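(* Consider the Cauchy problem $$u_{tt}(x,t)=\int_{\mathbb{R}} \alpha(y-x)\, w\big(u(y,t)-u(x,t)\big)\,dy,\quad x\in\mathbb{R},\ t>0,\qquad u(x,0)=\varphi(x),\ u_t(x,0)=\psi(x),$$ with $\alpha\in L^1(\mathbb{R})$, $w(0)=0$, and suppose one of the following holds: (i) $w\in C^1(\mathbb{R})$ and $X=C_b(\mathbb{R})$; (ii) $w\in C^1(\mathbb{R})$ and $X=L^p(\mathbb{R})\cap L^\infty(\mathbb{R})$ for some $1\le p\le\infty$; (iii) $w\in C^2(\mathbb{R})$ and $X=C^1_b(\mathbb{R})$; (iv) $w\in C^2(\mathbb{R})$ and $X=W^{1,p}(\mathbb{R})$ for some $1\le p\le\infty$; and let $\varphi,\psi\in X$. If there are constants $a,b$ with $|w(\eta)|\le a|\eta|+b$ for all $\eta\in\mathbb{R}$, then the Cauchy problem has a global solution, i.e. the solution $u\in C^2([0,T],X)$ exists for every $T>0$.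
   Context: $C_b(\mathbb{R})$: bounded continuous functions, sup norm. $C^1_b(\mathbb{R})$: differentiable functions with $u,u'$ bounded continuous, norm $\|u\|_\infty+\|u'\|_\infty$. $L^p\cap L^\infty$ with norm $\|u\|_p+\|u\|_\infty$. $W^{1,p}(\mathbb{R})$: $L^p$ functions with distributional derivative in $L^p$, norm $\|u\|_p+\|u'\|_p$. In each case the problem has a unique local solution in $C^2([0,T],X)$ for some $T>0$, which can be continued to a maximal existence interval. *)

(* Defs.v *)
From HB Require Import structures.
From mathcomp Require Import all_boot all_order all_algebra.
From mathcomp Require Import all_classical all_reals all_analysis.
Set Implicit Arguments. Unset Strict Implicit. Unset Printing Implicit Defensive.
Import Order.TTheory GRing.Theory Num.Theory.
Import numFieldNormedType.Exports.
Local Open Scope classical_set_scope.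
Local Open Scope ring_scope.

Section Peri.
Variable R : realType.
Local Notation mu := (@lebesgue_measure R).

Definition C1fun (w : R -> R) :=
  (forall x, derivable w x 1) /\ continuous (derive1 w).
Definition C2fun (w : R -> R) :=
  (forall x, derivable w x 1) /\ (forall x, derivable (derive1 w) x 1) /\
  continuous (derive1n 2 w).

(** L^p norm of a real function (p : \bar R, p = +oo gives the ess sup) *)
Definition Lpn (p : \bar R) (f : R -> R) : \bar R := Lnorm mu p (EFin \o f).
Definition inLp (p : \bar R) (f : R -> R) :=
  measurable_fun setT f /\ (Lpn p f < +oo)%E.

Definition supn (f : R -> R) : \bar R := ereal_sup [set `|f x|%:E | x in setT].

Definition inCb (f : R -> R) := continuous f /\ (supn f < +oo)%E.
Definition nCb (f : R -> R) : \bar R := supn f.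

(** X = C^1_b(R), norm ||u||_oo + ||u'||_oo (+oo if u is not differentiable) *)
Definition inC1b (f : R -> R) :=
  (forall x, derivable f x 1) /\ inCb f /\ inCb (derive1 f).
Definition nC1b (f : R -> R) : \bar R :=
  ereal_inf [set (supn f + supn g)%E | g in
                [set g : R -> R | forall x : R, is_derive x (1:R) f (g x)]].

Definition inLpI (p : \bar R) (f : R -> R) := inLp p f /\ inLp +oo%E f.
Definition nLpI (p : \bar R) (f : R -> R) : \bar R := (Lpn p f + Lpn +oo%E f)%E.

Definition test_fun (phi : R -> R) :=
  (forall n x, derivable (derive1n n phi) x 1) /\
  exists M : R, forall x, M < `|x| -> phi x = 0.

Definition weak_deriv (f g : R -> R) :=
  forall phi, test_fun phi ->
    (\int[mu]_x (f x * derive1 phi x)%R%:E = - \int[mu]_x (g x * phi x)%R%:E)%E.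

(** X = W^{1,p}(R), norm ||u||_p + ||u'||_p (+oo if no weak derivative) *)
Definition inW1p (p : \bar R) (f : R -> R) :=
  inLp p f /\ exists g, inLp p g /\ weak_deriv f g.
Definition nW1p (p : \bar R) (f : R -> R) : \bar R :=
  ereal_inf [set (Lpn p f + Lpn p g)%E | g in [set g | weak_deriv f g]].

Definition Xderiv (nX : (R -> R) -> \bar R) (T : R) (u v : R -> R -> R) (t : R) :=
  forall e : R, 0 < e -> exists2 d : R, 0 < d & forall s, 0 <= s <= T ->
    0 < `|s - t| < d ->
    (nX (fun x => ((u s x - u t x) / (s - t) - v t x)%R) < e%:E)%E.
Definition Xcont (nX : (R -> R) -> \bar R) (T : R) (u : R -> R -> R) (t : R) :=
  forall e : R, 0 < e -> exists2 d : R, 0 < d & forall s, 0 <= s <= T ->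
    `|s - t| < d -> (nX (fun x => (u s x - u t x)%R) < e%:E)%E.

Definition peri_op (alpha w : R -> R) (v : R -> R) : R -> R :=
  fun x => \int[mu]_y (alpha (y - x) * w (v y - v x)) : R.

(** u in C^2([0,T],X) solves u_tt = peri_op u, u(0)=phi, u_t(0)=psi
    (equalities in X, i.e. X-norm of the difference is zero) *)
Definition solves_on (inX : (R -> R) -> Prop) (nX : (R -> R) -> \bar R)
    (alpha w phi psi : R -> R) (T : R) (u : R -> R -> R) :=
  exists u1 u2 : R -> R -> R,
    [/\ forall t, 0 <= t <= T -> [/\ inX (u t), inX (u1 t) & inX (u2 t)],
        forall t, 0 <= t <= T -> Xderiv nX T u u1 t,
        forall t, 0 <= t <= T -> Xderiv nX T u1 u2 t,
        forall t, 0 <= t <= T -> Xcont nX T u2 t &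
        [/\ nX (fun x => u 0 x - phi x) = 0%E,
            nX (fun x => u1 0 x - psi x) = 0%E &
            forall t, 0 <= t <= T ->
              nX (fun x => u2 t x - peri_op alpha w (u t) x) = 0%E]].

Definition global_sol inX nX (alpha w phi psi : R -> R) :=
  forall T : R, 0 < T -> exists u, solves_on inX nX alpha w phi psi T u.

End Peri.

(* Main.v *)
(* The equation, together with the equation it implies for v = u_x, is an ODE for a state (u, v)
   whose right-hand side is controlled pointwise: if a weight G >= 0 satisfies
   int |alpha z| G (x + z) dz <= B G x, then |u| <= C G implies |u_tt| <= C' G.  Picard iteration
   therefore converges in sup |u (x, t)| / (e^(l t) G x), and all bounds in X reduce to the norm of
   the single function G.  Linear growth of w bounds the sup norm of the iterates on [0, T] a priori,
   so w enters through its Lipschitz constant on a fixed ball and no continuation argument is needed.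

   For the sup norm spaces G is constant.  In L^p one takes the p-th root of a Neumann series for the
   convolution with |alpha|, started at the p-th power of the data.  In W^(1,p) the same is done for
   u and v, where the data are replaced by absolutely continuous representatives and the relation
   u y - u x = int_x^y v passes to the limit of the iteration. *)
Require Import Defs.
From HB Require Import structures.
From mathcomp Require Import all_boot all_order all_algebra.
From mathcomp Require Import all_classical all_reals all_analysis.
From mathcomp Require Import measurable_realfun ess_sup_inf ring lra.
Set Implicit Arguments. Unset Strict Implicit. Unset Printing Implicit Defensive.
Import Order.TTheory GRing.Theory Num.Theory.
Import numFieldNormedType.Exports.
Local Open Scope classical_set_scope.
Local Open Scope ring_scope.

(** * Real-valued Lebesgue integrals on the line and their translation invariance *)

Section Integral.
Context {R : realType}.
Local Notation mu := (@lebesgue_measure R).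
Implicit Types (f g h : R -> R) (c x y : R).

(** Everything is done with real numbers at one point x at a time, so no integral of an X-valued
    function of time occurs: the iteration carries joint measurability in (t, x), and the C^2
    dependence on time comes from pointwise remainders of size |s - t|^2 G. The obstacle is that
    boundedness of a convolution on L^p is not a pointwise statement; the weight turns it into one.
    In L^1 the Neumann series is summed by Tonelli, and a p-th root carries the weight to L^p
    because averages against |alpha| obey Jensen's inequality up to a constant. Linear growth says
    nothing about v, but the equation for v is linear in v with coefficient w'(u(y) - u(x)), which
    the sup bound of u keeps bounded; the second derivative of w enters only to make this
    coefficient Lipschitz in u. The inequality for the weight of v may fail on a null set, and
    therefore the link between u and v is kept as an integral identity, which does not see such a
    set. *)

Definition intg f := mu.-integrable setT (EFin \o f).

Lemma measurable_shift c : measurable_fun [set: R] (fun z : R => z + c).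
Proof. exact: measurable_funD. Qed.

(** The image of the measure under the translation agrees with it on half-open intervals, and these
    determine Lebesgue measure. *)
Lemma lebesgue_measure_shift c (A : set R) : measurable A ->
  mu ((fun z => z + c) @^-1` A) = mu A.
Proof.
move=> mA; symmetry.
have mf : measurable_fun [set: measurableTypeR R] ((fun z => z + c) : R -> measurableTypeR R).
  exact: measurable_shift.
pose m : {measure set (measurableTypeR R) -> \bar R} :=
  measure_function_pushforward__canonical__measure_function_Measure mu mf.
apply: (@lebesgue_measure_unique R m) => //= X [[a b] _ <-] /=.
rewrite /pushforward.
have -> : (fun z => z + c) @^-1` `]a, b] = `]a - c, b - c]%classic.
  by apply/seteqP; split=> z /=; rewrite !in_itv/= ltrBlDr lerBrDr.
by rewrite !lebesgue_measure_itv/= !lte_fin ltrD2r; case: ifP => // _; congr _%:E; ring.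
Qed.

Lemma ge0_integral_shift c (f : R -> \bar R) : measurable_fun setT f ->
  (forall z, 0 <= f z)%E -> (\int[mu]_z f (z + c)%R = \int[mu]_z f z)%E.
Proof.
move=> mf f0.
have mph : measurable_fun [set: measurableTypeR R] ((fun z => z + c) : R -> measurableTypeR R).
  exact: measurable_shift.
have := @ge0_integral_pushforward _ _ _ _ R _ mph mu setT f measurableT mf (fun y _ => f0 y).
rewrite preimage_setT => <-.
apply: eq_measure_integral => A mA _.
exact: lebesgue_measure_shift.
Qed.

Lemma intg_meas f : intg f -> measurable_fun setT f.
Proof. by move/integrableP => [] /measurable_EFinP. Qed.

Lemma intgP f : intg f <-> measurable_fun setT f /\ (\int[mu]_z `|f z|%:E < +oo)%E.
Proof.
split=> [/integrableP[/measurable_EFinP mf ?]|[mf ?]]; first by split.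
by apply/integrableP; split => //; exact/measurable_EFinP.
Qed.

Lemma intg_dom f g : measurable_fun setT f -> (forall z, `|f z| <= g z) ->
  intg g -> intg f.
Proof.
move=> mf fg; apply: le_integrable => //; first exact/measurable_EFinP.
by move=> z _ /=; rewrite lee_fin (le_trans (fg z)) // ler_norm.
Qed.

Lemma intgD f g : intg f -> intg g -> intg (fun z => f z + g z).
Proof. by move=> hf hg; have := integrableD measurableT hf hg. Qed.

Lemma intgB f g : intg f -> intg g -> intg (fun z => f z - g z).
Proof. by move=> hf hg; have := integrableB measurableT hf hg. Qed.

Lemma intgZ c f : intg f -> intg (fun z => c * f z).
Proof. by move=> hf; have := integrableZl measurableT c hf. Qed.

Lemma intg_norm f : intg f -> intg (fun z => `|f z|).
Proof. by move=> /(integrable_norm); apply. Qed.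

Lemma RiD f g : intg f -> intg g ->
  \int[mu]_z (f z + g z) = \int[mu]_z f z + \int[mu]_z g z.
Proof. exact: RintegralD. Qed.

Lemma RiB f g : intg f -> intg g ->
  \int[mu]_z (f z - g z) = \int[mu]_z f z - \int[mu]_z g z.
Proof. exact: RintegralB. Qed.

Lemma RiZ c f : intg f -> \int[mu]_z (c * f z) = c * \int[mu]_z f z.
Proof. exact: RintegralZl. Qed.

Lemma eq_Ri f g : (forall z, f z = g z) -> \int[mu]_z f z = \int[mu]_z g z.
Proof. by move=> fg; apply: eq_Rintegral => z _; exact: fg. Qed.

Lemma Ri0 : \int[mu]_z (0 : R) = 0.
Proof. by rewrite /Rintegral integral0. Qed.

Lemma RiE f : intg f -> ((\int[mu]_z f z)%:E = \int[mu]_z (f z)%:E)%E.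
Proof. by move=> hf; rewrite fineK //; exact: integrable_fin_num. Qed.

Lemma le_Ri f g : intg f -> intg g -> (forall z, f z <= g z) ->
  \int[mu]_z f z <= \int[mu]_z g z.
Proof. by move=> hf hg fg; apply: le_Rintegral. Qed.

Lemma ler_norm_Ri f g : measurable_fun setT f -> intg g ->
  (forall z, `|f z| <= g z) -> `|\int[mu]_z f z| <= \int[mu]_z g z.
Proof.
move=> mf hg fg.
have hf := intg_dom mf fg hg.
apply: (le_trans (le_normr_Rintegral measurableT hf)).
by apply: le_Ri => //; exact: intg_norm.
Qed.

Lemma intg_shift c f : intg f -> intg (fun z => f (z + c)).
Proof.
move=> /intgP[mf hf]; apply/intgP; split.
  by apply: measurableT_comp mf _; exact: measurable_shift.
rewrite (ge0_integral_shift c (f := fun z => `|f z|%:E)) //.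
by apply/measurable_EFinP; exact: measurableT_comp.
Qed.

Lemma Ri_shift c f : measurable_fun setT f ->
  \int[mu]_z f (z + c) = \int[mu]_z f z.
Proof.
move=> mf; rewrite /Rintegral; congr fine.
have mf' : measurable_fun setT (EFin \o f) by exact/measurable_EFinP.
rewrite integralE [RHS]integralE; congr (_ - _)%E.
  rewrite -(ge0_integral_shift c (f := (EFin \o f)^\+%E)) //.
    by apply: eq_integral => z _; rewrite !funeposE.
  exact: measurable_funepos.
rewrite -(ge0_integral_shift c (f := (EFin \o f)^\-%E)) //.
  by apply: eq_integral => z _; rewrite !funenegE.
exact: measurable_funeneg.
Qed.

Lemma ae_imp (P Q : R -> Prop) : (forall x, P x -> Q x) ->
  (\forall x \ae mu, P x) -> \forall x \ae mu, Q x.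
Proof. by move=> PQ; apply: (@filterS _ _ (ae_filter_ringOfSetsType mu)). Qed.

Lemma ae_and (P Q : R -> Prop) : (\forall x \ae mu, P x) ->
  (\forall x \ae mu, Q x) -> \forall x \ae mu, P x /\ Q x.
Proof. by apply: (@filterS2 _ _ (ae_filter_ringOfSetsType mu)). Qed.

Lemma ae_shift (P : R -> Prop) c : (\forall x \ae mu, P x) -> \forall x \ae mu, P (x + c).
Proof.
move=> [N [mN N0 PN]]; exists ((fun z => z + c) @^-1` N); split.
- by rewrite -[X in measurable X]setTI; exact: (measurable_shift c).
- by rewrite -N0; exact: lebesgue_measure_shift.
- by move=> x /= nP; exact: PN.
Qed.

Lemma Ri_ae f g : measurable_fun setT f -> measurable_fun setT g ->
  (\forall z \ae mu, f z = g z) -> \int[mu]_z f z = \int[mu]_z g z.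
Proof.
move=> mf mg fg; rewrite /Rintegral; congr fine.
apply: ae_eq_integral => //; [exact/measurable_EFinP|exact/measurable_EFinP|].
refine (ae_imp _ fg) => z E _ /=; by rewrite E.
Qed.

(** No integrability is required: by Tonelli the integrals of the positive and of the negative part
    are measurable in the parameter, and [fine] is a measurable function. *)
Lemma measurable_Ri_param d (P : measurableType d) (F : P * R -> R) :
  measurable_fun setT F -> measurable_fun setT (fun p => \int[mu]_z F (p, z)).
Proof.
move=> mF; rewrite /Rintegral.
have mF' : measurable_fun setT (EFin \o F) by exact/measurable_EFinP.
apply: measurableT_comp; first exact: measurable_realfun.fine_measurable.
under eq_fun do rewrite integralE.
apply: emeasurable_funB.
  rewrite (_ : (fun _ => _) = fubini_F mu ((EFin \o F)^\+)%E); last first.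
    by apply/funext => p; apply: eq_integral => z _; rewrite !funeposE.
  by apply: measurable_fun_fubini_tonelli_F => //; exact: measurable_funepos.
rewrite (_ : (fun _ => _) = fubini_F mu ((EFin \o F)^\-)%E); last first.
  by apply/funext => p; apply: eq_integral => z _; rewrite !funenegE.
by apply: measurable_fun_fubini_tonelli_F => //; exact: measurable_funeneg.
Qed.

End Integral.

(** * Absolutely continuous functions *)

Section Primitive.
Context {R : realType}.
Local Notation mu := (@lebesgue_measure R).
Implicit Types (f g h w : R -> R) (c x y z r : R).

(** The indicator of []y, x]], used as a factor so that every integral, in space and in time, is
    taken over the whole line. *)
Definition ker y x r : R := ((y < r) && (r <= x))%:R.

Lemma ker_ge0 y x r : 0 <= ker y x r. Proof. exact: ler0n. Qed.

Lemma ker_le1 y x r : ker y x r <= 1.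
Proof. by rewrite /ker; case: (_ && _). Qed.

Lemma kerE y x : ker y x = \1_(`]y, x]%classic : set R).
Proof. by apply/funext => r; rewrite indicE mem_setE. Qed.

Lemma ker_cat y x z r : y <= x -> x <= z -> ker y x r + ker x z r = ker y z r.
Proof.
move=> yx xz; rewrite /ker.
have [rx|rx] := leP r x.
  by rewrite (le_trans rx xz) !andbT /= addr0.
by rewrite andbF add0r (le_lt_trans yx rx).
Qed.

Lemma measurable_ker y x : measurable_fun setT (ker y x).
Proof. by rewrite kerE; apply: measurable_indic. Qed.

Definition loc g := measurable_fun setT g /\ forall y x, intg (fun r => ker y x r * g r).

Lemma intg_ker y x : intg (ker y x).
Proof.
apply/intgP; split; first exact: measurable_ker.
under eq_integral do rewrite ger0_norm ?ker_ge0 // kerE.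
rewrite integral_indic //= setIT lebesgue_measure_itv /=.
by case: ifP => // _; rewrite ltry.
Qed.

Lemma Ri_ker y x : y <= x -> \int[mu]_r ker y x r = x - y.
Proof.
move=> yx; rewrite /Rintegral.
under eq_integral do rewrite kerE.
rewrite integral_indic //= setIT lebesgue_measure_itv /= lte_fin.
by move: yx; rewrite le_eqVlt => /orP[/eqP->|->]; rewrite ?ltxx ?subrr.
Qed.

(** [h] may be negative on the exceptional null set, so the comparison goes through [|h r|], which
    agrees with [h r] almost everywhere. *)
Lemma loc_dom_ae g h : measurable_fun setT g -> loc h ->
  (\forall r \ae mu, `|g r| <= h r) ->
  loc g /\ forall y x, \int[mu]_r (ker y x r * `|g r|) <= \int[mu]_r (ker y x r * h r).
Proof.
move=> mg [mh lh] gh.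
have mk y x k : measurable_fun setT k -> measurable_fun setT (fun r => ker y x r * k r).
  by move=> ?; apply: measurable_funM => //; exact: measurable_ker.
have mng : measurable_fun setT (fun r => `|g r|) by exact: measurableT_comp.
have le y x : (\int[mu]_r (ker y x r * `|g r|)%:E <= \int[mu]_r (ker y x r * `|h r|)%:E)%E.
  apply: ae_ge0_le_integral => //.
  - by move=> r _; rewrite lee_fin mulr_ge0 // ker_ge0.
  - by apply/measurable_EFinP; exact: mk.
  - by move=> r _; rewrite lee_fin mulr_ge0 // ker_ge0.
  - by apply/measurable_EFinP; apply: mk; exact: measurableT_comp.
  - refine (ae_imp _ gh) => r ghr _; rewrite lee_fin ler_wpM2l ?ker_ge0 //.
    by rewrite (le_trans ghr) // ler_norm.
have ih y x : intg (fun r => ker y x r * `|h r|).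
  have := intg_norm (lh y x).
  by under eq_fun do rewrite normrM (ger0_norm (ker_ge0 _ _ _)).
have ig y x : intg (fun r => ker y x r * `|g r|).
  apply/intgP; split; first exact: mk.
  under eq_integral do rewrite ger0_norm ?mulr_ge0 ?ker_ge0 //.
  by apply: le_lt_trans (le y x) _; rewrite -RiE // ltry.
split; first split=> // y x.
  apply/intgP; split; first exact: mk.
  under eq_integral do rewrite normrM (ger0_norm (ker_ge0 _ _ _)).
  by rewrite -RiE // ltry.
move=> y x; rewrite -lee_fin !RiE //; apply: le_trans (le y x) _.
rewrite le_eqVlt; apply/orP; left; apply/eqP; apply: ae_eq_integral => //.
- by apply/measurable_EFinP; apply: mk; exact: measurableT_comp.
- by apply/measurable_EFinP; exact: mk.
- by refine (ae_imp _ gh) => r ghr _; rewrite ger0_norm // (le_trans _ ghr).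
Qed.

Lemma loc_dom g h : measurable_fun setT g -> loc h -> (forall r, `|g r| <= h r) -> loc g.
Proof.
move=> mg lh gh; have gh' : \forall r \ae mu, `|g r| <= h r by exact: aeW.
exact: (loc_dom_ae mg lh gh').1.
Qed.

Lemma loc_cst c : loc (fun=> c).
Proof.
split=> // y x.
by under eq_fun do rewrite mulrC; apply: intgZ; exact: intg_ker.
Qed.

Lemma locD f g : loc f -> loc g -> loc (fun r => f r + g r).
Proof.
move=> [mf lf] [mg lg]; split; first exact: measurable_funD.
by move=> y x; under eq_fun do rewrite mulrDr; apply: intgD.
Qed.

Lemma locZ c f : loc f -> loc (fun r => c * f r).
Proof.
move=> [mf lf]; split; first exact: measurable_funM.
by move=> y x; under eq_fun do rewrite mulrCA; apply: intgZ.
Qed.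

Lemma loc_norm f : loc f -> loc (fun r => `|f r|).
Proof.
move=> [mf lf]; split; first exact: measurableT_comp.
move=> y x; have := intg_norm (lf y x).
by under eq_fun do rewrite normrM (ger0_norm (ker_ge0 _ _ _)).
Qed.

Lemma loc_intg f : intg f -> loc f.
Proof.
move=> hf; have mf := intg_meas hf; split => // y x.
apply: intg_dom (intg_norm hf) => [|r].
  by apply: measurable_funM => //; exact: measurable_ker.
by rewrite normrM (ger0_norm (ker_ge0 _ _ _)) ler_piMl // ker_le1.
Qed.

(* [f] is locally absolutely continuous with derivative [g] almost everywhere *)
Definition prim f g := loc g /\
  forall y x, y <= x -> f x - f y = \int[mu]_r (ker y x r * g r).

Lemma primD f g f' g' : prim f g -> prim f' g' ->
  prim (fun x => f x + f' x) (fun x => g x + g' x).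
Proof.
move=> [lg hf] [lg' hf']; split; first exact: locD.
move=> y x yx; under eq_Rintegral do rewrite mulrDr.
by rewrite RiD ?(lg.2, lg'.2) // -hf // -hf' //; ring.
Qed.

Lemma primZ c f g : prim f g -> prim (fun x => c * f x) (fun x => c * g x).
Proof.
move=> [lg hf]; split; first exact: locZ.
move=> y x yx; under eq_Rintegral do rewrite mulrCA.
by rewrite RiZ ?lg.2 // -hf //; ring.
Qed.

Lemma prim_cst c : prim (fun=> c) (fun=> 0).
Proof.
split; first exact: loc_cst.
by move=> y x _; rewrite subrr; under eq_Rintegral do rewrite mulr0; rewrite Ri0.
Qed.

Lemma primB f g f' g' : prim f g -> prim f' g' ->
  prim (fun x => f x - f' x) (fun x => g x - g' x).
Proof.
move=> hf /(primZ (-1)) hf'; have := primD hf hf'.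
by under eq_fun do rewrite mulN1r; under [in X in prim _ X]eq_fun do rewrite mulN1r.
Qed.

Lemma prim_ae f g g' : prim f g -> measurable_fun setT g' ->
  (\forall x \ae mu, g x = g' x) -> prim f g'.
Proof.
move=> [[mg lg] hf] mg' gg'.
have gg'K y x : \forall r \ae mu, ker y x r * g r = ker y x r * g' r.
  by apply: ae_imp gg' => r ->.
have mK y x k : measurable_fun setT k -> measurable_fun setT (fun r => ker y x r * k r).
  by move=> mk; apply: measurable_funM => //; exact: measurable_ker.
have lg' : loc g'.
  have ln : loc (fun r => `|g r|) by exact: (loc_norm (conj mg lg)).
  have h : \forall r \ae mu, `|g' r| <= `|g r| by apply: ae_imp gg' => r ->.
  by have [] := loc_dom_ae mg' ln h.
split => //.
move=> y x yx; rewrite hf //; apply: Ri_ae; [exact: mK|exact: mK|exact: gg'K].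
Qed.

Lemma Ri_ker_cat g y x z : loc g -> y <= x -> x <= z ->
  \int[mu]_r (ker y x r * g r) + \int[mu]_r (ker x z r * g r) =
  \int[mu]_r (ker y z r * g r).
Proof.
move=> [_ lg] yx xz; rewrite -RiD //; apply: eq_Ri => r.
by rewrite -mulrDl ker_cat.
Qed.

(** The derivatives converge only relative to a locally integrable weight. This suffices: the
    integral identity is off by at most [e n] times the integral of [G], and the estimate for
    [n = 0] makes [g] locally integrable. *)
Lemma prim_lim (fn gn : nat -> R -> R) f g G (e : nat -> R) :
  (forall n, prim (fn n) (gn n)) -> (forall x, fn n x @[n --> \oo] --> f x) ->
  loc G -> measurable_fun setT g ->
  (forall n x, `|gn n x - g x| <= e n * G x) -> e n @[n --> \oo] --> 0 ->
  prim f g.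
Proof.
move=> hp hf lG mg hg he.
have lg : loc g.
  apply: (loc_dom (h := fun r => `|gn 0%N r| + e 0%N * G r)) => //.
    by apply: locD; [exact/loc_norm/(hp 0%N).1|exact: locZ].
  move=> r; have := hg 0%N r; have := ler_normD (gn 0%N r) (g r - gn 0%N r).
  by rewrite addrC subrK distrC; lra.
split=> // y x yx.
have h1 : (fn n x - fn n y) @[n --> \oo] --> f x - f y by apply: cvgB.
apply: (cvg_unique _ h1) => //=.
apply/cvgrPdist_le => eps eps0.
have h2 : e n * (\int[mu]_r (ker y x r * G r)) @[n --> \oo] --> 0.
  by rewrite -[X in _ --> X](mul0r (\int[mu]_r (ker y x r * G r))); apply: cvgMl.
near=> n.
rewrite (hp n).2 // -RiB ?lg.2 ?(hp n).1.2 //.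
apply: (@le_trans _ _ (\int[mu]_r (e n * (ker y x r * G r)))).
  apply: ler_norm_Ri.
  - by apply: intg_meas; apply: intgB; [exact: lg.2|exact: (hp n).1.2].
  - by apply: intgZ; exact: lG.2.
  - move=> r; rewrite -mulrBr normrM (ger0_norm (ker_ge0 _ _ _)) mulrCA.
    by rewrite ler_wpM2l ?ker_ge0 // distrC.
rewrite RiZ ?lG.2 //.
near: n; have /cvgrPdist_le/(_ _ eps0) := h2.
by apply: filterS => n; rewrite sub0r normrN; apply: le_trans; exact: ler_norm.
Unshelve. all: by end_near. Qed.

End Primitive.

(** * Continuity and the chain rule for absolutely continuous functions *)

Section Chain.
Context {R : realType}.
Local Notation mu := (@lebesgue_measure R).
Implicit Types (f g h w : R -> R) (c x y z r : R).

(** Real induction, in place of a compactness argument: the supremum [s] of the points reached from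
    [y] can be passed by joining a reached point just before [s] to a point just after it. *)
Lemma segment_induction (P : R -> R -> Prop) y x : y <= x ->
  (forall a b c, a <= b -> b <= c -> P a b -> P b c -> P a c) ->
  (forall p, exists2 d, 0 < d & forall a b, p - d < a -> a <= p -> p <= b ->
     b < p + d -> P a b) -> P y x.
Proof.
move=> yx Pcat Ploc.
pose S := [set t | y <= t <= x /\ P y t].
have Sy : S y.
  split; first by rewrite lexx.
  by have [d d0] := Ploc y; apply; rewrite // ?ltrDl ?gtrDl ?oppr_lt0.
have supS : has_sup S.
  by split; [exists y|exists x => t [/andP[]]].
pose s := sup S.
have ys : y <= s by apply: ub_le_sup => //; exact: supS.2.
have sx : s <= x by apply: ge_sup; [exists y|move=> t [/andP[]]].
have [d d0 Pd] := Ploc s.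
have [t [/andP[yt tx] Pyt] tsd] := sup_adherent d0 supS.
have ts : t <= s by apply: ub_le_sup; [exact: supS.2|split=> //; rewrite yt].
pose s' := Num.min (s + d / 2) x.
have ss' : s <= s' by rewrite le_min sx andbT lerDl; lra.
have Pys' : P y s'.
  apply: Pcat Pyt _ => //; first exact: le_trans ss'.
  apply: Pd => //; rewrite gt_min; apply/orP; left; lra.
have s's : s' <= s.
  apply: ub_le_sup; first exact: supS.2.
  by split => //; rewrite (le_trans ys ss') /= ge_min lexx orbT.
move: s's; rewrite ge_min => /orP[|xs]; first by lra.
suff <- : s' = x by [].
by apply: min_r; rewrite (le_trans xs) // lerDl; lra.
Qed.

Lemma continuous_bounded_segment h y x : continuous h ->
  exists2 M, 0 <= M & forall r, y <= r <= x -> `|h r| <= M.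
Proof.
move=> ch; have [yx|xy] := leP y x; last first.
  by exists 0 => // r /andP[yr rx]; move: (le_lt_trans (le_trans yr rx) xy); rewrite ltxx.
have cn : {within `[y, x], continuous (fun r => `|h r|)}.
  apply: continuous_subspaceT => r.
  by apply: continuous_comp; [exact: ch|exact: norm_continuous].
have [c cI hc] := EVT_max yx cn.
by exists `|h c| => // r rI; apply: hc; rewrite in_itv.
Qed.

Lemma loc_mul_continuous h g : continuous h -> loc g -> loc (fun r => h r * g r).
Proof.
move=> ch [mg lg].
have mh : measurable_fun setT h by exact: continuous_measurable_fun.
split; first exact: measurable_funM.
move=> y x; have [M M0 hM] := continuous_bounded_segment y x ch.
apply: (intg_dom (g := fun r => M * `|ker y x r * g r|)).
- by apply: measurable_funM; [exact: measurable_ker|exact: measurable_funM].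
- move=> r; rewrite mulrCA normrM /ker.
  have [/andP[yr rx]|_] := boolP ((y < r) && (r <= x)); last first.
    by rewrite mul0r normr0 !mulr0.
  by rewrite ler_wpM2r // hM // (ltW yr).
- by apply: intgZ; apply: intg_norm; exact: lg.
Qed.

Lemma loc_continuous h : continuous h -> loc h.
Proof.
move=> ch; have := loc_mul_continuous ch (loc_cst 1).
by under eq_fun do rewrite mulr1.
Qed.

Lemma prim_norm f g y x : prim f g -> y <= x ->
  `|f x - f y| <= \int[mu]_r (ker y x r * `|g r|).
Proof.
move=> [lg hf] yx; rewrite hf //; apply: ler_norm_Ri.
- by apply: intg_meas; exact: lg.2.
- exact: (loc_norm lg).2.
- by move=> r; rewrite normrM (ger0_norm (ker_ge0 _ _ _)).
Qed.

Lemma prim_continuous f g : prim f g -> continuous f.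
Proof.
move=> hp p; have [lg _] := hp.
(* [g] is only locally integrable, so absolute continuity of the integral is applied to its
   restriction to []p - 1, p + 1]]. *)
pose F r := ker (p - 1) (p + 1) r * g r.
have iF : intg F by exact: lg.2.
apply/cvgrPdist_lt => e e0.
have [d [d0 hd]] := integral_normr_continuous iF e0.
have key y x : p - 1 <= y -> y <= x -> x <= p + 1 -> x - y < d -> `|f x - f y| < e.
  move=> py yx xp xyd; apply: le_lt_trans (prim_norm hp yx) _.
  have mI : measurable (`]y, x]%classic : set R) by [].
  have muI : (mu (`]y, x]%classic : set R) < d%:E)%E.
    by rewrite lebesgue_measure_itv /=; case: ifP => _; rewrite lte_fin.
  have := hd _ mI muI; rewrite Rintegral_mkcond; apply: le_lt_trans.
  rewrite le_eqVlt; apply/orP; left; apply/eqP; apply: eq_Ri => r.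
  rewrite patchE mem_setE /= in_itv /= /F /ker.
  case: ifP => [/andP[yr rx]|_]; last by rewrite mul0r.
  by rewrite (le_lt_trans py yr) (le_trans rx xp) !mul1r.
apply/nbhs_ballP; exists (Num.min d 1); first by rewrite /= lt_min d0 /=.
move=> q; rewrite /= /ball /= lt_min => /andP[pqd pq1].
have [pq|qp] := leP p q.
  by rewrite distrC; apply: key => //; move: pqd pq1; rewrite distrC ger0_norm ?subr_ge0 //; lra.
by apply: key; move: pqd pq1; rewrite ger0_norm ?subr_ge0 ?(ltW qp) //; lra.
Qed.

Lemma derivable_is_derive1 f x : derivable f x 1 -> is_derive x (1 : R) f (derive1 f x).
Proof. by move=> df; rewrite derive1E; apply: DeriveDef. Qed.

Lemma derivable_continuous f : (forall x, derivable f x 1) -> continuous f.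
Proof.
by move=> df x; apply: differentiable_continuous; apply/derivable1_diffP; exact: df.
Qed.

Lemma MVT_dist w y x : (forall x, derivable w x 1) ->
  exists2 c, Num.min y x <= c <= Num.max y x & w x - w y = derive1 w c * (x - y).
Proof.
move=> dw; have cw := derivable_continuous dw.
have [yx|xy] := leP y x.
  have [c] := @MVT_segment R w (derive1 w) y x yx (fun z _ => derivable_is_derive1 (dw z))
    (continuous_subspaceT cw).
  by rewrite in_itv /= => cI ->; exists c.
have [c] := @MVT_segment R w (derive1 w) x y (ltW xy) (fun z _ => derivable_is_derive1 (dw z))
  (continuous_subspaceT cw).
rewrite in_itv /= => cI wE; exists c => //.
by rewrite -opprB wE; ring.
Qed.

Lemma C1_strict_derivable w p : C1fun w -> forall e, 0 < e -> exists2 d, 0 < d &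
  forall x y, `|x - p| < d -> `|y - p| < d ->
    `|w x - w y - derive1 w p * (x - y)| <= e * `|x - y|.
Proof.
move=> [dw cw] e e0.
have /cvgrPdist_lt/(_ _ e0)[d /= d0 hd] := cw p.
exists d => // x y xp yp.
have [c cI ->] := MVT_dist y x dw.
rewrite -mulrBl normrM ler_wpM2r // ltW // distrC; apply: hd => /=.
move: cI xp yp; rewrite ge_min le_max !ltr_norml.
by move=> /andP[/orP[?|?] /orP[?|?]] /andP[? ?] /andP[? ?]; lra.
Qed.

(** [f] need not be differentiable at every point. Near [p] the increment of [w (f x)] is compared
    with [derive1 w (f p) * (f b - f a)] by strict differentiability of [w], and this with the
    integral by continuity of [derive1 w (f r)]. Each of the two errors is at most [e'] times the
    integral of [|g|]. *)
Lemma chain_prim f g w : C1fun w -> prim f g ->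
  prim (fun x => w (f x)) (fun x => derive1 w (f x) * g x).
Proof.
move=> Cw hp; have [lg hf] := hp.
have cf := prim_continuous hp.
have ch : continuous (fun r => derive1 w (f r)).
  by move=> r; apply: continuous_comp; [exact: cf|exact: Cw.2].
have lh := loc_mul_continuous ch lg.
split => // y x yx; apply/eqP; rewrite -subr_eq0 -normr_le0; apply/ler_addgt0Pr => e e0.
rewrite add0r.
have I0 : 0 <= \int[mu]_r (ker y x r * `|g r|).
  by apply: Rintegral_ge0 => r _; rewrite mulr_ge0 ?ker_ge0.
pose e' := e / (2 * (1 + \int[mu]_r (ker y x r * `|g r|))).
have e'0 : 0 < e' by rewrite divr_gt0 // mulr_gt0 // ltr_pwDl.
pose P a b := a <= b -> `|w (f b) - w (f a) - \int[mu]_r (ker a b r * (derive1 w (f r) * g r))|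
   <= 2 * e' * \int[mu]_r (ker a b r * `|g r|).
(* The linearisation error is additive over adjacent intervals, hence it is enough to bound it
   on short ones. *)
suff : P y x.
  move=> /(_ yx)/le_trans; apply.
  rewrite /e'; move: I0; set I := (X in 0 <= X -> _) => I0.
  have -> : 2 * (e / (2 * (1 + I))) * I = e * (I / (1 + I)) by field; lra.
  by rewrite -[leRHS]mulr1 ler_wpM2l ?(ltW e0) // ler_pdivrMr ?mul1r; lra.
apply: segment_induction => // [a b c ab bc Pab Pbc _|p].
  rewrite -(Ri_ker_cat lh ab bc) -(Ri_ker_cat (loc_norm lg) ab bc) mulrDr.
  have := lerD (Pab ab) (Pbc bc); apply: le_trans.
  by rewrite (le_trans _ (ler_normD _ _)) // le_eqVlt; apply/orP; left; apply/eqP; congr `|_|; ring.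
have [d1 d10 hd1] := C1_strict_derivable (f p) Cw e'0.
have /cvgrPdist_lt/(_ _ d10)[d2 /= d20 hd2] := cf p.
have /cvgrPdist_lt/(_ _ e'0)[d3 /= d30 hd3] := ch p.
exists (Num.min d2 d3); first by rewrite lt_min d20.
move=> a b pa ap pb bp ab.
have near_p r : a <= r -> r <= b -> `|p - r| < Num.min d2 d3.
  by move=> ar rb; rewrite ltr_norml; lra.
have near2 r : a <= r -> r <= b -> `|f r - f p| < d1.
  move=> ar rb; rewrite distrC; apply: hd2 => /=.
  by have := near_p r ar rb; rewrite lt_min => /andP[].
have near3 r : a <= r -> r <= b -> `|derive1 w (f p) - derive1 w (f r)| < e'.
  move=> ar rb; apply: hd3 => /=.
  by have := near_p r ar rb; rewrite lt_min => /andP[].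
have E1 := hd1 _ _ (near2 b ab (lexx b)) (near2 a (lexx a) ab).
have E2 : `|derive1 w (f p) * (f b - f a) - \int[mu]_r (ker a b r * (derive1 w (f r) * g r))|
    <= e' * \int[mu]_r (ker a b r * `|g r|).
  rewrite hf // -(RiZ _ (lg.2 a b)) -(RiB (intgZ _ (lg.2 a b)) (lh.2 a b)).
  rewrite -(RiZ _ ((loc_norm lg).2 a b)); apply: ler_norm_Ri.
  - by apply: intg_meas; apply: intgB; [apply: intgZ; exact: lg.2|exact: lh.2].
  - by apply: intgZ; exact: (loc_norm lg).2.
  - move=> r; rewrite (mulrCA (derive1 w (f p))) -mulrBr -mulrBl !normrM (ger0_norm (ker_ge0 _ _ _)).
    rewrite (mulrCA e') /ker; have [/andP[ar rb]|_] := boolP ((a < r) && (r <= b)); last by rewrite !mul0r.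
    by rewrite !mul1r ler_wpM2r // ltW // near3 // ltW.
have E3 := ler_wpM2l (ltW e'0) (prim_norm hp ab).
move: E1 E2 E3; set I := \int[mu]_r _ => E1 E2 E3.
have := ler_normD (w (f b) - w (f a) - derive1 w (f p) * (f b - f a))
  (derive1 w (f p) * (f b - f a) - I).
rewrite addrA subrK; lra.
Qed.

End Chain.

(** * Taylor estimate, product rule and weak derivatives *)

Section Primitive_calculus.
Context {R : realType}.
Local Notation mu := (@lebesgue_measure R).
Implicit Types (f g h w : R -> R) (c x y z r : R).

Lemma Ri_ker_taylor v y x c e : loc v -> y <= x ->
  (forall r, y <= r <= x -> `|v r - c| <= e) ->
  `|\int[mu]_r (ker y x r * v r) - c * (x - y)| <= e * (x - y).
Proof.
move=> [mv lv] yx hv.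
have ik := intg_ker y x.
rewrite -(Ri_ker yx) -(RiZ c ik) -(RiZ e ik) -(RiB (lv y x) (intgZ c ik)).
apply: ler_norm_Ri.
- by apply: intg_meas; apply: intgB => //; apply: intgZ; exact: intg_ker.
- by apply: intgZ; exact: intg_ker.
- move=> r; rewrite mulrC -mulrBl normrM (ger0_norm (ker_ge0 _ _ _)) /ker.
  have [/andP[yr rx]|_] := boolP ((y < r) && (r <= x)); last by rewrite !mulr0.
  by rewrite !mulr1 hv // (ltW yr).
Qed.

Lemma prim_taylor f g x y c e : prim f g ->
  (forall r, `|r - x| <= `|y - x| -> `|g r - c| <= e) ->
  `|f y - f x - c * (y - x)| <= e * `|y - x|.
Proof.
move=> [lg hf] hg; have [xy|/ltW yx] := leP x y.
  have xy0 : 0 <= y - x by rewrite subr_ge0.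
  rewrite hf // (ger0_norm xy0); apply: Ri_ker_taylor => // r /andP[xr ry].
  by apply: hg; rewrite !ger0_norm ?subr_ge0 // lerB.
have yx0 : 0 <= x - y by rewrite subr_ge0.
rewrite (_ : _ - _ = - (f x - f y - c * (x - y))); last by ring.
rewrite normrN hf // (distrC y) (ger0_norm yx0).
apply: Ri_ker_taylor => // r /andP[yr rx]; apply: hg.
by rewrite (distrC r) (distrC y) !ger0_norm ?subr_ge0 // lerB.
Qed.

Lemma prim_is_derive f g x : prim f g -> {for x, continuous g} -> is_derive x (1 : R) f (g x).
Proof.
move=> hp cg.
have H : h^-1 *: (f (h *: (1 : R) + x) - f x) @[h --> 0^'] --> g x.
  apply/cvgrPdist_le => e e0.
  have /cvgrPdist_lt/(_ _ e0)/nbhs_ballP[d /= d0 hd] := cg.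
  exists d => //= h /= ; rewrite sub0r normrN => hd' h0.
  have := @prim_taylor f g x (h + x) (g x) e hp.
  rewrite addrK scaler1 => /(_ _)/wrap[r rh|H].
    by rewrite distrC ltW // hd // /ball /= distrC (le_lt_trans rh).
  rewrite -[X in X - _](mulKf h0) (_ : _ *: _ = h^-1 * (f (h + x) - f x)) // -mulrBr normrM normfV.
  by rewrite mulrC ler_pdivrMr ?normr_gt0 // distrC mulrC.
apply: DeriveDef; first by apply/cvg_ex; exists (g x).
by apply: cvg_lim.
Qed.

Lemma prim_id : prim (id : R -> R) (fun=> 1).
Proof.
split; first exact: loc_cst.
by move=> y x yx; under eq_Rintegral do rewrite mulr1; rewrite Ri_ker.
Qed.

Lemma C1_prim f : C1fun f -> prim f (derive1 f).
Proof.
move=> Cf; have := chain_prim Cf prim_id.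
by under [X in prim _ X]eq_fun do rewrite mulr1.
Qed.

Lemma sqr_C1 : C1fun (fun x : R => x * x) /\ forall x, derive1 (fun x : R => x * x) x = 2 * x.
Proof.
have H x : is_derive x 1 (fun x : R => x * x) (2 * x).
  apply: is_derive_eq; rewrite /GRing.scale /=; ring.
have E x : derive1 (fun x : R => x * x) x = 2 * x by rewrite derive1E; apply: derive_val.
split=> //; split=> [x|]; first exact: ex_derive.
rewrite (funext E) => x; apply: cvgMr; exact: cvg_id.
Qed.

(* By polarisation the product rule reduces to the chain rule for squares. *)
Lemma prim_mul f g f' g' : prim f g -> prim f' g' ->
  prim (fun x => f x * f' x) (fun x => g x * f' x + f x * g' x).
Proof.
move=> hf hf'; have [Csq Esq] := sqr_C1.
have h1 := chain_prim Csq (primD hf hf').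
have h2 := chain_prim Csq (primB hf hf').
have := primZ (4^-1) (primB h1 h2).
congr prim; apply/funext => x.
  by field.
by rewrite !Esq; field.
Qed.

(** Integration by parts: the product rule for [f * phi] on []- N, N]], with vanishing boundary
    terms. *)
Lemma prim_weak_deriv f g : prim f g -> weak_deriv f g.
Proof.
move=> hp phi [dphi [M hM]].
have d0 x : derivable phi x 1 by exact: (dphi 0%N).
have d1 x : derivable (derive1 phi) x 1 by exact: (dphi 1%N).
have Cphi : C1fun phi := conj d0 (derivable_continuous d1).
have phip := C1_prim Cphi.
have cf := prim_continuous hp.
have cphi := derivable_continuous d0.
have cphi' := derivable_continuous d1.
have hM' x : M < `|x| -> derive1 phi x = 0.
  move=> Mx.
  have : \forall z \near x, phi z = (fun=> 0) z.
    have := @norm_continuous _ R x; rewrite /continuous_at => /cvgrPdist_lt.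
    have : 0 < `|x| - M by rewrite subr_gt0.
    move=> /[swap] /[apply]; apply: filterS => z hz; apply: hM.
    by move: hz; rewrite ltr_norml; lra.
  by rewrite derive1E => /near_eq_derive ->; exact: derive_cst.
(* Strictly beyond [M], so that [phi] vanishes at both end points; [M] itself may be negative. *)
pose N := `|M| + 1.
have NM : M < N by rewrite /N; have := ler_norm M; lra.
have N0 : 0 <= N by rewrite /N addr_ge0.
have kN k r : (M < `|r| -> k r = 0) -> ker (- N) N r * k r = k r.
  rewrite /ker => hk; have [|] := boolP ((- N < r) && (r <= N)); first by rewrite mul1r.
  rewrite mul0r => /negP h; rewrite hk //; apply: contrapT => /negP; rewrite -leNgt => rM; apply: h.
  by have := le_lt_trans rM NM; rewrite ltr_norml => /andP[-> /ltW].
have [lh hh] := prim_mul hp phip.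
have l1 : loc (fun x => g x * phi x).
  by under eq_fun do rewrite mulrC; apply: loc_mul_continuous => //; exact: hp.1.
have l2 : loc (fun x => f x * derive1 phi x).
  by apply: loc_mul_continuous => //; exact: loc_continuous.
have NN : - N <= N by lra.
have := hh _ _ NN.
rewrite !hM ?normrN ?ger0_norm // !mulr0 subrr.
under eq_Rintegral do rewrite mulrDr.
rewrite RiD ?l1.2 ?l2.2 //.
have e1 r : ker (- N) N r * (g r * phi r) = g r * phi r.
  by apply: (kN (fun r => g r * phi r)) => /hM ->; rewrite mulr0.
have e2 r : ker (- N) N r * (f r * derive1 phi r) = f r * derive1 phi r.
  by apply: (kN (fun r => f r * derive1 phi r)) => /hM' ->; rewrite mulr0.
have i1 : intg (fun r => g r * phi r) by rewrite -(funext e1); exact: l1.2.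
have i2 : intg (fun r => f r * derive1 phi r) by rewrite -(funext e2); exact: l2.2.
rewrite (funext e1) (funext e2) => /eqP; rewrite eq_sym addrC addr_eq0 => /eqP E.
by rewrite -!RiE // E.
Qed.

End Primitive_calculus.

(** * Continuity and differentiation under the integral sign *)

Section Kernel.
Context {R : realType}.
Local Notation mu := (@lebesgue_measure R).

Lemma kernel_continuous (k : R -> R) (f : R -> R -> R) (C : R) :
  intg k -> (forall s, continuous (f s)) -> (forall x, measurable_fun setT (f^~ x)) ->
  (forall s x, `|k s * f s x| <= C * `|k s|) -> continuous (fun x => \int[mu]_s (k s * f s x)).
Proof.
move=> ik cf mf fC x.
have := @continuity_under_integral R _ _ mu (fun x s => k s * f s x) setT measurableT (x - 1) (x + 1).
have mk := intg_meas ik.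
apply.
- move=> z _; apply: (@intg_dom R _ (fun s => C * `|k s|)).
  + exact: measurable_funM.
  + by move=> s; exact: fC.
  + by apply: intgZ; exact: intg_norm.
- by apply: aeW => s _ z _; apply: cvgMr; exact: cf.
- by apply: (@intgZ R C (fun s => `|k s|)); exact: intg_norm.
- by move=> z _; apply: aeW => s _; exact: fC.
- by rewrite inE /= in_itv /=; lra.
Qed.

Lemma measurable_swap_param (h : R -> R -> R) :
  measurable_fun setT (fun p : R * R => h p.1 p.2) ->
  measurable_fun setT (fun p : R * R => h p.2 p.1).
Proof.
move=> mh; apply: (measurableT_comp mh (g := fun p : R * R => (p.2, p.1))).
exact: measurable_fun_pair.
Qed.

(** Fubini for [ker y x r * (k s * g s r)]; the bound by [K] makes this function integrable on the
    plane. It is asked only for almost every [r], because an L^p weight dominates its convolution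
    only almost everywhere. *)
Lemma kernel_prim (k : R -> R) (f g : R -> R -> R) (K : R -> R) :
  measurable_fun setT k ->
  measurable_fun setT (fun p : R * R => g p.1 p.2) ->
  (forall s, prim (f s) (g s)) ->
  (forall x, intg (fun s => k s * f s x)) -> loc K ->
  (\forall r \ae mu, intg (fun s => k s * g s r) /\ \int[mu]_s `|k s * g s r| <= K r) ->
  prim (fun x => \int[mu]_s (k s * f s x)) (fun r => \int[mu]_s (k s * g s r)).
Proof.
move=> mk mg hp ikf lK hK.
set G := fun r => \int[mu]_s (k s * g s r).
have mkg : measurable_fun setT (fun p : R * R => k p.1 * g p.1 p.2).
  by apply: measurable_funM => //; exact: measurableT_comp.
have mkg' := @measurable_swap_param (fun s r => k s * g s r) mkg.
have mG : measurable_fun setT G by exact: (measurable_Ri_param mkg').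
pose h y x (p : R * R) : R := ker y x p.1 * (k p.2 * g p.2 p.1).
have mh y x : measurable_fun setT (EFin \o h y x).
  apply/measurable_EFinP; apply: measurable_funM => //.
  by apply: measurableT_comp => //; exact: measurable_ker.
have GK : \forall r \ae mu, `|G r| <= K r.
  refine (ae_imp _ hK) => r [ir].
  by apply: le_trans; exact: le_normr_Rintegral.
have mkK y x : measurable_fun setT (fun r => `|ker y x r * K r|%:E).
  by apply/measurable_EFinP; apply: measurableT_comp => //; exact: intg_meas (lK.2 y x).
have ih y x : (mu \x mu)%E.-integrable setT (EFin \o h y x).
  apply/integrable12ltyP; first exact: mh.
  have /intgP[_ hb] := lK.2 y x; apply: le_lt_trans hb.
  apply: ae_ge0_le_integral => //.
  - by move=> r _; exact: integral_ge0.
  - apply: (measurable_fun_fubini_tonelli_F (m2 := mu) (abse \o (EFin \o h y x))) => //.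
      by apply: (measurableT_comp (f := abse)); [exact: abse_measurable|exact: mh].
    by move=> p; exact: abse_ge0.
  - exact: mkK.
  - refine (ae_imp _ hK) => r [ir rK] _ /=.
    under eq_integral do rewrite /h /= normrM.
    rewrite -RiE; last by apply: intgZ; exact: intg_norm.
    rewrite RiZ ?intg_norm // lee_fin normrM ler_wpM2l //.
    by rewrite (le_trans rK) // ler_norm.
have [lG _] := loc_dom_ae mG lK GK.
split => // y x yx.
rewrite -RiB //.
have := Fubini (ih y x) => /(congr1 fine).
rewrite [in X in X -> _](_ : (\int[mu]_r \int[mu]_s (EFin \o h y x) (r, s) =
   \int[mu]_r (ker y x r * G r)%:E)%E); last first.
  apply: ae_eq_integral => //.
  - exact: (measurable_fubini_F (ih y x)).
  - by apply/measurable_EFinP; exact: intg_meas (lG.2 y x).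
  - refine (ae_imp _ hK) => r [ir rK] _ /=.
    by rewrite -RiZ // RiE //; exact: intgZ.
rewrite [in X in X -> _](_ : (\int[mu]_s \int[mu]_r (EFin \o h y x) (r, s) =
   \int[mu]_s (k s * f s x - k s * f s y)%:E)%E); last first.
  apply: eq_integral => s _ /=.
  rewrite -mulrBr (hp s).2 // -RiZ ?(hp s).1.2 // RiE; last first.
    by apply: intgZ; exact: (hp s).1.2.
  by apply: eq_integral => r _; rewrite /h /= mulrCA.
by move=> E; rewrite /Rintegral E.
Qed.

End Kernel.

(** * Picard iteration in weighted norms *)

Section Picard.
Context {R : realType}.
Local Notation mu := (@lebesgue_measure R).

(** The integral from 0 to [t]; for negative [t] it is 0, not the oriented integral. *)
Definition J (f : R -> R) (t : R) : R := \int[mu]_s (ker 0 t s * f s).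

Lemma loc_bounded (f : R -> R) (c : R) : measurable_fun setT f ->
  (forall s, `|f s| <= c) -> loc f.
Proof. by move=> mf fc; apply: loc_dom (loc_cst c) fc. Qed.

Lemma JB f g t : loc f -> loc g -> J (fun s => f s - g s) t = J f t - J g t.
Proof.
move=> [_ lf] [_ lg]; rewrite /J -RiB //; apply: eq_Ri => s; exact: mulrBr.
Qed.

Lemma J_cat f s t : loc f -> 0 <= s -> s <= t -> J f t - J f s = \int[mu]_r (ker s t r * f r).
Proof. by move=> lf s0 st; rewrite /J -(Ri_ker_cat lf s0 st) addrC addKr. Qed.

Lemma J0 f : J f 0 = 0.
Proof.
rewrite /J (eq_Ri (g := fun=> 0)) ?Ri0 // => s; rewrite /ker.
have [/andP[s0 s0']|_] := boolP ((0 < s) && (s <= 0)); last by rewrite mul0r.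
by move: (lt_le_trans s0 s0'); rewrite ltxx.
Qed.

(** The source of both time derivatives: if [f] is Lipschitz, [e] can be taken proportional to
    [|s - t|] and the remainder is quadratic. Confining [r] to [[0, max s t]] lets estimates known
    only on [[0, T]] be used. *)
Lemma J_taylor f s t c e : loc f -> 0 <= s -> 0 <= t ->
  (forall r, 0 <= r -> r <= Num.max s t -> `|r - t| <= `|s - t| -> `|f r - c| <= e) ->
  `|J f s - J f t - c * (s - t)| <= e * `|s - t|.
Proof.
move=> lf s0 t0 hf; have [ts|/ltW st] := leP t s.
  have st0 : 0 <= s - t by rewrite subr_ge0.
  rewrite J_cat // (ger0_norm st0); apply: Ri_ker_taylor => // r /andP[tr rs].
  by apply: hf; rewrite ?(le_trans t0) ?le_max ?rs // !ger0_norm ?subr_ge0 // lerB.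
have ts0 : 0 <= t - s by rewrite subr_ge0.
rewrite (_ : _ - _ = - (J f t - J f s - c * (t - s))); last by ring.
rewrite normrN J_cat // (distrC s) (ger0_norm ts0); apply: Ri_ker_taylor => // r /andP[sr rt].
apply: hf; rewrite ?(le_trans s0) ?le_max ?rt ?orbT //.
by rewrite (distrC r) (distrC s) !ger0_norm ?subr_ge0 // lerB.
Qed.

Lemma J_lipschitz f s t e : loc f -> 0 <= s -> 0 <= t ->
  (forall r, 0 <= r -> r <= Num.max s t -> `|r - t| <= `|s - t| -> `|f r| <= e) ->
  `|J f s - J f t| <= e * `|s - t|.
Proof.
move=> lf s0 t0 hf; have := @J_taylor f s t 0 e lf s0 t0.
by rewrite mul0r subr0; apply=> r r0 rm rt; rewrite subr0 hf.
Qed.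

Lemma Ri_ker_expR (l t : R) : 0 <= t ->
  \int[mu]_s (ker 0 t s * (l * expR (l * s))) = expR (l * t) - 1.
Proof.
move=> t0.
have D (x : R) : is_derive x (1 : R) (fun s : R => expR (l * s)) (l * expR (l * x)).
  apply: is_derive_eq; rewrite /GRing.scale /=; ring.
have E : derive1 (fun s : R => expR (l * s)) = fun x => l * expR (l * x).
  by apply/funext => x; rewrite derive1E; exact: derive_val.
have C : C1fun (fun s : R => expR (l * s)).
  split=> [x|]; first exact: ex_derive.
  rewrite E => x; apply: cvgMr.
  by apply: (derivable_continuous (f := fun s : R => expR (l * s))) => y; exact: ex_derive.
have [_ H] := C1_prim C.
by have := H 0 t t0; rewrite E mulr0 expR0 => ->.
Qed.

(** Each integration in time gains a factor [l^-1] on functions of size [expR (l * t)]. Two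
    integrations gain [l^-2], which makes the iteration contract and the a priori bounds close for
    large [l]. *)
Lemma J_expR f l t c : 0 < l -> 0 <= t -> 0 <= c -> loc f ->
  (forall s, 0 <= s -> `|f s| <= c * expR (l * s)) -> `|J f t| <= c / l * expR (l * t).
Proof.
move=> l0 t0 c0 lf hf.
have lE : loc (fun s => l * expR (l * s)).
  apply: locZ; apply: loc_continuous => x.
  apply: continuous_comp; last exact: continuous_expR.
  by apply: cvgMr; exact: cvg_id.
apply: (@le_trans _ _ (c / l * (expR (l * t) - 1))); last first.
  by rewrite ler_wpM2l ?divr_ge0 ?(ltW l0) // lerBlDr lerDl.
rewrite -Ri_ker_expR // -RiZ ?lE.2 //; apply: ler_norm_Ri.
- by apply: intg_meas; exact: lf.2.
- by apply: intgZ; exact: lE.2.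
- move=> s; rewrite normrM (ger0_norm (ker_ge0 _ _ _)) mulrCA /ker.
  have [/andP[s0 st]|_] := boolP ((0 < s) && (s <= t)); last by rewrite !mul0r.
  rewrite !mul1r; apply: le_trans (hf s (ltW s0)) _.
  by rewrite mulrA divfK ?gt_eqF.
Qed.

(** The intervals with centre [a n] and radius [2 * K / 2 ^+ n] are nested, since the radius drops
    by exactly [K / 2 ^+ n] at each step. The limit is the supremum of the left ends, and it comes
    with the explicit rate on which convergence relative to the weight relies. *)
Lemma geometric_cauchy (a : nat -> R) (K : R) :
  (forall n, `|a n.+1 - a n| <= K / 2 ^+ n) ->
  exists l, forall n, `|a n - l| <= 2 * K / 2 ^+ n.
Proof.
move=> ha.
have K0 : 0 <= K by have := ha 0%N; rewrite expr0 divr1; exact: le_trans.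
have E n : 2 * K / 2 ^+ n.+1 = K / 2 ^+ n.
  by rewrite exprS; field; rewrite expf_neq0.
have E' n : 2 * K / 2 ^+ n = K / 2 ^+ n + K / 2 ^+ n by rewrite -mulrA mulrDl mul1r.
have lo n m : (n <= m)%N -> a n - 2 * K / 2 ^+ n <= a m - 2 * K / 2 ^+ m.
  elim: m => [|m IH]; first by rewrite leqn0 => /eqP ->.
  rewrite leq_eqVlt => /orP[/eqP -> //|/IH]; move/le_trans; apply.
  by rewrite E E'; have := ha m; rewrite ler_norml; lra.
have up n m : (n <= m)%N -> a m + 2 * K / 2 ^+ m <= a n + 2 * K / 2 ^+ n.
  elim: m => [|m IH]; first by rewrite leqn0 => /eqP ->.
  rewrite leq_eqVlt => /orP[/eqP -> //|/IH]; apply: le_trans.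
  by rewrite E E'; have := ha m; rewrite ler_norml; lra.
have lu n m : a n - 2 * K / 2 ^+ n <= a m + 2 * K / 2 ^+ m.
  have := lo _ _ (leq_maxl n m); have := up _ _ (leq_maxr n m).
  have : 0 <= 2 * K / 2 ^+ maxn n m by rewrite divr_ge0 ?mulr_ge0 ?exprn_ge0.
  lra.
pose S := [set a n - 2 * K / 2 ^+ n | n in setT].
have S0 : S !=set0 by exists (a 0%N - 2 * K / 2 ^+ 0), 0%N.
exists (sup S) => n; rewrite ler_distl; apply/andP; split.
  rewrite lerBlDr; apply: ge_sup => // _ [m _ <-]; exact: lu.
rewrite -lerBlDr; apply: ub_le_sup; last by exists n.
by exists (a 0%N + 2 * K / 2 ^+ 0) => _ [m _ <-]; exact: lu.
Qed.

Variables (I : Type) (G : I -> R) (T : R) (phi psi : I -> R).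
Variables (F : (I -> R) -> I -> R) (Q : (R -> I -> R) -> Prop) (U0 : R -> I -> R).
Variables (L C : R).

(* Trajectories are cut off outside [0, T], so that bounds on them hold for all times. *)
Definition chi (t : R) : R := ((0 <= t) && (t <= T))%:R.

Definition picard1 (U : R -> I -> R) (t : R) (i : I) := psi i + J (fun r => F (U r) i) t.
Definition picard (U : R -> I -> R) (t : R) (i : I) :=
  chi t * (phi i + J (fun s => picard1 U s i) t).

(** [Q] collects the a priori bounds and the regularity of the iterates. Lipschitz continuity of [F]
    is asked only on [Q], as [w] is only locally Lipschitz; in exchange [Q] has to be stable under
    the iteration and closed under limits that are uniform relative to [G]. *)
Hypotheses (G0 : forall i, 0 <= G i) (L0 : 0 <= L) (C0 : 0 <= C).
Hypothesis QU0 : Q U0.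
Hypothesis Qpicard : forall U, Q U -> Q (picard U).
Hypothesis Qlipschitz : forall U V, Q U -> Q V -> forall s t c, 0 <= c ->
  (forall i, `|U s i - V t i| <= c * G i) ->
  forall i, `|F (U s) i - F (V t) i| <= L * c * G i.
Hypothesis Qbounded : forall U, Q U -> forall t i, `|U t i| <= C * G i.
Hypothesis Qmeasurable : forall U, Q U -> forall i, loc (fun t => F (U t) i).
Hypothesis Qmeasurable1 : forall U, Q U -> forall i, loc (fun t => picard1 U t i).
Hypothesis Qlimit : forall (Un : nat -> R -> I -> R) U e, (forall n, Q (Un n)) ->
  (forall n t i, `|Un n t i - U t i| <= e n * G i) -> e n @[n --> \oo] --> 0 -> Q U.

Lemma picard_dist U V c l : 0 < l -> 0 <= c -> Q U -> Q V ->
  (forall t i, `|U t i - V t i| <= c * expR (l * `|t|) * G i) ->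
  forall t i, `|picard U t i - picard V t i| <= L / l ^+ 2 * c * expR (l * `|t|) * G i.
Proof.
move=> l0 c0 QU QV UV t i; rewrite /picard /chi.
have [/andP[t0 tT]|_] := boolP ((0 <= t) && (t <= T)); last first.
  by rewrite !mul0r subr0 normr0 !mulr_ge0 ?invr_ge0 ?exprn_ge0 ?expR_ge0 ?(ltW l0) //.
rewrite !mul1r (_ : _ - _ = J (fun s => picard1 U s i) t - J (fun s => picard1 V s i) t);
  last by ring.
rewrite -JB; [|exact: Qmeasurable1|exact: Qmeasurable1].
rewrite (ger0_norm t0) (_ : L / l ^+ 2 * c * expR (l * t) * G i =
  (L * c * G i / l) / l * expR (l * t)); last by field; rewrite gt_eqF.
apply: J_expR => //.
- by rewrite divr_ge0 ?(ltW l0) // !mulr_ge0.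
- by have := locD (Qmeasurable1 QU i) (locZ (-1) (Qmeasurable1 QV i)); under eq_fun do rewrite mulN1r.
- move=> s s0; rewrite (_ : picard1 U s i - _ =
    J (fun r => F (U r) i) s - J (fun r => F (V r) i) s); last by rewrite /picard1; ring.
  rewrite -JB; [|exact: Qmeasurable|exact: Qmeasurable].
  apply: J_expR => //.
  + by rewrite !mulr_ge0.
  + by have := locD (Qmeasurable QU i) (locZ (-1) (Qmeasurable QV i)); under eq_fun do rewrite mulN1r.
  + move=> r r0; have := Qlipschitz QU QV (s := r) (t := r) (c := c * expR (l * r)).
    rewrite (_ : L * c * G i * _ = L * (c * expR (l * r)) * G i); last by ring.
    apply; first by rewrite mulr_ge0 ?expR_ge0.
    by move=> j; have := UV r j; rewrite (ger0_norm r0).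
Qed.

Lemma picard_fixpoint : exists2 U, Q U & forall t i, U t i = picard U t i.
Proof.
(* With this [l] the iteration contracts sup_(t, i) |U t i| / (expR (l |t|) G i) by 1/2. *)
pose l := 1 + 2 * L.
have L0' := L0.
have l0 : 0 < l by rewrite /l ltr_pwDl // mulr_ge0.
have Ll : L / l ^+ 2 <= 2^-1.
  rewrite ler_pdivrMr ?exprn_gt0 // /l; have LL := mulr_ge0 L0 L0.
  by rewrite (_ : 2^-1 * _ = 2^-1 + 2 * L + 2 * (L * L)); [lra|field].
pose U n := iter n picard U0.
have QU n : Q (U n) by elim: n => //= n; exact: Qpicard.
have dU n t i : `|U n.+1 t i - U n t i| <= 2 * C / 2 ^+ n * expR (l * `|t|) * G i.
  elim: n t i => [|n IH] t i.
    rewrite expr0 divr1.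
    apply: le_trans (ler_normB _ _) _.
    have := lerD (Qbounded (QU 1%N) t i) (Qbounded (QU 0%N) t i).
    move/le_trans; apply; rewrite -mulrDl ler_wpM2r // (_ : C + C = 2 * C * 1); last by ring.
    by rewrite ler_wpM2l ?mulr_ge0 // -expR0 ler_expR mulr_ge0 // ltW.
  have := @picard_dist (U n.+1) (U n) (2 * C / 2 ^+ n) l l0 _ (QU _) (QU _) IH t i.
  move=> /(_ _)/wrap[]; first by rewrite divr_ge0 ?mulr_ge0 ?exprn_ge0.
  move/le_trans; apply; rewrite ler_wpM2r // ler_wpM2r ?expR_ge0 //.
  rewrite [leRHS](_ : _ = 2^-1 * (2 * C / 2 ^+ n)); last first.
    by rewrite exprS; field; rewrite expf_neq0.
  by rewrite ler_wpM2r // divr_ge0 ?mulr_ge0 ?exprn_ge0.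
have /choice[V0 HV0] ti : exists v, forall n, `|U n ti.1 ti.2 - v| <=
    4 * C / 2 ^+ n * expR (l * `|ti.1|) * G ti.2.
  have [|v hv] := @geometric_cauchy (fun n => U n ti.1 ti.2) (2 * C * expR (l * `|ti.1|) * G ti.2).
    move=> n; apply: le_trans (dU n _ _) _.
    by rewrite le_eqVlt; apply/orP; left; apply/eqP; ring.
  exists v => n; apply: le_trans (hv n) _.
  by rewrite le_eqVlt; apply/orP; left; apply/eqP; ring.
pose V t i := V0 (t, i).
have HV n t i : `|U n t i - V t i| <= 4 * C / 2 ^+ n * expR (l * `|t|) * G i := HV0 (t, i) n.
have cvg2 K : (K / 2 ^+ n : R) @[n --> \oo] --> 0.
  rewrite -[X in _ --> X](mulr0 K); apply: cvgMr.
  under eq_fun do rewrite -exprVn; apply: cvg_expr.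
  by rewrite ger0_norm ?invf_lt1 ?invr_ge0 // ltr1n.
have out n t i : ~~ ((0 <= t) && (t <= T)) -> U n.+1 t i = 0.
  by move=> h; rewrite /= /picard /chi (negbTE h) mul0r.
have cvgU t i : U n.+1 t i @[n --> \oo] --> V t i.
  apply/cvgrPdist_le => e e0.
  have := cvg2 (4 * C * expR (l * `|t|) * G i / 2); move=> /cvgrPdist_le/(_ _ e0).
  apply: filterS => n; rewrite sub0r normrN => h.
  rewrite distrC; apply: le_trans (HV _ _ _) _; apply: le_trans (le_trans (ler_norm _) h).
  by rewrite le_eqVlt exprS; apply/orP; left; apply/eqP; field; rewrite expf_neq0.
have V_out t i : ~~ ((0 <= t) && (t <= T)) -> V t i = 0.
  move=> h; have := cvgU t i; under eq_fun do rewrite out //.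
  by move/(cvg_unique (@norm_hausdorff _ _)); apply; exact: cvg_cst.
(* The factor [expR (l * |t|)] is unbounded in time, but the trajectories vanish outside [[0, T]],
   so [expR (l * T)] serves for all [t]. The index is [n.+1] because nothing forces [U0] to vanish
   there. *)
have HV' n t i : `|U n.+1 t i - V t i| <= (4 * C * expR (l * T) / 2) / 2 ^+ n * G i.
  have [/andP[t0 tT]|h] := boolP ((0 <= t) && (t <= T)); last first.
    by rewrite out // V_out // subr0 normr0 mulr_ge0 // divr_ge0 ?exprn_ge0 // divr_ge0 // !mulr_ge0.
  apply: le_trans (HV _ _ _) _; rewrite ler_wpM2r //.
  rewrite (_ : 4 * C * _ / 2 / _ = 4 * C / 2 ^+ n.+1 * expR (l * T)); last first.
    by rewrite exprS; field; rewrite expf_neq0.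
  rewrite ler_wpM2l ?divr_ge0 ?mulr_ge0 ?exprn_ge0 //.
  by rewrite ler_expR ger0_norm // ler_wpM2l // ltW.
have QV : Q V by apply: (Qlimit (fun n => QU n.+1) HV' (cvg2 _)).
exists V => // t i.
apply/eqP; rewrite -subr_eq0 -normr_le0; apply/ler_addgt0Pr => e e0; rewrite add0r.
(* The two errors below are [2^-1] and [L / l ^+ 2] times the same quantity
   [4 * C * expR (l * |t|) * G i / 2 ^+ n]. *)
have e'0 : 0 < e / (2^-1 + L / l ^+ 2).
  by rewrite divr_gt0 // ltr_pwDl // divr_ge0 // exprn_ge0 // ltW.
near \oo => n.
have d1 := HV n.+1 t i.
have d2 := @picard_dist (U n) V (4 * C / 2 ^+ n) l l0 _ (QU _) QV (HV n) t i.
have {}d2 := d2 (divr_ge0 (mulr_ge0 (ler0n _ 4) C0) (exprn_ge0 n (ler0n _ 2))).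
have : `|V t i - picard V t i| <= `|U n.+1 t i - V t i| + `|picard (U n) t i - picard V t i|.
  by rewrite (distrC _ (V t i)); apply: ler_distD.
move/le_trans; apply; apply: le_trans (lerD d1 d2) _.
have small : (4 * C * expR (l * `|t|) * G i) / 2 ^+ n <= e / (2^-1 + L / l ^+ 2).
  near: n; have /cvgrPdist_le/(_ _ e'0) := cvg2 (4 * C * expR (l * `|t|) * G i).
  by apply: filterS => n; rewrite sub0r normrN; apply: le_trans; exact: ler_norm.
move: small; rewrite ler_pdivlMr; last first.
  by rewrite ltr_pwDl // divr_ge0 // exprn_ge0 // ltW.
apply: le_trans; rewrite le_eqVlt exprS; apply/orP; left; apply/eqP.
by field; rewrite ?expf_neq0 // gt_eqF.
Unshelve. all: by end_near. Qed.

End Picard.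

(** * The equation for a function and its space derivative *)

Section System.
Context {R : realType}.
Local Notation mu := (@lebesgue_measure R).
Local Notation state := (bool * R -> R).
Implicit Types (S : state) (U V : R -> state).

Lemma le_sum4 (p q r s : R) : 0 <= p -> 0 <= q -> 0 <= r -> 0 <= s ->
  [/\ 0 <= p + q + r + s, p <= p + q + r + s, q <= p + q + r + s,
      r <= p + q + r + s & s <= p + q + r + s].
Proof. by move=> *; split; lra. Qed.

Definition smeas S := forall b, measurable_fun setT (fun x : R => S (b, x)).
(** Joint measurability in time and space is what Tonelli and Fubini require of a trajectory. *)
Definition jmeas U := forall b, measurable_fun setT (fun p : R * R => U p.1 (b, p.2)).

Lemma jmeas_slice U t : jmeas U -> smeas (U t).
Proof.
move=> mU b; apply: (measurableT_comp (mU b) (g := fun x : R => (t, x))).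
exact: measurable_fun_pair.
Qed.

Lemma jmeas_time U i : jmeas U -> measurable_fun setT (U^~ i).
Proof.
case: i => b x mU; apply: (measurableT_comp (mU b) (g := fun t : R => (t, x))).
exact: measurable_fun_pair.
Qed.

Lemma jmeas_cst S : smeas S -> jmeas (fun=> S).
Proof. by move=> mS b; apply: (measurableT_comp (mS b)). Qed.

Lemma jmeasD U V : jmeas U -> jmeas V -> jmeas (fun t i => U t i + V t i).
Proof. by move=> mU mV b; apply: measurable_funD; [exact: mU|exact: mV]. Qed.

Lemma jmeasZ (k : R -> R) U : measurable_fun setT k -> jmeas U -> jmeas (fun t i => k t * U t i).
Proof.
move=> mk mU b; apply: measurable_funM; last exact: mU.
exact: measurableT_comp.
Qed.

Lemma smeasD S S' : smeas S -> smeas S' -> smeas (fun i => S i + S' i).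
Proof. by move=> mS mS' b; apply: measurable_funD; [exact: mS|exact: mS']. Qed.

Lemma smeasZ c S : smeas S -> smeas (fun i => c * S i).
Proof. by move=> mS b; apply: measurable_funM => //; exact: mS. Qed.

Lemma measurable_bool d (X : measurableType d) (P : X -> bool) :
  measurable_fun setT P -> measurable_fun setT (fun x => (P x)%:R : R).
Proof.
move=> mP; rewrite (_ : (fun x => _) = (fun x => if P x then 1 else 0)); last first.
  by apply/funext => x; case: (P x).
exact: measurable_fun_ifT.
Qed.

Lemma jmeas_J U : jmeas U -> jmeas (fun t i => J (U^~ i) t).
Proof.
move=> mU b; rewrite /J.
apply: (measurable_Ri_param (F := fun q : (R * R) * R => ker 0 q.1.1 q.2 * U q.2 (b, q.1.2))).
apply: measurable_funM; last first.
  apply: (measurableT_comp (mU b) (g := fun q : (R * R) * R => (q.2, q.1.2))).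
  apply: measurable_fun_pair => //.
  exact: measurableT_comp.
rewrite /ker; apply: measurable_bool; apply: measurable_and.
  exact: measurable_fun_ltr.
apply: measurable_fun_ler => //.
exact: measurableT_comp.
Qed.

Variables (alpha w w1 : R -> R) (D : set R) (G : state) (T a b g0 B : R) (phi psi : state).
Variable Ex : state -> Prop.
Let A := \int[mu]_z `|alpha z|.

(* A state [S] consists of u = S (true, .) and its space derivative v = S (false, .).  When v plays
   no role, [w1] is 0; otherwise it is w'.  [D] is a set of full measure on which the weight of v
   is finite: v is frozen outside it. *)
Definition dom (i : bool * R) : bool := i.1 || (i.2 \in D).

(** The substitution y = z + x leaves [alpha z] free of x, so that the derivative in x falls on [S]
    alone. The second branch is the formal x-derivative of the first when [w1] is w'. *)
Definition kern S (c : bool) (x z : R) : R :=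
  if c then w (S (true, z + x) - S (true, x))
  else w1 (S (true, z + x) - S (true, x)) * (S (false, z + x) - S (false, x)).

Definition field_op S (i : bool * R) : R :=
  (dom i)%:R * \int[mu]_z (alpha z * kern S i.1 i.2 z).

Definition locally_lipschitz (f : R -> R) := forall M, exists2 L, 0 <= L &
  forall x y, `|x| <= M -> `|y| <= M -> `|f x - f y| <= L * `|x - y|.

Hypotheses (ialpha : intg alpha) (mw : measurable_fun setT w) (mw1 : measurable_fun setT w1).
Hypotheses (wlip : locally_lipschitz w) (w1lip : locally_lipschitz w1).
Hypotheses (w0 : w 0 = 0) (a0 : 0 <= a) (b0 : 0 <= b).
Hypothesis growth : forall x, `|w x| <= a * `|x| + b.
Hypotheses (mD : measurable D) (G_ge0 : forall i, 0 <= G i).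
Hypotheses (G_bnd : forall x, G (true, x) <= g0) (B0 : 0 <= B).
Hypothesis G_conv : forall i, dom i -> intg (fun z => `|alpha z| * G (i.1, z + i.2)) /\
  \int[mu]_z (`|alpha z| * G (i.1, z + i.2)) <= B * G i.

Lemma A_ge0 : 0 <= A. Proof. by apply: Rintegral_ge0. Qed.

Lemma weighted_conv_le (H : R -> R) k i : 0 <= k -> dom i -> measurable_fun setT H ->
  (forall z, `|H z| <= k * (G (i.1, z + i.2) + G i)) ->
  intg (fun z => alpha z * H z) /\
  \int[mu]_z `|alpha z * H z| <= k * (B + A) * G i.
Proof.
move=> k0 di mH hH; have [i1 h1] := G_conv di.
have ma := intg_meas ialpha.
have maH : measurable_fun setT (fun z => alpha z * H z) by exact: measurable_funM.
have i2 : intg (fun z => k * (`|alpha z| * G (i.1, z + i.2) + G i * `|alpha z|)).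
  by apply: intgZ; apply: intgD => //; apply: intgZ; exact: intg_norm.
have dom_le z : `|alpha z * H z| <= k * (`|alpha z| * G (i.1, z + i.2) + G i * `|alpha z|).
  rewrite normrM (mulrC (G i)) -mulrDr mulrCA.
  by rewrite ler_wpM2l.
have i4 := intg_dom maH dom_le i2; split=> //.
apply: le_trans (le_Ri (intg_norm i4) i2 dom_le) _.
have i3 : intg (fun z => G i * `|alpha z|) by apply: intgZ; exact: intg_norm.
rewrite RiZ; last exact: intgD.
rewrite RiD // RiZ ?intg_norm // -mulrA ler_wpM2l // mulrDl lerD //.
by rewrite mulrC.
Qed.

Lemma locally_lipschitz_bounded (f : R -> R) M : locally_lipschitz f ->
  exists2 C, 0 <= C & forall x, `|x| <= M -> `|f x| <= C.
Proof.
move=> /(_ M)[L L0 hL]; exists (L * `|M| + `|f 0|); first by rewrite addr_ge0 // mulr_ge0.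
move=> x xM; have := hL x 0 xM; rewrite normr0 subr0 => /(_ (le_trans (normr_ge0 x) xM)) h.
have := ler_normD (f x - f 0) (f 0); rewrite subrK.
have := ler_wpM2l L0 (le_trans xM (ler_norm M)).
lra.
Qed.

(** In the difference of the products, [w1 u * (v - v')] needs [w1] bounded, and
    [(w1 u - w1 u') * v'] needs [w1] Lipschitz. In the latter the weight of [u] is estimated by
    [g0], so that only one factor of the weight survives. The arguments of [w] and [w1] are
    differences, hence the ball of radius [2 * M]. *)
Lemma kern_estimates M C : 0 <= C -> exists2 X, 0 <= X &
  forall S S', (forall x, `|S (true, x)| <= M) -> (forall x, `|S' (true, x)| <= M) ->
    (forall i, `|S' i| <= C * G i) ->
  forall c, 0 <= c -> (forall i, `|S i - S' i| <= c * G i) -> forall d x z,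
   `|kern S d x z - kern S' d x z| <= X * c * (G (d, z + x) + G (d, x)).
Proof.
move=> C0.
have [L L0 hL] := wlip (2 * M).
have [L1 L10 hL1] := w1lip (2 * M).
have [B1 B10 hB1] := locally_lipschitz_bounded (2 * M) w1lip.
have g00 : 0 <= g0 := le_trans (G_ge0 (true, 0)) (G_bnd 0).
exists (L + B1 + 2 * L1 * g0 * C).
  by rewrite !addr_ge0 // !mulr_ge0.
move=> S S' hS hS' hC c c0 hc d x z.
have diff (P : state) : (forall x, `|P (true, x)| <= M) -> `|P (true, z + x) - P (true, x)| <= 2 * M.
  move=> hP; apply: le_trans (ler_normB _ _) _.
  by have := hP x; have := hP (z + x); lra.
have dist e : `|(S (e, z + x) - S (e, x)) - (S' (e, z + x) - S' (e, x))| <=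
   c * (G (e, z + x) + G (e, x)).
  rewrite (_ : _ - _ - _ = (S (e, z + x) - S' (e, z + x)) - (S (e, x) - S' (e, x))); last by ring.
  by apply: le_trans (ler_normB _ _) _; rewrite mulrDr lerD.
have GG e : 0 <= G (e, z + x) + G (e, x) by rewrite addr_ge0.
have X1 : 0 <= 2 * L1 * g0 * C by rewrite !mulr_ge0.
case: d; rewrite /kern.
  apply: le_trans (hL _ _ (diff _ hS) (diff _ hS')) _.
  apply: le_trans (ler_wpM2l L0 (dist true)) _.
  rewrite mulrA ler_wpM2r // ler_wpM2r //.
  by rewrite -addrA lerDl addr_ge0.
set u := S (true, z + x) - _; set v := S (false, z + x) - _.
set u' := S' (true, z + x) - _; set v' := S' (false, z + x) - _.
rewrite (_ : _ - _ = w1 u * (v - v') + (w1 u - w1 u') * v'); last by ring.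
have E1 : `|w1 u * (v - v')| <= B1 * (c * (G (false, z + x) + G (false, x))).
  by rewrite normrM ler_pM // ?hB1 ?diff //; exact: dist.
have E2 : `|v'| <= C * (G (false, z + x) + G (false, x)).
  by apply: le_trans (ler_normB _ _) _; rewrite mulrDr lerD.
have E3 : `|w1 u - w1 u'| <= L1 * (c * (2 * g0)).
  apply: le_trans (hL1 _ _ (diff _ hS) (diff _ hS')) _.
  rewrite ler_wpM2l //; apply: le_trans (dist true) _; rewrite ler_wpM2l //.
  by have := G_bnd x; have := G_bnd (z + x); lra.
have E4 : `|(w1 u - w1 u') * v'| <= L1 * (c * (2 * g0)) * (C * (G (false, z + x) + G (false, x))).
  by rewrite normrM ler_pM.
apply: le_trans (ler_normD _ _) _; apply: le_trans (lerD E1 E4) _.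
rewrite (_ : _ + _ = (B1 + 2 * L1 * g0 * C) * c * (G (false, z + x) + G (false, x))); last by ring.
by rewrite ler_wpM2r // ler_wpM2r // -addrA lerDr.
Qed.

Lemma kern0 d x z : kern (fun=> 0) d x z = 0.
Proof. by case: d; rewrite /kern !subrr ?w0 // mulr0. Qed.

Lemma kern_jmeas U d : jmeas U ->
  measurable_fun setT (fun q : (R * R) * R => kern (U q.1.1) d q.1.2 q.2).
Proof.
move=> mU.
have m1 e : measurable_fun setT (fun q : (R * R) * R => U q.1.1 (e, q.2 + q.1.2)).
  apply: (measurableT_comp (mU e) (g := fun q : (R * R) * R => (q.1.1, q.2 + q.1.2))).
  apply: measurable_fun_pair; first exact: measurableT_comp.
  by apply: measurable_funD => //; exact: measurableT_comp.
have m2 e : measurable_fun setT (fun q : (R * R) * R => U q.1.1 (e, q.1.2)).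
  exact: (measurableT_comp (mU e) measurable_fst).
have m3 e := measurable_funB (m1 e) (m2 e).
case: d; rewrite /kern.
  by apply: (measurableT_comp mw); exact: (m3 true).
apply: measurable_funM; last exact: m3.
by apply: (measurableT_comp mw1); exact: (m3 true).
Qed.

Lemma kern_meas S d x : smeas S -> measurable_fun setT (kern S d x).
Proof.
move=> mS; have mk := kern_jmeas d (jmeas_cst mS).
apply: (measurableT_comp mk (g := fun z : R => ((0 : R, x), z))).
exact: measurable_fun_pair.
Qed.

Lemma jmeas_field U : jmeas U -> jmeas (fun t => field_op (U t)).
Proof.
move=> mU d; apply: measurable_funM.
  rewrite /dom /=; case: d => //=.
  exact: (measurableT_comp (measurable_indic mD) measurable_snd).
apply: (measurable_Ri_param (F := fun q : (R * R) * R => alpha q.2 * kern (U q.1.1) d q.1.2 q.2)).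
apply: measurable_funM; last exact: kern_jmeas.
by apply: measurableT_comp => //; exact: intg_meas.
Qed.

Lemma field_estimates M C : 0 <= C -> exists2 X, 0 <= X &
  forall S S', smeas S -> smeas S' ->
    (forall x, `|S (true, x)| <= M) -> (forall x, `|S' (true, x)| <= M) ->
    (forall i, `|S' i| <= C * G i) ->
  forall c, 0 <= c -> (forall i, `|S i - S' i| <= c * G i) -> forall i,
   `|field_op S i - field_op S' i| <= X * c * G i.
Proof.
move=> C0; have [X X0 hX] := kern_estimates M C0.
exists (X * (B + A)); first by rewrite mulr_ge0 // addr_ge0 // A_ge0.
move=> S S' mS mS' hS hS' hC c c0 hc [d x]; rewrite /field_op /=.
case: (boolP (dom (d, x))) => di; last first.
  rewrite !mul0r subrr normr0 !mulr_ge0 // addr_ge0 //; exact: A_ge0.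
rewrite !mul1r.
have M0 : 0 <= M by apply: le_trans (hS 0).
have hX0 P : (forall x, `|P (true, x)| <= M) -> forall k, 0 <= k -> (forall i, `|P i| <= k * G i) ->
    forall d x z, `|kern P d x z| <= X * k * (G (d, z + x) + G (d, x)).
  move=> hP k k0 hk d' x' z.
  have := hX P (fun=> 0) hP _ _ k k0 _ d' x' z; rewrite kern0 subr0; apply.
  - by move=> ?; rewrite normr0.
  - by move=> ?; rewrite normr0 mulr_ge0.
  - by move=> j; rewrite subr0.
have hS2 j : `|S j| <= (C + c) * G j.
  have := ler_normD (S j - S' j) (S' j); rewrite subrK.
  by have := hC j; have := hc j; rewrite mulrDl; lra.
have iS : intg (fun z => alpha z * kern S d x z).
  refine (@weighted_conv_le (kern S d x) (X * (C + c)) (d, x) _ di (kern_meas _ _ mS) _).1.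
    by rewrite mulr_ge0 // addr_ge0.
  by move=> z; apply: hX0 => //; rewrite addr_ge0.
have iS' : intg (fun z => alpha z * kern S' d x z).
  refine (@weighted_conv_le (kern S' d x) (X * C) (d, x) _ di (kern_meas _ _ mS') _).1.
    by rewrite mulr_ge0.
  by move=> z; exact: hX0.
rewrite -RiB //; apply: le_trans (le_normr_Rintegral measurableT (intgB iS iS')) _.
under eq_Rintegral do rewrite -mulrBr.
rewrite (_ : X * (B + A) * c = X * c * (B + A)); last by ring.
refine (@weighted_conv_le (fun z => kern S d x z - kern S' d x z) (X * c) (d, x) _ di _ _).2.
- by rewrite mulr_ge0.
- by apply: measurable_funB; exact: kern_meas.
- by move=> z; exact: hX.
Qed.

(** The comparison with the zero state, whose weighted bound is 0, yields an [X] that depends on [M]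
    but not on [c]. This reflects that the equation for v is linear in v, and it allows the weighted
    bound of the solution to be chosen after [X]. *)
Lemma field_bound M : exists2 X, 0 <= X &
  forall S, smeas S -> (forall x, `|S (true, x)| <= M) ->
  forall c, 0 <= c -> (forall i, `|S i| <= c * G i) -> forall i,
   `|field_op S i| <= X * c * G i.
Proof.
have [X X0 hX] := field_estimates M (lexx 0).
exists X => // S mS hS c c0 hc i.
have M0 : 0 <= M by apply: le_trans (hS 0).
have := hX S (fun=> 0) mS _ hS _ _ c c0 _ i.
rewrite [X in `|_ - X|](_ : _ = 0) ?subr0; last first.
  rewrite /field_op; under eq_Rintegral do rewrite kern0 mulr0.
  by rewrite Ri0 mulr0.
apply.
- by move=> ?; exact: measurable_cst.
- by move=> ?; rewrite normr0.
- by move=> ?; rewrite normr0 mul0r.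
- by move=> j; rewrite subr0.
Qed.

(* The bound does not depend on the Lipschitz constants of [w]: this is what makes the solution
   global, and the only use of the growth condition. *)
Lemma field_growth S N : smeas S -> (forall x, `|S (true, x)| <= N) ->
  forall x, `|field_op S (true, x)| <= A * (2 * a * N + b).
Proof.
move=> mS hS x; rewrite /field_op /= mul1r.
have mk := kern_meas true x mS.
apply: (@le_trans _ _ (\int[mu]_z ((2 * a * N + b) * `|alpha z|))); last first.
  rewrite RiZ; last exact: intg_norm.
  by rewrite (mulrC A).
apply: ler_norm_Ri.
- by apply: measurable_funM => //; exact: intg_meas.
- by apply: intgZ; exact: intg_norm.
- move=> z; rewrite normrM mulrC ler_wpM2r // /kern.
  apply: le_trans (growth _) _; rewrite lerD2r (mulrC 2) -mulrA ler_wpM2l //.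
  by apply: le_trans (ler_normB _ _) _; have := hS x; have := hS (z + x); lra.
Qed.

Hypotheses (T0 : 0 <= T) (mphi : smeas phi) (mpsi : smeas psi).
Hypotheses (phi_le : forall i, `|phi i| <= G i) (psi_le : forall i, `|psi i| <= G i).
(** [Ex] is the regularity that a weighted bound does not express, such as continuity or u being a
    primitive of v. It only has to survive the operations of which the iteration consists. *)
Hypotheses (Ex0 : Ex (fun=> 0)) (Exphi : Ex phi) (Expsi : Ex psi).
Hypothesis ExD : forall S S', Ex S -> Ex S' -> Ex (fun i => S i + S' i).
Hypothesis ExZ : forall c S, Ex S -> Ex (fun i => c * S i).
Hypothesis Exlim : forall (Sn : nat -> state) S (e : nat -> R), (forall n, Ex (Sn n)) -> smeas S ->
  (forall n i, `|Sn n i - S i| <= e n * G i) -> e n @[n --> \oo] --> 0 -> Ex S.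
Hypothesis Exfield : forall S M C, smeas S -> (forall x, `|S (true, x)| <= M) ->
  (forall i, `|S i| <= C * G i) -> Ex S -> Ex (field_op S).
Hypothesis ExJ : forall U t C, jmeas U -> 0 <= t -> (forall s i, 0 <= s <= t -> `|U s i| <= C * G i) ->
  (forall s, Ex (U s)) -> Ex (fun i => J (U^~ i) t).

Local Notation pic := (picard T phi psi field_op).
Local Notation pic1 := (picard1 psi field_op).

Lemma J_neg (f : R -> R) t : t <= 0 -> J f t = 0.
Proof.
move=> t0; rewrite /J (eq_Ri (g := fun=> 0)) ?Ri0 // => s; rewrite /ker.
have [/andP[s0 st]|_] := boolP ((0 < s) && (s <= t)); last by rewrite mul0r.
by move: (lt_le_trans s0 (le_trans st t0)); rewrite ltxx.
Qed.

Lemma J_le (f : R -> R) t e : loc f -> (forall s, `|f s| <= e) -> `|J f t| <= e * `|t|.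
Proof.
move=> lf hf; have [t0|/ltW t0] := leP 0 t; last first.
  by rewrite J_neg // normr0 mulr_ge0 // (le_trans _ (hf 0)).
by have := @J_lipschitz _ f t 0 e lf t0 (lexx 0) (fun r _ _ _ => hf r); rewrite J0 !subr0.
Qed.

Lemma loc_affine (f : R -> R) (c e : R) : measurable_fun setT f ->
  (forall t, `|f t| <= c + e * `|t|) -> loc f.
Proof.
move=> mf hf; apply: (loc_dom (h := fun t => c + e * `|t|)) => //.
apply: loc_continuous => t; apply: cvgD; first exact: cvg_cst.
by apply: cvgMr; exact: norm_continuous.
Qed.

Lemma jmeas_pic1 U : jmeas U -> jmeas (pic1 U).
Proof.
move=> mU; apply: (jmeasD (jmeas_cst mpsi)).
exact: (jmeas_J (jmeas_field mU)).
Qed.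

Lemma jmeas_pic U : jmeas U -> jmeas (pic U).
Proof.
move=> mU; apply: jmeasZ; last exact: (jmeasD (jmeas_cst mphi) (jmeas_J (jmeas_pic1 mU))).
rewrite /chi; apply: measurable_bool; apply: measurable_and; exact: measurable_fun_ler.
Qed.

(** A bound [c * expR (l * t)] reproduces itself: the data contribute at most [m * (1 + T)], which
    is at most [c / 2], and the double time integral at most [X * c / l ^+ 2], again at most
    [c / 2], times the exponential. It serves both the sup bound of u and the weighted bound of the
    state. *)
Lemma picard_bound U i m c l X : 0 < l -> 0 <= c -> 0 <= X ->
  loc (fun r => field_op (U r) i) -> loc (fun r => pic1 U r i) ->
  `|phi i| <= m -> `|psi i| <= m -> m * (1 + T) <= c / 2 -> 2 * X <= l ^+ 2 ->
  (forall r, 0 <= r -> `|field_op (U r) i| <= X * c * expR (l * r)) ->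
  forall t, `|pic U t i| <= c * expR (l * `|t|).
Proof.
move=> l0 c0 X0 lF lP hphi hpsi mc Xl hF t; rewrite /picard /chi.
case: (boolP ((0 <= t) && (t <= T))) => [/andP[t0 tT]|_]; last first.
  by rewrite mul0r normr0 mulr_ge0 // expR_ge0.
rewrite mul1r (ger0_norm t0).
have lJ : loc (fun s => pic1 U s i - psi i).
  by have := locD lP (loc_cst (- psi i)).
have JJ : `|J (fun s => pic1 U s i - psi i) t| <= X * c / l / l * expR (l * t).
  apply: J_expR => //; first by rewrite divr_ge0 ?mulr_ge0 // ltW.
  move=> s s0; rewrite /picard1 addrC addKr.
  by apply: J_expR => //; rewrite mulr_ge0.
have E : J (fun s => pic1 U s i) t = J (fun s => pic1 U s i - psi i) t + J (fun=> psi i) t.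
  by rewrite JB ?subrK //; exact: loc_cst.
have hpsi' : `|J (fun=> psi i) t| <= m * t.
  by rewrite -[X in _ * X](ger0_norm t0); apply: J_le => //; exact: loc_cst.
have m0 : 0 <= m := le_trans (normr_ge0 _) hphi.
have mt : m * t <= m * T by rewrite ler_wpM2l.
have e1 : 1 <= expR (l * t) by rewrite -expR0 ler_expR mulr_ge0 // ltW.
have XX : X * c / l / l <= c / 2.
  rewrite -mulrA -invfM -expr2 ler_pdivrMr ?exprn_gt0 //.
  have := ler_wpM2l c0 Xl; lra.
have := ler_wpM2r (expR_ge0 (l * t)) XX.
have := ler_wpM2l (divr_ge0 c0 (ler0n R 2)) e1; rewrite mulr1.
have := ler_normD (phi i) (J (fun s => pic1 U s i) t).
rewrite {2}E.
have := ler_normD (J (fun s => pic1 U s i - psi i) t) (J (fun=> psi i) t).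
move: mc; rewrite mulrDr mulr1; lra.
Qed.

(** Once the norm of X is controlled by the weight, these pointwise remainders become Taylor
    estimates in X for u and for its time derivative, whatever X is. *)
Definition solution_data (U U1 U2 : R -> state) C :=
  [/\ forall t, 0 <= t <= T -> forall V, [\/ V = U, V = U1 | V = U2] ->
        [/\ Ex (V t), smeas (V t) & forall i, `|V t i| <= C * G i],
      forall s t i, 0 <= s <= T -> 0 <= t <= T ->
        `|U s i - U t i - U1 t i * (s - t)| <= C * `|s - t| * `|s - t| * G i,
      forall s t i, 0 <= s <= T -> 0 <= t <= T ->
        `|U1 s i - U1 t i - U2 t i * (s - t)| <= C * `|s - t| * `|s - t| * G i,
      forall s t i, 0 <= s <= T -> 0 <= t <= T ->
        `|U2 s i - U2 t i| <= C * `|s - t| * G i &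
      [/\ forall i, U 0 i = phi i, forall i, U1 0 i = psi i & forall t, U2 t = field_op (U t)]].

(** The constants arise in the order [M], [X], [C], [L], so that there is no circle: linear growth
    bounds u by [M], [M] gives the linear bound [X] of the field, [X] the weighted bound [C] of the
    state, and [M] with [C] the Lipschitz constant [L]. *)
Lemma system_solution : exists U U1 U2 C, 0 <= C /\ solution_data U U1 U2 C.
Proof.
have g00 : 0 <= g0 := le_trans (G_ge0 (true, 0)) (G_bnd 0).
have A0 := A_ge0.
(* [c0 >= 1] absorbs [b]: for N = [c0 * expR (l0 * t)], which is at least 1, the bound A (2 a N + b)
   is at most [X0] N. Otherwise [c0] and [l0] are what [picard_bound] asks for data bounded by [g0]
   and for a field bounded by [X0]. *)
pose X0 := A * (2 * a + b); pose l0 := 1 + 2 * X0; pose c0 := 1 + 2 * (1 + T) * g0.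
have X00 : 0 <= X0 by rewrite /X0 mulr_ge0 // addr_ge0 // mulr_ge0.
have l00 : 0 < l0 by rewrite /l0 ltr_pwDl // mulr_ge0.
have c01 : 1 <= c0 by rewrite /c0 lerDl !mulr_ge0 // addr_ge0.
have sq (Y : R) : 0 <= Y -> 2 * Y <= (1 + 2 * Y) ^+ 2.
  move=> Y0; rewrite (_ : (1 + 2 * Y) ^+ 2 = 1 + 4 * Y + 4 * (Y * Y)); last by ring.
  by have := mulr_ge0 Y0 Y0; lra.
have c0h : g0 * (1 + T) <= c0 / 2 by rewrite /c0; lra.
have l0h : 2 * X0 <= l0 ^+ 2 by exact: sq.
have X0E : X0 = A * (2 * a + b) by [].
clearbody X0 l0 c0.
pose M := c0 * expR (l0 * T).
have [X X_ge0 hX] := field_bound M.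
pose c := 2 * (1 + T); pose l := 1 + 2 * X; pose C := c * expR (l * T).
have lgt0 : 0 < l by rewrite /l ltr_pwDl // mulr_ge0.
have c_ge0 : 0 <= c by rewrite /c mulr_ge0 // addr_ge0.
have C_ge0 : 0 <= C by rewrite /C mulr_ge0 // expR_ge0.
have ch m : m * (1 + T) <= c * m / 2 by rewrite /c; lra.
have lh : 2 * X <= l ^+ 2 by exact: sq.
have ME : M = c0 * expR (l0 * T) by [].
have CE : C = c * expR (l * T) by [].
clearbody M c l C.
have [L L_ge0 hL] := field_estimates M C_ge0.
(* Both exponential bounds reproduce under the iteration, and vanishing outside [[0, T]] turns them
   into the constants [M] and [C], valid at all times. The sup bound of u is kept apart, since [X]
   is derived from it. *)
pose Q U := [/\ jmeas U, forall t x, `|U t (true, x)| <= c0 * expR (l0 * `|t|),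
  forall t i, `|U t i| <= c * G i * expR (l * `|t|),
  forall t i, ~~ ((0 <= t) && (t <= T)) -> U t i = 0 & forall t, Ex (U t)].
have QM U : Q U -> forall t x, `|U t (true, x)| <= M.
  move=> [_ h _ h' _] t x; case: (boolP ((0 <= t) && (t <= T))) => [/andP[t0 tT]|tT].
    apply: le_trans (h t x) _; rewrite ME (ger0_norm t0) ler_wpM2l ?(le_trans _ c01) //.
    by rewrite ler_expR ler_wpM2l // ltW.
  by rewrite h' // normr0 ME mulr_ge0 ?expR_ge0 // (le_trans _ c01).
have QC U : Q U -> forall t i, `|U t i| <= C * G i.
  move=> [_ _ h h' _] t i; case: (boolP ((0 <= t) && (t <= T))) => [/andP[t0 tT]|tT].
    apply: le_trans (h t i) _; rewrite CE (ger0_norm t0) mulrAC ler_wpM2r // ler_wpM2l //.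
    by rewrite ler_expR ler_wpM2l // ltW.
  by rewrite h' // normr0 mulr_ge0.
have QF U : Q U -> forall t i, `|field_op (U t) i| <= X * C * G i.
  by move=> QU t i; apply: hX; [case: QU => mU *; exact: jmeas_slice|exact: QM|by []|exact: QC].
have QlF U : Q U -> forall i, loc (fun t => field_op (U t) i).
  move=> QU i; apply: (loc_bounded (c := X * C * G i)); last by move=> s; exact: QF.
  by case: QU => mU *; exact: (jmeas_time i (jmeas_field mU)).
have Q1 U : Q U -> forall t i, `|pic1 U t i| <= (1 + X * C * `|t|) * G i.
  move=> QU t i; rewrite /picard1; apply: le_trans (ler_normD _ _) _.
  rewrite mulrDl mul1r lerD // mulrAC; apply: J_le; first exact: QlF.
  by move=> s; exact: QF.
have QlP U : Q U -> forall i, loc (fun t => pic1 U t i).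
  move=> QU i; apply: (loc_affine (c := G i) (e := X * C * G i)).
    by case: QU => mU *; exact: (jmeas_time i (jmeas_pic1 mU)).
  by move=> t; apply: le_trans (Q1 U QU t i) _; rewrite mulrDl mul1r mulrAC.
have QEx1 U : Q U -> forall t, Ex (pic1 U t).
  move=> QU t; have [t0|/ltW t0] := leP 0 t; last first.
    rewrite (_ : pic1 U t = psi) //; apply/funext => i.
    by rewrite /picard1 J_neg // addr0.
  apply: ExD => //; case: (QU) => mU _ _ _ EU.
  apply: (ExJ (C := X * C)) => //; first exact: jmeas_field.
    by move=> s i _; exact: QF.
  move=> s; apply: (Exfield (M := M) (C := C)) => //; first exact: jmeas_slice.
    exact: QM.
  exact: QC.
have Q0 : Q (fun _ _ => 0).
  split=> //.
  - by move=> t x; rewrite normr0 mulr_ge0 ?expR_ge0 // (le_trans _ c01).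
  - by move=> t i; rewrite normr0; apply: mulr_ge0; [exact: mulr_ge0|exact: expR_ge0].
have Qpic U : Q U -> Q (pic U).
  move=> QU; case: (QU) => mU U1 U2 U3 U4; split.
  - exact: jmeas_pic.
  - move=> t x; apply: (picard_bound (m := g0) (X := X0)) => //.
    + by rewrite (le_trans _ c01).
    + exact: QlF.
    + exact: QlP.
    + exact: le_trans (G_bnd x).
    + exact: le_trans (G_bnd x).
    + move=> r r0; have := field_growth (jmeas_slice r mU) (U1 r) x; move/le_trans; apply.
      rewrite (ger0_norm r0) (_ : X0 * c0 * _ = A * ((2 * a + b) * (c0 * expR (l0 * r)))); last first.
        by rewrite X0E; ring.
      rewrite ler_wpM2l // (mulrDl (2 * a)).
      have e1 : 1 <= c0 * expR (l0 * r).
        by rewrite mulr_ege1 // -expR0 ler_expR mulr_ge0 // ltW.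
      by rewrite lerD // -[leLHS]mulr1 ler_wpM2l.
  - move=> t i; apply: (picard_bound (m := G i) (X := X)) => //.
    + by rewrite mulr_ge0.
    + exact: QlF.
    + exact: QlP.
    + move=> r r0; have := hX _ (jmeas_slice r mU) (QM U QU r) (c * expR (l * r)) _ _ i.
      rewrite (_ : X * _ * expR _ = X * (c * expR (l * r)) * G i); last by ring.
      apply; first by rewrite mulr_ge0 ?expR_ge0.
      by move=> j; have := U2 r j; rewrite (ger0_norm r0) mulrAC.
  - by move=> t i h; rewrite /picard /chi (negbTE h) mul0r.
  - move=> t; rewrite /picard /chi.
    case: (boolP ((0 <= t) && (t <= T))) => [/andP[t0 tT]|tT]; last first.
      by rewrite (_ : (fun _ => _) = fun=> 0) //; apply/funext => i; rewrite mul0r.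
    apply: ExZ; apply: ExD => //; apply: (ExJ (C := 1 + X * C * t)) => //.
    + exact: jmeas_pic1.
    + move=> s i /andP[s0 st]; apply: le_trans (Q1 U QU s i) _.
      by rewrite ler_wpM2r // lerD2l ger0_norm // ler_wpM2l // mulr_ge0.
    + exact: QEx1.
have norm_lim (u : nat -> R) (v K : R) : u n @[n --> \oo] --> v ->
    (forall n, `|u n| <= K) -> `|v| <= K.
  move=> uv uK; apply/ler_addgt0Pr => e e0.
  have /cvgrPdist_le/(_ _ e0)[n _ /(_ n (leqnn n)) /= h] := uv.
  have := ler_normD (v - u n) (u n); rewrite subrK; have := uK n; lra.
have Qlim (Un : nat -> R -> state) U e : (forall n, Q (Un n)) ->
    (forall n t i, `|Un n t i - U t i| <= e n * G i) -> e n @[n --> \oo] --> 0 -> Q U.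
  move=> QUn hU he.
  have cU t i : Un n t i @[n --> \oo] --> U t i.
    apply/cvgrPdist_le => d d0.
    have : e n * G i @[n --> \oo] --> 0.
      by rewrite -[X in _ --> X](mul0r (G i)); apply: cvgMl.
    move/cvgrPdist_le/(_ _ d0); apply: filterS => n; rewrite sub0r normrN distrC => h.
    by apply: le_trans (hU n t i) _; apply: le_trans (ler_norm _) h.
  have mU : jmeas U.
    move=> d; apply: (@measurable_fun_cvg _ _ _ _ (fun n (p : R * R) => Un n p.1 (d, p.2))).
      by move=> n; case: (QUn n) => mUn *; exact: mUn.
    by move=> p _; exact: cU.
  split=> //.
  - by move=> t x; apply: norm_lim (cU t (true, x)) _ => n; case: (QUn n).
  - by move=> t i; apply: norm_lim (cU t i) _ => n; case: (QUn n).
  - move=> t i h; apply: (cvg_unique (@norm_hausdorff _ _) (cU t i)).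
    rewrite (_ : (fun n => Un n t i) = fun=> 0); first exact: cvg_cst.
    by apply/funext => n; case: (QUn n) => _ _ _ /(_ t i h).
  - move=> t; apply: (Exlim (Sn := fun n => Un n t) (e := e)) => //.
    + by move=> n; case: (QUn n).
    + exact: jmeas_slice.
have Qlip U V : Q U -> Q V -> forall s t d, 0 <= d -> (forall i, `|U s i - V t i| <= d * G i) ->
    forall i, `|field_op (U s) i - field_op (V t) i| <= L * d * G i.
  move=> QU QV s t d d0 h i; apply: hL => //.
  - by case: QU => mU *; exact: jmeas_slice.
  - by case: QV => mV *; exact: jmeas_slice.
  - exact: QM.
  - exact: QM.
  - exact: QC.
have [U QU UE] := @picard_fixpoint R _ G T phi psi field_op Q _ L C G_ge0 L_ge0 C_ge0
  Q0 Qpic Qlip QC QlF QlP Qlim.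
case: (QU) => mU _ _ _ EU.
have UT t i : 0 <= t <= T -> U t i = phi i + J (fun s => pic1 U s i) t.
  by move=> tT; rewrite UE /picard /chi tT mul1r.
(* A bound for the time derivative at the intermediate times [r], with
   [|r| <= |r - t| + |t| <= 2 * T]. *)
pose K1 := 1 + X * C * (2 * T).
have XC0 : 0 <= X * C by rewrite mulr_ge0.
have K1_ge0 : 0 <= K1 by rewrite /K1 addr_ge0 // mulr_ge0 // mulr_ge0.
have lip1 s t i : 0 <= s -> 0 <= t -> `|pic1 U s i - pic1 U t i| <= X * C * G i * `|s - t|.
  move=> s0 t0; rewrite /picard1 (_ : _ - _ = J (fun r => field_op (U r) i) s -
    J (fun r => field_op (U r) i) t); last by ring.
  by apply: J_lipschitz => //; [exact: QlF|move=> r _ _ _; exact: QF].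
have lip0 s t i : 0 <= s <= T -> 0 <= t <= T -> `|U s i - U t i| <= K1 * `|s - t| * G i.
  move=> sT tT; rewrite !UT // (_ : _ - _ = J (fun r => pic1 U r i) s -
    J (fun r => pic1 U r i) t); last by ring.
  move: sT tT => /andP[s0 sT] /andP[t0 tT].
  rewrite mulrAC; apply: J_lipschitz => //; first exact: QlP.
  move=> r r0 _ rt; apply: le_trans (Q1 U QU r i) _; rewrite ler_wpM2r // /K1 lerD2l ler_wpM2l //.
  have st : `|s - t| <= T by rewrite ler_norml; apply/andP; split; lra.
  apply: le_trans (_ : `|r - t| + `|t| <= _); first by rewrite -{1}(subrK t r) ler_normD.
  by rewrite (ger0_norm t0) (le_trans (lerD rt (lexx t))) //; lra.
have lip2 s t i : 0 <= s <= T -> 0 <= t <= T ->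
    `|field_op (U s) i - field_op (U t) i| <= L * K1 * `|s - t| * G i.
  move=> sT tT; have := Qlip U U QU QU s t (K1 * `|s - t|) _ _ i.
  rewrite mulrA; apply; first by rewrite mulr_ge0.
  by move=> j; exact: lip0.
pose K := C + K1 + X * C + L * K1.
have LK1 : 0 <= L * K1 by rewrite mulr_ge0.
have hK : [/\ 0 <= K, C <= K, K1 <= K, X * C <= K & L * K1 <= K].
  exact: le_sum4.
clearbody K; case: hK => K0 hC hK1 hXC hLK1.
exists U, (pic1 U), (fun t => field_op (U t)), K; split => //; split.
- move=> t /andP[t0 tT] V VE; have [EV mV hV] : [/\ Ex (V t), smeas (V t) &
      exists2 k, k <= K & forall i, `|V t i| <= k * G i].
    case: VE => ->; split.
    + exact: EU.
    + exact: jmeas_slice.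
    + by exists C => // i; exact: QC.
    + exact: QEx1.
    + by apply: jmeas_slice; exact: jmeas_pic1.
    + exists K1 => // i; apply: le_trans (Q1 U QU t i) _; rewrite ler_wpM2r // /K1 lerD2l.
      by rewrite ler_wpM2l // ger0_norm // (le_trans tT) // ler_peMl // ler1n.
    + by apply: (Exfield (M := M) (C := C)) => //; [exact: jmeas_slice|exact: QM|exact: QC].
    + exact: (jmeas_slice t (jmeas_field mU)).
    + by exists (X * C) => // i; exact: QF.
  split=> // i; case: hV => k kK hk; apply: le_trans (hk i) _.
  by rewrite ler_wpM2r.
- move=> s t i sT tT; rewrite !UT // (_ : _ - _ - _ = J (fun r => pic1 U r i) s -
    J (fun r => pic1 U r i) t - pic1 U t i * (s - t)); last by ring.
  move: sT tT => /andP[s0 sT] /andP[t0 tT].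
  rewrite [leRHS]mulrAC; apply: J_taylor => //; first exact: QlP.
  move=> r r0 _ rt; apply: le_trans (lip1 r t i r0 t0) _.
  by rewrite [leRHS]mulrAC ler_pM // ?mulr_ge0 // ler_wpM2r.
- move=> s t i sT tT; rewrite (_ : _ - _ - _ =
    J (fun r => field_op (U r) i) s - J (fun r => field_op (U r) i) t
    - field_op (U t) i * (s - t)); last by rewrite /picard1; ring.
  move: (sT) (tT) => /andP[s0 s1] /andP[t0 t1].
  rewrite [leRHS]mulrAC; apply: J_taylor => //; first exact: QlF.
  move=> r r0 rm rt; apply: le_trans (lip2 r t i _ tT) _.
    by rewrite r0 (le_trans rm) // ge_max s1.
  by rewrite ler_wpM2r // ler_pM.
- move=> s t i sT tT; apply: le_trans (lip2 s t i sT tT) _.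
  by rewrite ler_wpM2r // ler_wpM2r.
- split=> // i.
    by rewrite UT ?lexx //= J0 addr0.
  by rewrite /picard1 J0 addr0.
Qed.

End System.

(** * From pointwise estimates to a solution in X *)

Section Solution.
Context {R : realType}.
Local Notation mu := (@lebesgue_measure R).
Local Notation state := (bool * R -> R).

Lemma peri_op_shift (alpha w v : R -> R) x : measurable_fun setT alpha ->
  measurable_fun setT w -> measurable_fun setT v ->
  peri_op alpha w v x = \int[mu]_z (alpha z * w (v (z + x) - v x)).
Proof.
move=> ma mw mv; rewrite /peri_op.
rewrite -(@Ri_shift R x (fun y => alpha (y - x) * w (v y - v x))); last first.
  apply: measurable_funM.
    by apply: (measurableT_comp ma); exact: measurable_funB.
  by apply: (measurableT_comp mw); exact: measurable_funB.
by apply: eq_Ri => z; rewrite addrK.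
Qed.

(** The difference quotient minus the derivative lies in [Ex], which is a linear space, and is
    bounded by [C * |s - t| * G]; the norm hypothesis turns this into convergence in X. [N] takes
    the place of the norm of the weight. *)
Lemma solves_of_data (alpha w w1 : R -> R) (D : set R) (G : state) (T : R) (phi psi : state)
  (Ex : state -> Prop) (U U1 U2 : R -> state) (C N : R)
  (inX : (R -> R) -> Prop) (nX : (R -> R) -> \bar R) (f g : R -> R) :
  measurable_fun setT alpha -> measurable_fun setT w -> 0 <= C -> 0 <= N ->
  solution_data alpha w w1 D G T phi psi Ex U U1 U2 C ->
  (forall S S', Ex S -> Ex S' -> Ex (fun i => S i + S' i)) ->
  (forall c S, Ex S -> Ex (fun i => c * S i)) ->
  (forall S c, Ex S -> smeas S -> (forall i, `|S i| <= c * G i) -> inX (fun x => S (true, x))) ->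
  (forall S c, Ex S -> smeas S -> 0 <= c -> (forall i, `|S i| <= c * G i) ->
     (nX (fun x => S (true, x)) <= (c * N)%:E)%E) ->
  nX (fun=> 0) = 0%E ->
  nX (fun x => phi (true, x) - f x) = 0%E -> nX (fun x => psi (true, x) - g x) = 0%E ->
  solves_on inX nX alpha w f g T (fun t x => U t (true, x)).
Proof.
move=> ma mw C0 N0 [nice d1 d2 d3 [U0 U10 U2E]] ExD ExZ hin hn n0 hf hg.
have small e : 0 < e -> exists2 d, 0 < d & forall h, 0 <= h -> h < d -> C * h * N < e.
  move=> e0; exists (e / (C * N + 1)); first by rewrite divr_gt0 // ltr_wpDl // mulr_ge0.
  move=> h h0; rewrite ltr_pdivlMr ?ltr_wpDl ?mulr_ge0 //.
  by apply: le_lt_trans; rewrite (_ : C * h * N = h * (C * N)) ?ler_wpM2l ?lerDl //; ring.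
have der (V V1 : R -> state) : [\/ V = U, V = U1 | V = U2] -> [\/ V1 = U, V1 = U1 | V1 = U2] ->
    (forall s t i, 0 <= s <= T -> 0 <= t <= T ->
      `|V s i - V t i - V1 t i * (s - t)| <= C * `|s - t| * `|s - t| * G i) ->
    forall t, 0 <= t <= T -> Xderiv nX T (fun t x => V t (true, x)) (fun t x => V1 t (true, x)) t.
  move=> hV hV1 hd t tT e e0; have [d d0 hde] := small e e0.
  exists d => // s sT /andP[st0 std].
  have [EVs mVs _] := nice s sT V hV; have [EVt mVt _] := nice t tT V hV.
  have [EV1 mV1 _] := nice t tT V1 hV1.
  pose S i := (s - t)^-1 * (V s i + -1 * V t i) + -1 * V1 t i.
  rewrite (_ : (fun x => _) = fun x => S (true, x)); last first.
    by apply/funext => x; rewrite /S !mulN1r mulrC.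
  apply: le_lt_trans (hn S (C * `|s - t|) _ _ _ _) _; last by rewrite lte_fin hde.
  - exact: (ExD _ _ (ExZ _ _ (ExD _ _ EVs (ExZ _ _ EVt))) (ExZ _ _ EV1)).
  - exact: (smeasD (smeasZ _ (smeasD mVs (smeasZ _ mVt))) (smeasZ _ mV1)).
  - by rewrite mulr_ge0.
  - move=> i; have st : s - t != 0 by rewrite -normr_gt0.
    rewrite (_ : S i = (s - t)^-1 * (V s i - V t i - V1 t i * (s - t))); last first.
      by rewrite /S; field.
    rewrite normrM normfV mulrC ler_pdivrMr //; apply: le_trans (hd s t i sT tT) _.
    by rewrite le_eqVlt; apply/orP; left; apply/eqP; ring.
exists (fun t x => U1 t (true, x)), (fun t x => U2 t (true, x)); split.
- move=> t tT; split.
  + by have [? ? ?] := nice t tT U (Or31 _ _ erefl); exact: hin.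
  + by have [? ? ?] := nice t tT U1 (Or32 _ _ erefl); exact: hin.
  + by have [? ? ?] := nice t tT U2 (Or33 _ _ erefl); exact: hin.
- by apply: der => //; [exact: Or31|exact: Or32].
- by apply: der => //; [exact: Or32|exact: Or33].
- move=> t tT e e0; have [d d0 hde] := small e e0; exists d => // s sT std.
  have [E1 m1 _] := nice s sT U2 (Or33 _ _ erefl); have [E2 m2 _] := nice t tT U2 (Or33 _ _ erefl).
  pose S i := U2 s i + -1 * U2 t i.
  rewrite (_ : (fun x => _) = fun x => S (true, x)); last first.
    by apply/funext => x; rewrite /S mulN1r.
  apply: le_lt_trans (hn S (C * `|s - t|) _ _ _ _) _; last by rewrite lte_fin hde.
  + exact: (ExD _ _ E1 (ExZ _ _ E2)).
  + exact: (smeasD m1 (smeasZ _ m2)).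
  + by rewrite mulr_ge0.
  + by move=> i; rewrite /S mulN1r; exact: d3.
- split.
  + by under eq_fun do rewrite U0.
  + by under eq_fun do rewrite U10.
  + move=> t tT; rewrite -[RHS]n0; congr nX; apply/funext => x.
    have [_ mU _] := nice t tT U (Or31 _ _ erefl).
    by rewrite U2E peri_op_shift // /field_op /= mul1r subrr.
Qed.

End Solution.

(** * Weights dominating their convolution with |alpha| *)

Section Weight.
Context {R : realType}.
Local Notation mu := (@lebesgue_measure R).
Local Open Scope ereal_scope.
Variable alpha : R -> R.
Hypothesis ialpha : intg alpha.

Definition conv_op (h : R -> \bar R) (x : R) : \bar R :=
  \int[mu]_z (`|alpha z|%:E * h (z + x)%R).

Lemma measurable_conv_arg (h : R -> \bar R) : measurable_fun setT h ->
  measurable_fun setT (fun p : R * R => `|alpha p.2|%:E * h (p.2 + p.1)%R).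
Proof.
move=> mh; apply: emeasurable_funM.
  apply/measurable_EFinP; apply: (measurableT_comp (f := fun z => `|alpha z|%R)) => //.
  by apply: measurableT_comp => //; exact: intg_meas.
by apply: (measurableT_comp mh); exact: measurable_funD.
Qed.

Lemma measurable_conv_section (h : R -> \bar R) x : measurable_fun setT h ->
  measurable_fun setT (fun z : R => `|alpha z|%:E * h (z + x)%R).
Proof.
move=> /measurable_conv_arg mh; apply: (measurableT_comp mh (g := fun z : R => (x, z))).
exact: measurable_fun_pair.
Qed.

Lemma measurable_conv (h : R -> \bar R) : measurable_fun setT h -> (forall x, 0 <= h x) ->
  measurable_fun setT (conv_op h).
Proof.
move=> mh h0.
apply: (measurable_fun_fubini_tonelli_F (m2 := mu)
  (fun p : R * R => `|alpha p.2|%:E * h (p.2 + p.1)%R)); first exact: measurable_conv_arg.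
by move=> p; rewrite mule_ge0.
Qed.

Lemma conv_ge0 (h : R -> \bar R) x : (forall x, 0 <= h x) -> 0 <= conv_op h x.
Proof. by move=> h0; apply: integral_ge0 => z _; rewrite mule_ge0. Qed.

Lemma conv_le_mono (h k : R -> \bar R) x : measurable_fun setT h -> measurable_fun setT k ->
  (forall x, 0 <= h x) -> (forall x, h x <= k x) -> conv_op h x <= conv_op k x.
Proof.
move=> mh mk h0 hk; apply: ge0_le_integral => //.
- by move=> z _; rewrite mule_ge0.
- exact: measurable_conv_section.
- exact: measurable_conv_section.
- by move=> z _; rewrite lee_wpmul2l.
Qed.

(** Young's inequality in L^1, an equality for nonnegative functions, by Tonelli and translation
    invariance. *)
Lemma integral_conv (h : R -> \bar R) : measurable_fun setT h -> (forall x, 0 <= h x) ->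
  \int[mu]_x conv_op h x = (\int[mu]_z `|alpha z|)%R%:E * \int[mu]_x h x.
Proof.
move=> mh h0.
have := @fubini_tonelli _ _ _ _ R mu mu _ (measurable_conv_arg mh) _.
rewrite /conv_op => -> /=; last by move=> p; rewrite mule_ge0.
have ma := intg_meas ialpha.
rewrite (RiE (intg_norm ialpha)) -ge0_integralZr //; last 2 first.
- by apply/measurable_EFinP; exact: measurableT_comp.
- exact: integral_ge0.
apply: eq_integral => z _; rewrite ge0_integralZl //.
- congr (_ * _); rewrite -[RHS](ge0_integral_shift z) //.
  by apply: eq_integral => x _; rewrite addrC.
- by apply: (measurableT_comp mh); exact: measurable_funD.
Qed.

End Weight.

(** * A dominating weight in L^1 *)

Section Superharmonic.
Context {R : realType}.
Local Notation mu := (@lebesgue_measure R).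
Local Open Scope ereal_scope.
Variable alpha : R -> R.
Hypothesis ialpha : intg alpha.
Let A := (\int[mu]_z `|alpha z|)%R.
Local Notation conv := (conv_op alpha).

(** Since [e * A <= 2^-1], the partial sums have integral at most twice that of [h]. The recursion
    gives [e * conv (S n) <= S n.+1], and monotone convergence carries it to the limit, whence the
    constant [e^-1]. The summand 1 in the definition of [e] covers [A = 0]. *)
Lemma conv_superharmonic (h : R -> \bar R) : measurable_fun setT h -> (forall x, 0 <= h x) ->
  \int[mu]_x h x < +oo -> exists H B, [/\ (0 <= B)%R, measurable_fun setT H,
    forall x, h x <= H x, forall x, conv H x <= B%:E * H x & \int[mu]_x H x < +oo].
Proof.
move=> mh h0 hoo.
have A0 : (0 <= A)%R by apply: Rintegral_ge0.
pose e : R := ((2 * (A + 1))^-1)%R.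
have e0 : (0 < e)%R by rewrite invr_gt0 mulr_gt0 // ltr_wpDl.
have eA : (e * A <= 2^-1)%R.
  rewrite /e -ler_pdivlMl ?invr_gt0 ?mulr_gt0 ?ltr_wpDl // invrK; lra.
clearbody e.
(* partial sums of the Neumann series sum_n e^n conv^n h, which converges in L^1 *)
pose S := fix S n := if n is n'.+1 then fun x => h x + e%:E * conv (S n') x else h.
have mS0 n : measurable_fun setT (S n) /\ forall x, 0 <= S n x.
  elim: n => [//|n [mS S0]] /=; split.
    by apply: emeasurable_funD => //; apply: measurable_funeM; exact: measurable_conv.
  by move=> x; rewrite adde_ge0 // mule_ge0 ?lee_fin ?(ltW e0) // conv_ge0.
have mS n := (mS0 n).1; have S0 n := (mS0 n).2.
have S_step n x : S n x <= S n.+1 x.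
  elim: n x => [|n IH] x /=.
    by rewrite leeDl // mule_ge0 ?lee_fin ?(ltW e0) // conv_ge0.
  rewrite leeD2l // lee_wpmul2l ?lee_fin ?(ltW e0) //.
  exact: (conv_le_mono ialpha x (mS n) (mS n.+1) (S0 n) IH).
have S_nd x : nondecreasing_seq (S^~ x) by apply/nondecreasing_seqP => n; exact: S_step.
have hS n x : h x <= S n x by have := S_nd x _ _ (leq0n n).
pose c := fine (\int[mu]_x h x).
have cE : \int[mu]_x h x = c%:E by rewrite fineK // ge0_fin_numE // integral_ge0.
have c0 : (0 <= c)%R by rewrite -lee_fin -cE integral_ge0.
have intS n : \int[mu]_x S n x <= (2 * c)%:E.
  elim: n => [|n IH] /=; first by rewrite cE lee_fin ler_peMl // ler1n.
  rewrite ge0_integralD //; last 2 first.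
  - by move=> x _; rewrite mule_ge0 ?lee_fin ?(ltW e0) // conv_ge0.
  - by apply: measurable_funeM; exact: measurable_conv.
  rewrite ge0_integralZl //; last 3 first.
  - exact: measurable_conv.
  - by move=> x _; exact: conv_ge0.
  - by rewrite lee_fin ltW.
  rewrite integral_conv // cE muleA -EFinM.
  apply: le_trans (_ : c%:E + (2^-1)%:E * (2 * c)%:E <= _); last first.
    by rewrite -EFinM -EFinD lee_fin; lra.
  by rewrite leeD2l // lee_pmul ?lee_fin // ?mulr_ge0 ?(ltW e0) // integral_ge0.
pose H x := limn (S^~ x).
have cvgS x : cvgn (S^~ x) by exact: ereal_nondecreasing_is_cvgn.
have SH n x : S n x <= H x.
  by apply: lime_ge => //; exists n => // m /= nm; exact: S_nd.
exists H, (e^-1)%R; split.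
- by rewrite invr_ge0 ltW.
- by apply: (emeasurable_fun_cvg S) => // x _; exact: cvgS.
- by move=> x; exact: le_trans (SH 0%N x).
- move=> x; rewrite /conv_op.
  rewrite (_ : (fun z => _) = fun z => limn (fun n => `|alpha z|%:E * S n (z + x)%R)); last first.
    by apply/funext => z; rewrite limeMl //; exact: cvgS.
  rewrite monotone_convergence //; last 3 first.
  + by move=> n; exact: measurable_conv_section.
  + by move=> n z _; rewrite mule_ge0.
  + by move=> z _ n m nm; rewrite lee_wpmul2l //; exact: S_nd.
  apply: lime_le.
    apply: ereal_nondecreasing_is_cvgn => n m nm; apply: conv_le_mono => //.
    by move=> z; exact: S_nd.
  apply: nearW => n; rewrite -[leLHS]mul1e -(mulVf (lt0r_neq0 e0)) EFinM -muleA.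
  rewrite lee_wpmul2l ?lee_fin ?invr_ge0 ?(ltW e0) //.
  by apply: (le_trans _ (SH n.+1 x)) => /=; rewrite leeDr.
- rewrite monotone_convergence //.
  apply: (@le_lt_trans _ _ (2 * c)%:E); last by rewrite ltry.
  apply: lime_le; last by apply: nearW => n; exact: intS.
  apply: ereal_nondecreasing_is_cvgn => n m nm; apply: ge0_le_integral => //.
  + exact: (mS n).
  + exact: (mS m).
  + by move=> x _; exact: (S_nd x n m nm).
Qed.

End Superharmonic.

(** * From L^1 weights to L^p weights *)

Section Root_weight.
Context {R : realType}.
Local Notation mu := (@lebesgue_measure R).
Variable alpha : R -> R.
Hypothesis ialpha : intg alpha.
Let A := \int[mu]_z `|alpha z|.
Local Notation conv := (conv_op alpha).

Lemma tangent_powR (x c p : R) : 0 <= x -> 0 < c -> 1 <= p ->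
  x <= x `^ p / c `^ (p - 1) + c.
Proof.
move=> x0 c0 p1; have [xc|/ltW cx] := leP x c.
  by rewrite (le_trans xc) // lerDr divr_ge0 // powR_ge0.
rewrite -[leLHS]addr0 lerD // ?(ltW c0) // ler_pdivlMr ?powR_gt0 //.
rewrite -(mulr_powRB1 x0) ?(lt_le_trans ltr01) // ler_wpM2l //.
by apply: ge0_ler_powR => //; rewrite ?nnegrE ?subr_ge0 // ltW.
Qed.

(* The p-th root of [K] inherits its inequality: apply [tangent_powR] with [c] the root at [x]. *)
Lemma root_weight (K : R -> \bar R) (B p : R) : measurable_fun setT K ->
  (forall x, 0 <= K x)%E -> 0 <= B -> (forall x, conv K x <= B%:E * K x)%E -> 1 <= p ->
  forall x, (K x < +oo)%E ->
  intg (fun z => `|alpha z| * fine (K (z + x)) `^ p^-1) /\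
  \int[mu]_z (`|alpha z| * fine (K (z + x)) `^ p^-1) <= (B + A) * fine (K x) `^ p^-1.
Proof.
move=> mK K0 B0 KB p1 x Kx.
have p0 : 0 < p by rewrite (lt_le_trans ltr01).
have A0 : 0 <= A by apply: Rintegral_ge0.
pose G x := fine (K x) `^ p^-1.
have mG : measurable_fun setT G.
  apply: (measurableT_comp (measurable_powR _)).
  by apply: measurableT_comp mK; exact: measurable_realfun.fine_measurable.
have G0 y : 0 <= G y by exact: powR_ge0.
have Gp y : G y `^ p = fine (K y) by rewrite /G -powRrM mulVf ?gt_eqF // powRr1 // fine_ge0.
(* Only an inequality, since [fine] sends [+oo] to 0. *)
have GpK y : ((G y `^ p)%:E <= K y)%E.
  by rewrite Gp; have := K0 y; case: (K y) => //= r _; rewrite ?lexx ?leey.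
have ma := intg_meas ialpha.
have mna : measurable_fun setT (fun z => `|alpha z|) by exact: measurableT_comp.
have mGx : measurable_fun setT (fun z : R => G (z + x)).
  by apply: (measurableT_comp mG); exact: measurable_funD.
have maG : measurable_fun setT (fun z : R => `|alpha z| * G (z + x)) by exact: measurable_funM.
have bound c : 0 < c ->
    (\int[mu]_z (`|alpha z| * G (z + x))%:E <= (B * (fine (K x) / c `^ (p - 1)) + A * c)%:E)%E.
  move=> c0; pose d := (c `^ (p - 1))^-1.
  have d0 : 0 <= d by rewrite invr_ge0 powR_ge0.
  apply: (@le_trans _ _ (\int[mu]_z (d%:E * (`|alpha z|%:E * K (z + x)%R) + (c * `|alpha z|)%:E))%E).
    apply: ge0_le_integral => //.
    - by move=> z _; rewrite lee_fin mulr_ge0.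
    - exact/measurable_EFinP.
    - apply: emeasurable_funD; last by apply/measurable_EFinP; exact: measurable_funM.
      by apply: measurable_funeM; exact: measurable_conv_section.
    - move=> z _; rewrite muleA -EFinM.
      apply: (@le_trans _ _ ((d * `|alpha z| * G (z + x) `^ p)%:E + (c * `|alpha z|)%:E)%E).
        rewrite -EFinD lee_fin mulrAC -mulrDl mulrC ler_wpM2r //.
        by rewrite mulrC; exact: tangent_powR.
      apply: leeD2r; rewrite (EFinM (d * `|alpha z|)); apply: lee_wpmul2l => //.
      by rewrite lee_fin mulr_ge0.
  rewrite ge0_integralD //; last 4 first.
  - by move=> z _; rewrite !mule_ge0 ?lee_fin.
  - by apply: measurable_funeM; exact: measurable_conv_section.
  - by move=> z _; rewrite lee_fin mulr_ge0 // ltW.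
  - by apply/measurable_EFinP; exact: measurable_funM.
  rewrite ge0_integralZl //; last 2 first.
  - exact: measurable_conv_section.
  - by move=> z _; rewrite mule_ge0.
  rewrite -(RiE (intgZ c (intg_norm ialpha))) RiZ ?intg_norm // (mulrC c) EFinD leeD2r //.
  apply: le_trans (lee_wpmul2l _ (KB x)) _; first by rewrite lee_fin.
  rewrite -[K x in leLHS]fineK ?ge0_fin_numE // -!EFinM lee_fin -/d.
  by rewrite mulrCA (mulrC d).
have fin : (\int[mu]_z (`|alpha z| * G (z + x))%:E < +oo)%E.
  by apply: le_lt_trans (bound 1 ltr01) _; rewrite ltry.
have iG : intg (fun z => `|alpha z| * G (z + x)).
  apply/intgP; split => //.
  by under eq_integral do rewrite ger0_norm ?mulr_ge0 //.
split => //; rewrite -/(G x) -lee_fin RiE //.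
have [Gx0|] := eqVneq (G x) 0; last first.
  move=> Gx; have Gx0 : 0 < G x by rewrite lt0r Gx G0.
  apply: le_trans (bound _ Gx0) _; rewrite lee_fin -Gp.
  have h := lt0r_neq0 (powR_gt0 (p - 1) Gx0).
  rewrite -(mulr_powRB1 (G0 x) p0) (mulfK h).
  by rewrite mulrDl.
(* At a zero of [G] the choice [c = G x] is not allowed; there every [c > 0] bounds the integral by
   [A * c], so it vanishes. *)
have K00 : fine (K x) = 0 by rewrite -Gp Gx0 powR0 // gt_eqF.
rewrite Gx0 mulr0; apply/lee_addgt0Pr => e e0; rewrite add0e.
have c0 : 0 < e / (A + 1) by rewrite divr_gt0 // ltr_wpDl.
apply: le_trans (bound _ c0) _.
rewrite K00 mul0r mulr0 add0r lee_fin mulrCA ler_piMr ?(ltW e0) //.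
by rewrite ler_pdivrMr ?mul1r ?lerDl // ltr_wpDl.
Qed.

End Root_weight.

(** * L^p norms and weights in L^p *)

Section Lp.
Context {R : realType}.
Local Notation mu := (@lebesgue_measure R).
Implicit Types (f g G : R -> R) (p : \bar R).

Lemma lebesgue_measure_setT_gt0 : (0 < mu [set: measurableTypeR R])%E.
Proof.
have -> : [set: measurableTypeR R] = `]-oo, +oo[%classic by rewrite set_itvE.
by rewrite lebesgue_measure_itv /= lt0y.
Qed.

Lemma LpnE (r : R) f : Lpn r%:E f = ((\int[mu]_x (`|f x| `^ r)%:E) `^ r^-1)%E.
Proof.
by rewrite /Lpn unlock.
Qed.

Lemma Lpn_yE f : Lpn +oo%E f = ess_sup mu (fun x => `|f x|%:E).
Proof. by rewrite /Lpn unlock lebesgue_measure_setT_gt0. Qed.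

Lemma Lpn_ge0 p f : (0 <= Lpn p f)%E. Proof. exact: Lnorm_ge0. Qed.

Lemma Lpn_y_ae f : (Lpn +oo%E f < +oo)%E ->
  \forall x \ae mu, `|f x| <= fine (Lpn +oo%E f).
Proof.
move=> fy; have ffin : Lpn +oo%E f \is a fin_num by rewrite ge0_fin_numE // Lpn_ge0.
have := ess_sup_ge mu (fun x => `|f x|%:E).
by rewrite -Lpn_yE; apply: ae_imp => x; rewrite -lee_fin fineK.
Qed.

Lemma Lpn_y_le f c : (\forall x \ae mu, `|f x| <= c) -> (Lpn +oo%E f <= c%:E)%E.
Proof.
by move=> h; rewrite Lpn_yE; apply/ess_supP; apply: ae_imp h => x; rewrite lee_fin.
Qed.

Lemma measurable_normX f (r : R) : measurable_fun setT f ->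
  measurable_fun setT (fun x => (`|f x| `^ r)%:E).
Proof.
move=> mf; apply/measurable_EFinP; apply: (measurableT_comp (measurable_powR _)).
exact: measurableT_comp.
Qed.

Lemma Lpn_integral_lty (r : R) f : 1 <= r ->
  (Lpn r%:E f < +oo)%E <-> (\int[mu]_x (`|f x| `^ r)%:E < +oo)%E.
Proof.
move=> r1; have r0 : r != 0 by rewrite gt_eqF // (lt_le_trans ltr01).
rewrite LpnE; split=> [|]; last exact: poweR_lty.
by apply: lty_poweRy; rewrite invr_neq0.
Qed.

Lemma Lpn_mono_ae p f G c : (1 <= p)%E -> measurable_fun setT f -> measurable_fun setT G ->
  0 <= c -> (\forall x \ae mu, `|f x| <= c * G x) -> (Lpn p G < +oo)%E ->
  (Lpn p f <= (c * fine (Lpn p G))%:E)%E.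
Proof.
move=> p1 mf mG c0 fG Gy.
have Gfin : Lpn p G \is a fin_num by rewrite ge0_fin_numE // Lpn_ge0.
case: p p1 Gy Gfin => [r|_|//] => [r1|] Gy Gfin; last first.
  apply: Lpn_y_le; apply: ae_imp (ae_and fG (Lpn_y_ae Gy)) => x [h h'].
  by apply: le_trans h _; rewrite ler_wpM2l // (le_trans (ler_norm _)).
rewrite lee_fin in r1; have r0 : 0 < r by rewrite (lt_le_trans ltr01).
rewrite EFinM fineK // !LpnE.
have IG0 : (0 <= \int[mu]_x (`|G x| `^ r)%:E)%E.
  by apply: integral_ge0 => x _; rewrite lee_fin powR_ge0.
rewrite (_ : c%:E = ((c `^ r)%:E `^ r^-1)%E); last first.
  by rewrite poweR_EFin -powRrM mulfV ?gt_eqF // powRr1.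
rewrite -poweRM ?lee_fin ?powR_ge0 //.
apply: gt0_ler_poweR.
- by rewrite invr_ge0 ltW.
- by rewrite in_itv /= leey andbT integral_ge0 // => x _; rewrite lee_fin powR_ge0.
- by rewrite in_itv /= leey andbT mule_ge0 // lee_fin powR_ge0.
rewrite -ge0_integralZl //; last 2 first.
- exact: measurable_normX.
- by rewrite lee_fin powR_ge0.
apply: ae_ge0_le_integral => //.
- exact: measurable_normX.
- by move=> x _; rewrite -EFinM lee_fin mulr_ge0 ?powR_ge0.
- by apply: measurable_funeM; exact: measurable_normX.
- refine (ae_imp _ fG) => x h _; rewrite -EFinM lee_fin -powRM //.
  apply: ge0_ler_powR; rewrite ?nnegrE ?mulr_ge0 ?(ltW r0) //.
  by apply: le_trans h _; rewrite ler_wpM2l // ler_norm.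
Qed.

Lemma Lpn_mono p f G c : (1 <= p)%E -> measurable_fun setT f -> measurable_fun setT G ->
  0 <= c -> (forall x, `|f x| <= c * G x) -> (Lpn p G < +oo)%E ->
  (Lpn p f <= (c * fine (Lpn p G))%:E)%E.
Proof. by move=> p1 mf mG c0 fG; apply: Lpn_mono_ae => //; exact: aeW. Qed.

Lemma Lpn_ae0 p f : (1 <= p)%E -> measurable_fun setT f -> (\forall x \ae mu, f x = 0) ->
  Lpn p f = 0%E.
Proof.
move=> p1 mf f0; case: p p1 => [r|_|//] => [r1|]; last first.
  apply/eqP; rewrite eq_le Lpn_ge0 andbT; apply: Lpn_y_le.
  by apply: ae_imp f0 => x ->; rewrite normr0.
rewrite lee_fin in r1; have r0 : r != 0 by rewrite gt_eqF // (lt_le_trans ltr01).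
rewrite LpnE (_ : (\int[mu]_x _)%E = 0%E) ?poweR0r ?invr_neq0 //.
rewrite (ae_eq_integral (cst 0%E)) ?integral0 //; first exact: measurable_normX.
by refine (ae_imp _ f0) => x -> _; rewrite normr0 powR0.
Qed.

Lemma Lpn0 p : (1 <= p)%E -> Lpn p (fun=> 0) = 0%E.
Proof. by move=> p1; apply: Lpn_ae0 => //; apply: aeW. Qed.

Lemma le1_add_powR (x r : R) : 0 <= x -> 1 <= r -> x <= 1 + x `^ r.
Proof.
move=> x0 r1; have [x1|/ltW x1] := leP x 1.
  by rewrite (le_trans x1) // lerDl powR_ge0.
by rewrite (le_trans (le1r_powR x1 r1)) // lerDr.
Qed.

Lemma Lp_uniformly_loc p f : (1 <= p)%E -> inLp p f ->
  loc f /\ exists C, forall x, \int[mu]_r (ker x (x + 1) r * `|f r|) <= C.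
Proof.
move=> p1 [mf fy].
have [h [C [lh fh hC]]] : exists h C, [/\ loc h, \forall r \ae mu, `|f r| <= h r &
    forall x, \int[mu]_r (ker x (x + 1) r * h r) <= C].
  case: p p1 fy => [r|_|//] => [r1|] fy; last first.
    exists (fun=> fine (Lpn +oo%E f)), (fine (Lpn +oo%E f)); split.
    + exact: loc_cst.
    + exact: Lpn_y_ae.
    + move=> x; under eq_Rintegral do rewrite mulrC.
      rewrite RiZ; last exact: intg_ker.
      by rewrite Ri_ker ?lerDl // addrC addKr mulr1.
  rewrite lee_fin in r1.
  have ir : intg (fun x => `|f x| `^ r).
    apply/intgP; split; first by apply/measurable_EFinP; exact: measurable_normX.
    under eq_integral do rewrite ger0_norm ?powR_ge0 //.
    exact/Lpn_integral_lty.
  exists (fun x => 1 + `|f x| `^ r), (1 + \int[mu]_x (`|f x| `^ r)); split.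
  + by apply: locD; [exact: loc_cst|exact: loc_intg].
  + by apply: aeW => x; exact: le1_add_powR.
  + move=> x; under eq_Rintegral do rewrite mulrDr mulr1.
    rewrite RiD ?intg_ker //; last exact: (loc_intg ir).2.
    rewrite Ri_ker ?lerDl // (addrC x) addrK lerD2l.
    apply: le_Ri => //; first exact: (loc_intg ir).2.
    by move=> z; rewrite ler_piMl ?powR_ge0 // ker_le1.
have [lf hf] := loc_dom_ae mf lh fh; split => //.
by exists C => x; apply: le_trans (hf _ _) (hC x).
Qed.

Lemma LpnD p f g : (1 <= p)%E -> inLp p f -> inLp p g -> inLp p (fun x => f x + g x).
Proof.
move=> p1 [mf fy] [mg gy]; split; first exact: measurable_funD.
by apply: le_lt_trans (eminkowski mu mf mg p1) _; rewrite lte_add_pinfty.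
Qed.

Lemma Lpn_norm p f : inLp p f -> inLp p (fun x => `|f x|).
Proof.
move=> [mf fy]; split; first exact: measurableT_comp.
apply: le_lt_trans fy; rewrite le_eqVlt /Lpn -[X in _ == X]Lnorm_abse.
by apply/orP; left; apply/eqP; congr Lnorm; apply/funext => x.
Qed.

Lemma Lpn_y_cst c : 0 <= c -> (Lpn +oo%E (fun=> c : R) <= c%:E)%E.
Proof. by move=> c0; apply: Lpn_y_le; apply: aeW => x; rewrite ger0_norm. Qed.

(** For finite exponents [D] is the set where the Neumann sum [H] is finite, of full measure as [H]
    is integrable. For [+oo] the weight is the essential supremum of [g], and [D] the set where [g]
    does not exceed it. *)
Lemma Lp_weight (alpha : R -> R) p g : intg alpha -> (1 <= p)%E -> inLp p g ->
  (forall x, 0 <= g x) ->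
  exists D G B, [/\ measurable D, \forall x \ae mu, D x & [/\ forall x, D x -> g x <= G x,
    forall x, 0 <= G x, inLp p G, 0 <= B &
    forall x, D x -> intg (fun z => `|alpha z| * G (z + x)) /\
       \int[mu]_z (`|alpha z| * G (z + x)) <= B * G x]].
Proof.
move=> ia p1 [mg gy] g0.
have A0 : 0 <= \int[mu]_z `|alpha z| by apply: Rintegral_ge0.
case: p p1 gy => [r|_|//] => [r1|] gy; last first.
  have hM := Lpn_y_ae gy; set M := fine _ in hM.
  have M0 : 0 <= M by rewrite fine_ge0 // Lpn_ge0.
  exists [set x | g x <= M], (fun=> M), (\int[mu]_z `|alpha z|); split.
  - rewrite -[X in measurable X]setTI; apply: measurable_fun_ler => //; exact: measurableT.
  - by apply: ae_imp hM => x; rewrite ger0_norm.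
  - split => // [|x _]; first by split => //; apply: le_lt_trans (Lpn_y_cst M0) _; rewrite ltry.
    have -> : (fun z => `|alpha z| * M) = (fun z => M * `|alpha z|).
      by apply/funext => z; rewrite mulrC.
    split; first by apply: intgZ; exact: intg_norm.
    by rewrite RiZ ?intg_norm // mulrC.
rewrite lee_fin in r1; have r0 : 0 < r by rewrite (lt_le_trans ltr01).
have [|||H [B [B0 mH gH HB Hoo]]] := @conv_superharmonic R alpha ia (fun x => (`|g x| `^ r)%:E).
- exact: measurable_normX.
- by move=> x; rewrite lee_fin powR_ge0.
- exact/Lpn_integral_lty.
have H0 x : (0 <= H x)%E by apply: le_trans (gH x); rewrite lee_fin powR_ge0.
pose G x := fine (H x) `^ r^-1.
have mG : measurable_fun setT G.
  apply: (measurableT_comp (measurable_powR _)).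
  by apply: measurableT_comp mH; exact: measurable_realfun.fine_measurable.
have G0 x : 0 <= G x by exact: powR_ge0.
exists [set x | (H x < +oo)%E], G, (B + \int[mu]_z `|alpha z|); split.
- by rewrite -[X in measurable X]setTI; exact: emeasurable_fun_lt.
- have iH : mu.-integrable setT H.
    by apply/integrableP; split => //; under eq_integral do rewrite gee0_abs //.
  have := integrable_ae measurableT iH.
  by apply: ae_imp => x /(_ I); rewrite ge0_fin_numE.
- split => //.
  + move=> x /= Hx; rewrite -[leLHS]powRr1 // -(mulfV (lt0r_neq0 r0)) powRrM.
    apply: ge0_ler_powR; rewrite ?nnegrE ?invr_ge0 ?powR_ge0 ?fine_ge0 ?(ltW r0) //.
    by rewrite -lee_fin fineK ?ge0_fin_numE // -{1}(ger0_norm (g0 x)) gH.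
  + split => //; apply/Lpn_integral_lty => //; apply: le_lt_trans Hoo.
    apply: ge0_le_integral => //.
    * exact: measurable_normX.
    * move=> x _; rewrite ger0_norm // /G -powRrM mulVf ?gt_eqF // powRr1 ?fine_ge0 //.
      by have := H0 x; case: (H x) => //= *; rewrite ?leey.
  + by rewrite addr_ge0.
  + by move=> x Hx; exact: root_weight.
Qed.

(** The component u needs a weight that is bounded and works at every point. Capping at [m]
    preserves domination, because the convolution of a minimum is at most that of each term and the
    constant [m] is dominated too. On the null set off [D] the value is the cap itself, which no
    integral notices. *)
Lemma Lp_bounded_weight (alpha : R -> R) p g m : intg alpha -> (1 <= p)%E -> inLp p g ->
  (forall x, 0 <= g x) -> (forall x, g x <= m) ->
  exists G B c, [/\ forall x, g x <= G x, forall x, 0 <= G x, inLp p G, forall x, G x <= c &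
    0 <= B /\ forall x, intg (fun z => `|alpha z| * G (z + x)) /\
       \int[mu]_z (`|alpha z| * G (z + x)) <= B * G x].
Proof.
move=> ia p1 gp g0 gm; have m0 : 0 <= m by rewrite (le_trans (g0 0)).
have A0 : 0 <= \int[mu]_z `|alpha z| by apply: Rintegral_ge0.
have [D [G [B [mD Dae [gG G0 [mG Gy] B0 GB]]]]] := Lp_weight ia p1 gp g0.
have mGm : measurable_fun setT (fun x => Num.min (G x) m) by exact: measurable_minr.
pose G' x := m + \1_D x * (Num.min (G x) m - m).
have G'D x : D x -> G' x = Num.min (G x) m by move=> Dx; rewrite /G' indicE mem_set // mul1r addrC subrK.
have G'nD x : ~ D x -> G' x = m by move=> Dx; rewrite /G' indicE memNset // mul0r addr0.
have mG' : measurable_fun setT G'.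
  apply: measurable_funD => //; apply: measurable_funM; last exact: measurable_funB.
  exact: (measurable_indic mD).
have G'm x : G' x <= m.
  by have [Dx|Dx] := pselect (D x); [rewrite G'D // ge_min lexx orbT|rewrite G'nD].
have G'0 x : 0 <= G' x.
  by have [Dx|Dx] := pselect (D x); [rewrite G'D // le_min G0|rewrite G'nD].
have mna : measurable_fun setT (fun z => `|alpha z|).
  by apply: measurableT_comp => //; exact: intg_meas.
have sh (k : R -> R) x : measurable_fun setT k -> measurable_fun setT (fun z : R => `|alpha z| * k (z + x)).
  by move=> mk; apply: measurable_funM => //; apply: (measurableT_comp mk); exact: measurable_shift.
have ima : intg (fun z => m * `|alpha z|) by apply: intgZ; exact: intg_norm.
have iG' x : intg (fun z => `|alpha z| * G' (z + x)).
  apply: intg_dom ima; first exact: sh.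
  by move=> z; rewrite ger0_norm ?mulr_ge0 // mulrC ler_wpM2r.
have conv_m x : \int[mu]_z (`|alpha z| * G' (z + x)) <= (\int[mu]_z `|alpha z|) * m.
  rewrite mulrC -RiZ ?intg_norm //; apply: le_Ri => // z.
  by rewrite mulrC ler_wpM2r.
exists G', (B + \int[mu]_z `|alpha z|), m; split => //.
- by move=> x; have [Dx|Dx] := pselect (D x); [rewrite G'D // le_min gG // gm|rewrite G'nD].
- split => //; apply: (@le_lt_trans _ _ (1 * fine (Lpn p G))%:E); last by rewrite ltry.
  apply: Lpn_mono_ae => //; apply: ae_imp Dae => x Dx.
  by rewrite ger0_norm // mul1r G'D // ge_min lexx.
- split; first exact: addr_ge0.
  move=> x; split => //; have [Dx|Dx] := pselect (D x); last first.
    by apply: le_trans (conv_m x) _; rewrite G'nD // ler_wpM2r // lerDr.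
  have [iG hG] := GB x Dx; rewrite G'D //.
  have h1 : \int[mu]_z (`|alpha z| * G' (z + x)) <= B * G x.
    apply: le_trans hG; rewrite (@Ri_ae R _ (fun z => `|alpha z| * Num.min (G (z + x)) m)).
    + apply: le_Ri => //; last by move=> z; rewrite ler_wpM2l // ge_min lexx.
      apply: intg_dom iG; first exact: (sh (fun y => Num.min (G y) m)).
      by move=> z; rewrite ger0_norm ?mulr_ge0 ?le_min ?G0 // ler_wpM2l // ge_min lexx.
    + exact: sh.
    + exact: (sh (fun y => Num.min (G y) m)).
    + by apply: ae_imp (ae_shift x Dae) => z Dz; rewrite G'D.
  have [Gm|/ltW mleG] := leP (G x) m.
    by apply: le_trans h1 _; rewrite ler_wpM2r // lerDl.
  by apply: le_trans (conv_m x) _; rewrite ler_wpM2r // lerDr.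
Qed.

End Lp.

(** * Absolutely continuous representatives of Sobolev functions *)

Section Smooth.
Context {R : realType}.
Implicit Types (f g : R -> R) (n k : nat) (x s : R).

(** Peeling off the innermost derivative makes the closure properties plain inductions; [smoothP]
    translates to the form used by [test_fun]. *)
Fixpoint smooth n f : Prop :=
  if n is n'.+1 then (forall x, derivable f x 1) /\ smooth n' (derive1 f) else True.

Lemma smoothW n f : smooth n.+1 f -> smooth n f.
Proof.
elim: n f => // n IH f [df sf]; split => //; exact: IH.
Qed.

Lemma smoothP f : (forall n, smooth n f) -> forall n x, derivable (derive1n n f) x 1.
Proof.
move=> sf n; elim: n f sf => [|n IH] f sf x; first by have [] := sf 1%N.
by rewrite derive1Sn; apply: IH => m; have [] := sf m.+1.
Qed.

Lemma derive1_is f (f' : R -> R) : (forall x, is_derive x (1 : R) f (f' x)) ->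
  (forall x, derivable f x 1) /\ derive1 f = f'.
Proof.
move=> H; split=> [x|]; first exact: ex_derive.
by apply/funext => x; rewrite derive1E; exact: derive_val.
Qed.

Lemma smooth_is n f f' : (forall x, is_derive x (1 : R) f (f' x)) -> smooth n f' -> smooth n.+1 f.
Proof. by move=> /derive1_is[df E] sf; split => //; rewrite E. Qed.

Lemma smooth_derive n f : smooth n.+1 f -> forall x, is_derive x (1 : R) f (derive1 f x).
Proof. by move=> [df _] x; exact: (derivable_is_derive1 (df x)). Qed.

Lemma smooth_cst n (c : R) : smooth n (fun=> c).
Proof.
elim: n c => // n IH c; apply: (smooth_is (f' := fun=> 0)) => //.
Qed.

Lemma smoothD n f g : smooth n f -> smooth n g -> smooth n (fun x => f x + g x).
Proof.
elim: n f g => // n IH f g sf sg.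
apply: (smooth_is (f' := fun x => derive1 f x + derive1 g x)).
  move=> x; have := smooth_derive sf x; have := smooth_derive sg x => dg df.
  exact: is_deriveD.
by apply: IH; [have [] := sf|have [] := sg].
Qed.

Lemma smoothM n f g : smooth n f -> smooth n g -> smooth n (fun x => f x * g x).
Proof.
elim: n f g => // n IH f g sf sg.
apply: (smooth_is (f' := fun x => f x * derive1 g x + g x * derive1 f x)).
  move=> x; have := smooth_derive sf x; have := smooth_derive sg x => dg df.
  exact: is_deriveM.
by apply: smoothD; apply: IH => //; [exact: smoothW|have [] := sg|exact: smoothW|have [] := sf].
Qed.

Lemma smoothZ n c f : smooth n f -> smooth n (fun x => c * f x).
Proof. by move=> sf; apply: smoothM => //; exact: smooth_cst. Qed.

Lemma smoothV n f : (forall x, f x != 0) -> smooth n f -> smooth n (fun x => (f x)^-1).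
Proof.
move=> f0; elim: n => // n IH sf.
apply: (smooth_is (f' := fun x => - 1 * ((f x)^-1 * (f x)^-1) * derive1 f x)).
  move=> x; have df := smooth_derive sf x.
  have h := is_deriveV (f0 x) df.
  by apply: is_derive_eq; rewrite /GRing.scale /= expr2 invfM; ring.
have [_ sf'] := sf; have sV := IH (smoothW sf).
by apply: smoothM => //; apply: smoothZ; exact: smoothM.
Qed.

Lemma smooth_affine n f c d : smooth n f -> smooth n (fun x => f (c * x + d)).
Proof.
elim: n f => // n IH f sf.
apply: (smooth_is (f' := fun x => c * derive1 f (c * x + d))).
  move=> x; have df := smooth_derive sf (c * x + d).
  have da : is_derive x (1 : R) (fun x : R => c * x + d) c.
    by apply: is_derive_eq; rewrite /GRing.scale /=; ring.
  rewrite (mulrC c (derive1 f _)).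
  exact: (@is_derive1_comp R f (fun x : R => c * x + d) x _ _ df da).
by apply: smoothZ; apply: IH; have [] := sf.
Qed.

(* s^-k exp(-1/s) for s > 0, extended by 0: a family closed under differentiation *)
Definition flat k s : R := if 0 < s then (s^-1) ^+ k * expR (- s^-1) else 0.

Lemma flat_ge0 k s : 0 <= flat k s.
Proof. by rewrite /flat; case: ifP => // s0; rewrite mulr_ge0 ?expR_ge0 // exprn_ge0 // invr_ge0 ltW. Qed.

Lemma flat_le0 k s : s <= 0 -> flat k s = 0.
Proof. by rewrite /flat ltNge => ->. Qed.

Lemma flat_gt0 k s : 0 < s -> 0 < flat k s.
Proof. by move=> s0; rewrite /flat s0 mulr_gt0 ?expR_gt0 // exprn_gt0 // invr_gt0. Qed.

(** The term of order [k.+2] of the exponential series, taken at [s^-1], leaves the factor [s * s].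
    A quadratic bound is what gives derivative 0 at the origin. *)
Lemma flat_bound k s : `|flat k s| <= (k.+2)`!%:R * (s * s).
Proof.
rewrite ger0_norm ?flat_ge0 //; have [s0|s0] := leP s 0.
  by rewrite flat_le0 // mulr_ge0 // -expr2 sqr_ge0.
rewrite /flat s0; have y0 : 0 < s^-1 by rewrite invr_gt0.
have h : s^-1 ^+ k.+2 / (k.+2)`!%:R <= expR s^-1.
  by apply: le_trans (expR_ge1Dxn k.+1 (ltW y0)); rewrite lerDr.
have f0 : 0 < (k.+2)`!%:R :> R by rewrite ltr0n fact_gt0.
rewrite expRN ler_pdivrMr ?expR_gt0 //.
have -> : s^-1 ^+ k = (k.+2)`!%:R * (s * s) * (s^-1 ^+ k.+2 / (k.+2)`!%:R).
  by rewrite !exprS; move: (s^-1 ^+ k) => v; field; rewrite !gt_eqF.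
by rewrite ler_wpM2l // mulr_ge0 // -expr2 sqr_ge0.
Qed.

Lemma flat_derive k s : is_derive s (1 : R) (flat k) (flat k.+2 s - k%:R * flat k.+1 s).
Proof.
have [s0|s0|s0] := ltgtP s 0.
- rewrite !flat_le0 ?(ltW s0) // mulr0 subrr.
  apply: (@near_eq_is_derive _ _ _ (cst (0 : R))).
  near=> x; rewrite flat_le0 // ltW //; near: x; exact: lt_nbhsl.
- apply: (@near_eq_is_derive _ _ _ (fun x : R => (x^-1) ^+ k * expR (- x^-1))).
    near=> x; rewrite /flat ifT //; near: x; exact: lt_nbhsr.
  rewrite /flat s0.
  have s0' : s != 0 by rewrite gt_eqF.
  have dV : is_derive s (1 : R) (fun x : R => x^-1) (- (s^-1 * s^-1)).
    have h := @is_deriveV R id s 1 1 s0' (is_derive_id _ _).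
    by apply: is_derive_eq; rewrite /GRing.scale /= expr2 invfM; ring.
  have dX := @is_deriveX _ _ (fun x : R => x^-1) k s 1 _ dV.
  have dE : is_derive s (1 : R) (fun x : R => expR (- x^-1)) (expR (- s^-1) * (s^-1 * s^-1)).
    have dN : is_derive s (1 : R) (fun x : R => - x^-1) (s^-1 * s^-1).
      by have h := is_deriveN dV; apply: is_derive_eq; rewrite opprK.
    exact: (is_derive1_comp (is_derive_expR _) dN).
  rewrite exprfctE in dX; have h := is_deriveM dX dE.
  have E : s^-1 ^+ k *: (expR (- s^-1) * (s^-1 * s^-1)) +
      expR (- s^-1) *: ((k%:R * s^-1 ^+ k.-1) *: (- (s^-1 * s^-1))) =
      s^-1 ^+ k.+2 * expR (- s^-1) - k%:R * (s^-1 ^+ k.+1 * expR (- s^-1)).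
    rewrite /GRing.scale /= !exprS; case: k {dX h} => [|k] /=; last by rewrite !exprS; ring.
    by rewrite !mul0r expr0; ring.
  by rewrite -E.
- rewrite s0 !flat_le0 // mulr0 subrr.
  have H : h^-1 *: (flat k (h *: (1 : R) + 0) - flat k 0) @[h --> 0^'] --> (0 : R).
    apply/cvgrPdist_le => e e0; pose K : R := (k.+2)`!%:R.
    have K0 : 0 < K by rewrite ltr0n fact_gt0.
    exists (e / K) => /=; first by rewrite divr_gt0.
    move=> h /=; rewrite !sub0r !normrN => he h0.
    rewrite (flat_le0 k (lexx 0)) subr0 addr0 scaler1 normrM normfV.
    rewrite ler_pdivrMl ?normr_gt0 //; apply: le_trans (flat_bound k h) _.
    have -> : K * (h * h) = `|h| * (K * `|h|).
      by rewrite [RHS]mulrCA -normrM ger0_norm // -expr2 sqr_ge0.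
    by rewrite ler_wpM2l // mulrC -ler_pdivlMr // ltW.
  apply: DeriveDef; first by apply/cvg_ex; exists 0.
  by apply: cvg_lim.
Unshelve. all: by end_near. Qed.

Lemma flat_smooth n k : smooth n (flat k).
Proof.
elim: n k => // n IH k; apply: (smooth_is (flat_derive k)).
have := smoothD (IH k.+2) (smoothZ (- k%:R) (IH k.+1)).
by under [X in smooth _ X]eq_fun do rewrite mulNr.
Qed.

Definition step s : R := flat 0 s * (flat 0 s + flat 0 (1 - s))^-1.

Lemma step_den_gt0 s : 0 < flat 0 s + flat 0 (1 - s).
Proof.
have [s0|s0] := leP s 0.
  by rewrite ltr_wpDl ?flat_ge0 // flat_gt0 // subr_gt0 (le_lt_trans s0).
by rewrite ltr_pwDl ?flat_ge0 // flat_gt0.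
Qed.

Lemma step_smooth n : smooth n step.
Proof.
apply: smoothM; first exact: flat_smooth.
apply: smoothV; first by move=> x; rewrite gt_eqF // step_den_gt0.
apply: smoothD; first exact: flat_smooth.
have := smooth_affine (- 1) 1 (flat_smooth n 0).
by under [X in smooth _ X]eq_fun do rewrite mulN1r addrC.
Qed.

Lemma step_le0 s : s <= 0 -> step s = 0.
Proof. by move=> s0; rewrite /step flat_le0 // mul0r. Qed.

Lemma step_ge1 s : 1 <= s -> step s = 1.
Proof.
move=> s1; rewrite /step (flat_le0 0 (_ : 1 - s <= 0)) ?subr_le0 // addr0 mulfV //.
by rewrite gt_eqF // flat_gt0 // (lt_le_trans ltr01).
Qed.

Lemma step_norm s : `|step s| <= 1.
Proof.
rewrite /step normrM normfV (gtr0_norm (step_den_gt0 s)) ger0_norm ?flat_ge0 //.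
by rewrite ler_pdivrMr ?step_den_gt0 // mul1r lerDl flat_ge0.
Qed.

Lemma step_C1 : C1fun step.
Proof.
by have [d [d' _]] := step_smooth 2; exact: (conj d (derivable_continuous d')).
Qed.

Lemma derive_step_out s : s < 0 \/ 1 < s -> derive1 step s = 0.
Proof.
move=> [s0|s1]; rewrite derive1E.
  rewrite -(@near_eq_derive _ _ _ (cst (0 : R))) ?derive_cst //.
  by near=> x; rewrite step_le0 // ltW //; near: x; exact: lt_nbhsl.
rewrite -(@near_eq_derive _ _ _ (cst (1 : R))) ?derive_cst //.
by near=> x; rewrite step_ge1 // ltW //; near: x; exact: lt_nbhsr.
Unshelve. all: by end_near. Qed.

Lemma derive_step_bounded : exists2 C, 0 <= C & forall s, `|derive1 step s| <= C.
Proof.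
have [C C0 hC] := continuous_bounded_segment 0 1 step_C1.2.
exists C => // s; have [s0|s0] := ltP s 0; first by rewrite derive_step_out ?normr0 //; left.
have [s1|s1] := ltP 1 s; first by rewrite derive_step_out ?normr0 //; right.
by rewrite hC // s0.
Qed.

(* The rescaled step climbing from 0 to 1 on [a, a + h] *)
Definition rstep a h s : R := step (h^-1 * s + - (h^-1 * a)).

Lemma rstepE a h s : h^-1 * s + - (h^-1 * a) = h^-1 * (s - a). Proof. by rewrite mulrBr. Qed.

Lemma rstep_le a h s : 0 < h -> s <= a -> rstep a h s = 0.
Proof.
move=> h0 sa; rewrite /rstep rstepE step_le0 // pmulr_rle0 ?invr_gt0 // subr_le0 //.
Qed.

Lemma rstep_ge a h s : 0 < h -> a + h <= s -> rstep a h s = 1.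
Proof.
move=> h0 sa; rewrite /rstep rstepE step_ge1 // mulrC ler_pdivlMr // mul1r.
by rewrite lerBrDl.
Qed.

Lemma rstep_smooth n a h : smooth n (rstep a h).
Proof. exact: smooth_affine (step_smooth n). Qed.

Lemma derive_rstep a h s : derive1 (rstep a h) s = h^-1 * derive1 step (h^-1 * (s - a)).
Proof.
rewrite -rstepE derive1E.
have df : is_derive (h^-1 * s + - (h^-1 * a)) (1 : R) step
    (derive1 step (h^-1 * s + - (h^-1 * a))).
  by apply: derivable_is_derive1; exact: step_C1.1.
have da : is_derive s (1 : R) (fun x : R => h^-1 * x + - (h^-1 * a)) h^-1.
  by apply: is_derive_eq; rewrite /GRing.scale /=; ring.
have := @is_derive1_comp R step (fun x : R => h^-1 * x + - (h^-1 * a)) s _ _ df da.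
by move=> H; rewrite mulrC; exact: derive_val.
Qed.

Lemma derive_rstep_out a h s : 0 < h -> s < a \/ a + h < s -> derive1 (rstep a h) s = 0.
Proof.
move=> h0 hs; rewrite derive_rstep derive_step_out ?mulr0 //; case: hs => hs; [left|right].
  by rewrite pmulr_rlt0 ?invr_gt0 // subr_lt0.
by rewrite mulrC ltr_pdivlMr // mul1r ltrBrDl.
Qed.

Lemma rstep_C1 a h : C1fun (rstep a h).
Proof.
by have [d [d' _]] := rstep_smooth 2 a h; exact: (conj d (derivable_continuous d')).
Qed.

Lemma rstep_test y x h : 0 < h -> y <= x ->
  test_fun (fun s => rstep y h s + -1 * rstep x h s).
Proof.
move=> h0 yx; split.
  by apply: smoothP => n; apply: smoothD; [|apply: smoothZ]; exact: rstep_smooth.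
exists (`|y| + `|x| + h) => s; have [s0|s0] := leP 0 s.
  rewrite (ger0_norm s0) => hs; have := ler_norm x; have := ler_norm y.
  have := normr_ge0 x; have := normr_ge0 y.
  by move=> *; rewrite !rstep_ge //; lra.
rewrite (ltr0_norm s0) => hs; have := ler_norm (- x); have := ler_norm (- y); rewrite !normrN.
have := normr_ge0 x; have := normr_ge0 y.
by move=> *; rewrite !rstep_le //; lra.
Qed.

End Smooth.

(** * Averages and the continuous representative *)

Section Sobolev.
Context {R : realType}.
Local Notation mu := (@lebesgue_measure R).
Implicit Types (f g : R -> R) (x y h : R).

Lemma ker_supp y x f s : (s <= y \/ x < s -> f s = 0) -> ker y x s * f s = f s.
Proof.
rewrite /ker => h; have [|] := boolP ((y < s) && (s <= x)); first by rewrite mul1r.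
rewrite mul0r negb_and -leNgt -ltNge => /orP[sy|xs]; rewrite h //; by [left|right].
Qed.

Lemma intg_supp y x f : loc f -> (forall s, s <= y \/ x < s -> f s = 0) -> intg f.
Proof.
move=> [_ lf] hf; have := lf y x.
by under eq_fun do rewrite (ker_supp (hf _)).
Qed.

Lemma intg_drstep f x h : 0 < h -> loc f -> intg (fun s => derive1 (rstep x h) s * f s).
Proof.
move=> h0 lf; apply: (@intg_supp (x - 1) (x + h)).
  by apply: loc_mul_continuous => //; exact: (rstep_C1 x h).2.
move=> s hs; rewrite derive_rstep_out ?mul0r //.
by case: hs => hs; [left; lra|right].
Qed.

(* An average of [f] over [x, x + h]; differences of such averages are of the form occurring in
   [weak_deriv], as [rstep y h - rstep x h] is a test function. *)
Definition mol f h x := \int[mu]_s (derive1 (rstep x h) s * f s).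

Lemma mol_diff f g y x h : loc f -> loc g -> weak_deriv f g -> 0 < h -> y <= x ->
  mol f h x - mol f h y = \int[mu]_s ((rstep y h s - rstep x h s) * g s).
Proof.
move=> lf lg fg h0 yx.
have [d1 c1] := rstep_C1 y h; have [d2 c2] := rstep_C1 x h.
have E : derive1 (fun s => rstep y h s + -1 * rstep x h s) =
    (fun s => derive1 (rstep y h) s - derive1 (rstep x h) s).
  apply/funext => s; rewrite derive1E.
  have := derivable_is_derive1 (d1 s); have := derivable_is_derive1 (d2 s) => i2 i1.
  have i3 : is_derive s (1 : R) (fun s => rstep y h s + -1 * rstep x h s)
      (derive1 (rstep y h) s - derive1 (rstep x h) s).
    rewrite (_ : (fun _ => _) = rstep y h - rstep x h); first exact: is_deriveB.
    by apply/funext => z; rewrite mulN1r.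
  exact: derive_val.
have := fg _ (rstep_test h0 yx); rewrite E.
rewrite (_ : (fun s => _) =
  fun s => (derive1 (rstep y h) s * f s - derive1 (rstep x h) s * f s)%:E); last first.
  by apply/funext => s; congr _%:E; ring.
have i1 := intg_drstep y h0 lf; have i2 := intg_drstep x h0 lf.
have cont a : continuous (rstep a h) by exact: (derivable_continuous (rstep_C1 a h).1).
have i3 : intg (fun s => (rstep y h s - rstep x h s) * g s).
  apply: (@intg_supp y (x + h)).
    by apply: loc_mul_continuous => // s; apply: cvgB; exact: cont.
  move=> s [sy|xs]; first by rewrite !rstep_le ?subrr ?mul0r // (le_trans sy).
  by rewrite !rstep_ge ?subrr ?mul0r ?(ltW xs) // (le_trans _ (ltW xs)) // lerD2r.
rewrite (_ : (fun s => (g s * _)%:E) = fun s => ((rstep y h s - rstep x h s) * g s)%:E); last first.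
  by apply/funext => s; congr _%:E; ring.
rewrite -(RiE (intgB i1 i2)) -(RiE i3) -EFinN => -[].
by rewrite RiB // => e; rewrite /mol -[RHS]opprK -e opprB.
Qed.

(** [rstep y h - rstep x h] tends to the indicator of []y, x]] at every point, end points included,
    because [rstep a h] vanishes at [a] and is 1 from [a + h] on. With [h n <= 1] the difference is
    supported in []y, x + 1]], which provides the dominating function. *)
Lemma mol_diff_cvg f g y x (h : nat -> R) : loc f -> loc g -> weak_deriv f g -> y <= x ->
  (forall n, 0 < h n <= 1) -> h n @[n --> \oo] --> 0 ->
  (mol f (h n) x - mol f (h n) y) @[n --> \oo] --> \int[mu]_s (ker y x s * g s).
Proof.
move=> lf lg fg yx h01 hcvg.
have h0 n : 0 < h n by have /andP[] := h01 n.
under eq_fun do rewrite (mol_diff lf lg fg (h0 _) yx).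
have lk := lg.2 y (x + 1).
apply: fine_cvg; rewrite fineK; last by rewrite -RiE ?lg.2.
apply: (@dominated_cvg _ _ _ mu setT measurableT
  (fun n s => ((rstep y (h n) s - rstep x (h n) s) * g s)%:E) (fun s => (ker y x s * g s)%:E)
  (fun s => `|2 * (ker y (x + 1) s * g s)|%:E)) => //.
- move=> n; apply/measurable_EFinP; apply: measurable_funM; last exact: lg.1.
  by apply: measurable_funB; apply: continuous_measurable_fun;
    exact: (derivable_continuous (rstep_C1 _ _).1).
- move=> s _; apply: cvg_EFin; first exact: nearW.
  apply: cvgMl; apply: cvg_near_cst.
  rewrite /ker; have [sy|ys] := leP s y.
    by near=> n; rewrite !rstep_le ?subrr // (le_trans sy).
  have [sx|xs] /= := leP s x.
    near=> n; rewrite [X in _ - X]rstep_le // subr0 rstep_ge // -lerBrDl.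
    near: n; have sy0 : 0 < s - y by rewrite subr_gt0.
    by apply: cvgr_le hcvg _ sy0.
  near=> n; have hn : h n <= s - x.
    near: n; have sx0 : 0 < s - x by rewrite subr_gt0.
    by apply: cvgr_le hcvg _ sx0.
  by rewrite !rstep_ge ?subrr //; lra.
- exact: intg_norm (intgZ 2 lk).
- move=> n s _; rewrite lee_fin mulrA !normrM ler_wpM2r // -normrM.
  rewrite /ker; have [sy|ys] := leP s y.
    by rewrite !rstep_le ?subrr ?mulr0 // (le_trans sy).
  have [sx|xs] /= := leP s (x + 1).
    rewrite mulr1 [leRHS]ger0_norm //; apply: le_trans (ler_normB _ _) _.
    by have := step_norm ((h n)^-1 * s + - ((h n)^-1 * y));
       have := step_norm ((h n)^-1 * s + - ((h n)^-1 * x)); rewrite /rstep; lra.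
  have /andP[_ h1] := h01 n.
  by rewrite !rstep_ge ?subrr ?mulr0 ?normr0 //; lra.
Unshelve. all: by end_near. Qed.

Lemma mol_one x h : 0 < h -> mol (fun=> 1) h x = 1.
Proof.
move=> h0; have [_ H] := C1_prim (rstep_C1 x h).
rewrite /mol; under eq_Rintegral do rewrite mulr1.
have := H (x - 1) (x + h); rewrite rstep_ge // rstep_le ?subr0 //; last lra.
move=> ->; last lra.
apply: eq_Ri => s; rewrite ker_supp // => hs; rewrite derive_rstep_out //.
by case: hs => hs; [left; lra|right].
Qed.

Lemma mol_lebesgue f x (h : nat -> R) : loc f -> lebesgue_pt f x -> (forall n, 0 < h n) ->
  h n @[n --> \oo] --> 0 -> mol f (h n) x @[n --> \oo] --> f x.
Proof.
move=> lf fx h0 hcvg; have [C C0 hC] := @derive_step_bounded R.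
apply/cvgrPdist_le => e e0.
(* The kernel is at most [C / H] and supported in [[x, x + H]], inside the open ball of radius
   [2 * H]. That ball has measure [4 * H], so the error is at most [4 * C * e']. *)
pose e' := e / (4 * (C + 1)).
have e'0 : 0 < e' by rewrite divr_gt0 // mulr_gt0 // ltr_wpDl.
have : \forall r \near 0^'+, (davg f x r < e'%:E)%E.
  have := fx; rewrite /lebesgue_pt => /(_ [set y | (y < e'%:E)%E]); apply.
  apply: open_nbhs_nbhs; split; first exact: open_ereal_lt_ereal.
  by rewrite /= lte_fin.
rewrite near_withinE => -[d /= d0 hd].
near=> n.
have hd2 : h n < 2^-1 * d.
  by near: n; apply: cvgr_lt hcvg _ _; rewrite mulr_gt0 // invr_gt0.
have hn := h0 n; set H := h n in hn hd2 *.
have dav : (davg f x (2 * H) < e'%:E)%E.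
  apply: hd; last by rewrite mulr_gt0.
  by rewrite /= sub0r normrN gtr0_norm ?mulr_gt0 // -ltr_pdivlMl.
have i1 := intg_drstep x hn lf.
have i2 := intg_drstep x hn (loc_cst 1).
have i3 : intg (fun s => derive1 (rstep x H) s * f s - f x * (derive1 (rstep x H) s * 1)).
  by apply: intgB => //; exact: intgZ.
have -> : f x - mol f H x = - \int[mu]_s (derive1 (rstep x H) s * f s - f x * (derive1 (rstep x H) s * 1)).
  by rewrite RiB //; [rewrite RiZ // -/(mol (fun=> 1) H x) mol_one // mulr1 opprB|exact: intgZ].
rewrite normrN; apply: le_trans (le_normr_Rintegral measurableT i3) _.
rewrite -lee_fin RiE ?intg_norm //.
set D := ball x (2 * H).
have mD : measurable (D : set R) by exact: measurable_ball.
have mfx : measurable_fun setT (fun s => `|f s - f x|%:E).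
  by apply/measurable_EFinP; apply: measurableT_comp => //; apply: measurable_funB => //; exact: lf.1.
have mR : measurable_fun setT ((fun s => `|f s - f x|%:E) \_ D).
  by apply/(measurable_restrictT _ _).1 => //; exact: measurable_funS mfx.
have R0 s : (0 <= ((fun s => `|f s - f x|%:E) \_ D) s)%E by rewrite patchE; case: ifP.
apply: (@le_trans _ _ (\int[mu]_s ((H^-1 * C)%:E * ((fun s => `|f s - f x|%:E) \_ D) s))%E).
  apply: ge0_le_integral => //.
  - by apply/measurable_EFinP; apply: measurableT_comp => //; exact: intg_meas.
  - exact: measurable_funeM.
  - move=> s _; rewrite patchE; case: ifPn => sD.
      rewrite -EFinM lee_fin (_ : _ - _ = derive1 (rstep x H) s * (f s - f x)); last by ring.
      rewrite normrM ler_wpM2r // derive_rstep normrM ger0_norm ?invr_ge0 ?(ltW hn) //.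
      by rewrite ler_wpM2l ?invr_ge0 ?(ltW hn).
    rewrite mule0 derive_rstep_out ?mul0r ?mulr0 ?subrr ?normr0 //.
    apply: contrapT => /not_orP[/negP + /negP]; rewrite -!leNgt => xs sx.
    move: sD; rewrite notin_setE; apply.
    by rewrite /D /ball /= ltr_norml; apply/andP; split; lra.
rewrite ge0_integralZl //; last first.
  by rewrite lee_fin mulr_ge0 // invr_ge0 ltW.
rewrite -integral_mkcond.
move: dav; rewrite /davg /iavg lebesgue_measure_ball; last by rewrite mulr_ge0 // ltW.
rewrite inver gt_eqF; last by rewrite pmulrn_lgt0 // mulr_gt0.
rewrite lte_pdivrMl; last by rewrite pmulrn_lgt0 // mulr_gt0.
move=> /ltW dav; apply: le_trans (lee_wpmul2l _ dav) _.
  by rewrite lee_fin mulr_ge0 // invr_ge0 ltW.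
rewrite -!EFinM lee_fin.
rewrite (_ : _ * _ = e * (C / (C + 1))); last first.
  by rewrite /e'; field; rewrite !gt_eqF // ltr_wpDl.
rewrite -[leRHS]mulr1 ler_wpM2l ?(ltW e0) // ler_pdivrMr ?mul1r ?lerDl //.
by rewrite ltr_wpDl.
Unshelve. all: by end_near. Qed.

Lemma loc_locally_integrable f : loc f -> locally_integrable setT f.
Proof.
move=> [mf lf]; split => // [|K _ cK]; first exact: openT.
have [M [_ hM]] := compact_bounded cK.
have KM : K `<=` `](- (`|M| + 2)), (`|M| + 2)]%classic.
  move=> s Ks; have := hM (`|M| + 1) _ s Ks; rewrite /= in_itv /= => /(_ _)/wrap[].
    by have := ler_norm M; lra.
  by rewrite ler_norml; lra.
have mK : measurable (K : set R) by exact: compact_measurable.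
have mnf : measurable_fun setT (fun x => `|f x|%:E).
  by apply/measurable_EFinP; exact: measurableT_comp.
apply: le_lt_trans (ge0_subset_integral mu mK _ (measurable_funS _ _ mnf) _ KM) _ => //.
rewrite integral_mkcond.
have /intgP[_] := lf (- (`|M| + 2)) (`|M| + 2); congr (_ < _)%E.
apply: eq_integral => s _; rewrite patchE mem_setE /= in_itv /= normrM.
rewrite (ger0_norm (ker_ge0 _ _ _)) /ker; case: ifP; rewrite ?mul1r ?mul0r //.
Qed.

(** The averages converge at one Lebesgue point of [f] and their differences converge everywhere,
    hence they converge at every point; the limit [F] is a primitive of [g] and equals [f] at
    Lebesgue points. For the bound, [|F x|] is at most [|F r|] plus the integral of [|g|] over []x,
    x + 1]], and this is averaged over [r] in that interval. *)
Lemma sobolev_representative p f g : (1 <= p)%E -> inLp p f -> inLp p g -> weak_deriv f g ->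
  exists F m, [/\ prim F g, \forall x \ae mu, f x = F x & forall x, `|F x| <= m].
Proof.
move=> p1 fp gp fg.
have [lf [Cf hCf]] := Lp_uniformly_loc p1 fp; have [lg [Cg hCg]] := Lp_uniformly_loc p1 gp.
have leb := lebesgue_differentiation (loc_locally_integrable lf).
have [x0 hx0] : exists x0, lebesgue_pt f x0.
  apply: contrapT => /forallNP no; have [N [mN N0 hN]] := leb.
  have NT : N = setT by apply/seteqP; split => // x _; apply: hN; exact: no.
  by have := @lebesgue_measure_setT_gt0 R; rewrite -NT N0 ltxx.
pose h n : R := n.+1%:R^-1.
have h0 n : 0 < h n by rewrite invr_gt0.
have h01 n : 0 < h n <= 1 by rewrite h0 invf_le1 // ler1n.
have hcvg : h n @[n --> \oo] --> 0 by exact: cvg_harmonic.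
have cF x : cvgn (fun n => mol f (h n) x).
  have c0 := mol_lebesgue lf hx0 h0 hcvg.
  have [xx|/ltW xx] := leP x0 x; apply/cvg_ex.
    exists (\int[mu]_s (ker x0 x s * g s) + f x0).
    rewrite (_ : (fun n => mol f (h n) x) = fun n => mol f (h n) x - mol f (h n) x0 + mol f (h n) x0).
      exact: (cvgD (mol_diff_cvg lf lg fg xx h01 hcvg) c0).
    by apply/funext => n; rewrite subrK.
  exists (f x0 - \int[mu]_s (ker x x0 s * g s)).
  rewrite (_ : (fun n => mol f (h n) x) = fun n => mol f (h n) x0 - (mol f (h n) x0 - mol f (h n) x)).
    exact: (cvgB c0 (mol_diff_cvg lf lg fg xx h01 hcvg)).
  by apply/funext => n; rewrite opprB addrC subrK.
pose F : R -> R := fun x => limn (fun n => mol f (h n) x : R).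
have pF : prim F g.
  split => // y x yx; have c1 := mol_diff_cvg lf lg fg yx h01 hcvg.
  apply: (cvg_unique (@norm_hausdorff _ _) _ c1).
  by apply: cvgB; exact: cF.
have fF : \forall x \ae mu, f x = F x.
  apply: ae_imp leb => x hx.
  exact: (cvg_unique (@norm_hausdorff _ _) (mol_lebesgue lf hx h0 hcvg) (cF x)).
clearbody F; exists F, (Cf + Cg); split => // x.
have cFc := prim_continuous pF.
have lF : loc F by exact: loc_continuous.
have I1 : \int[mu]_r (ker x (x + 1) r * `|F r|) <= Cf.
  apply: le_trans (hCf x); rewrite le_eqVlt; apply/orP; left; apply/eqP.
  have mk (k : R -> R) : measurable_fun setT k -> measurable_fun setT (fun r => ker x (x + 1) r * `|k r|).
    by move=> ?; apply: measurable_funM; [exact: measurable_ker|exact: measurableT_comp].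
  apply: Ri_ae; [exact: mk lF.1|exact: mk lf.1|].
  by apply: ae_imp fF => r ->.
have -> : `|F x| = \int[mu]_r (`|F x| * ker x (x + 1) r).
  by rewrite RiZ ?intg_ker // Ri_ker ?lerDl // addrC addKr mulr1.
pose K := \int[mu]_r (ker x (x + 1) r * `|g r|).
have KCg : K <= Cg := hCg x.
apply: (@le_trans _ _ (\int[mu]_r (ker x (x + 1) r * `|F r| + K * ker x (x + 1) r))).
  apply: le_Ri.
  - by apply: intgZ; exact: intg_ker.
  - by apply: intgD; [exact: (loc_norm lF).2|apply: intgZ; exact: intg_ker].
  - move=> r; rewrite (mulrC _ `|F r|) -mulrDl /ker.
    have [/andP[xr rx]|_] := boolP ((x < r) && (r <= x + 1)); last by rewrite !mulr0.
    rewrite !mulr1; have h1 := ler_normD (F x - F r) (F r); rewrite subrK distrC in h1.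
    have h2 := prim_norm pF (ltW xr).
    have h3 : \int[mu]_s (ker x r s * `|g s|) <= K.
      apply: le_Ri; [exact: (loc_norm lg).2|exact: (loc_norm lg).2|].
      move=> s; by rewrite ler_wpM2r // -(ker_cat s (ltW xr) rx) lerDl ker_ge0.
    by move: h1 h2 h3; lra.
rewrite RiD; [|exact: (loc_norm lF).2|by apply: intgZ; exact: intg_ker].
rewrite RiZ; last exact: intg_ker.
by rewrite Ri_ker ?lerDl // (_ : x + 1 - x = 1) ?mulr1 ?lerD //; ring.
Qed.

End Sobolev.

(** * The four function spaces *)

Section Closure.
Context {R : realType}.
Local Notation mu := (@lebesgue_measure R).
Local Notation state := (bool * R -> R).
Implicit Types (S : state) (c : bool).

Definition cont_on c S := continuous (fun x : R => S (c, x)).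
Definition prim_on S := prim (fun x => S (true, x)) (fun x => S (false, x)).

Lemma bound_norm S (G : state) C : (forall i, 0 <= G i) -> (forall i, `|S i| <= C * G i) ->
  forall i, `|S i| <= `|C| * G i.
Proof. by move=> G0 h i; apply: le_trans (h i) _; rewrite ler_wpM2r // ler_norm. Qed.

Lemma cont_on_limit c (G : state) (m : R) (Sn : nat -> state) S (e : nat -> R) :
  (forall i, 0 <= G i) -> (forall x, G (c, x) <= m) -> (forall n, cont_on c (Sn n)) ->
  (forall n i, `|Sn n i - S i| <= e n * G i) -> e n @[n --> \oo] --> 0 -> cont_on c S.
Proof.
move=> G0 Gm cSn hS he x; apply/cvgrPdist_le => d d0.
have m0 : 0 <= m := le_trans (G0 (c, 0)) (Gm 0).
have d'0 : 0 < d / (3 * (m + 1)) by rewrite divr_gt0 // mulr_gt0 // ltr_wpDl.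
have /cvgrPdist_le/(_ _ d'0)[n _ /(_ n (leqnn n)) /=] := he; rewrite sub0r normrN => hn.
have near_n y : `|Sn n (c, y) - S (c, y)| <= d / 3.
  apply: le_trans (hS n (c, y)) _.
  apply: (@le_trans _ _ (d / (3 * (m + 1)) * m)).
    apply: le_trans (_ : `|e n| * G (c, y) <= _); first by rewrite ler_wpM2r // ler_norm.
    by rewrite ler_pM.
  have -> : d / (3 * (m + 1)) * m = d / 3 * (m / (m + 1)).
    by field; rewrite gt_eqF // ltr_wpDl.
  rewrite -[leRHS]mulr1 ler_wpM2l ?divr_ge0 ?(ltW d0) //.
  by rewrite ler_pdivrMr ?mul1r ?lerDl // ltr_wpDl.
have d3 : 0 < d / 3 by rewrite divr_gt0.
have /cvgrPdist_le/(_ _ d3) := cSn n x; apply: filterS => y hy.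
have h1 := near_n x; have h2 := near_n y; rewrite distrC in h1.
have -> : S (c, x) - S (c, y) = (S (c, x) - Sn n (c, x)) + (Sn n (c, x) - Sn n (c, y)) +
  (Sn n (c, y) - S (c, y)) by ring.
apply: le_trans (ler_normD _ _) _; have := ler_normD (S (c, x) - Sn n (c, x)) (Sn n (c, x) - Sn n (c, y)).
by move: hy h1 h2; lra.
Qed.

Lemma cont_on_J c (G : state) (m : R) (U : R -> state) t C : (forall i, 0 <= G i) ->
  (forall x, G (c, x) <= m) -> jmeas U -> 0 <= t ->
  (forall s i, 0 <= s <= t -> `|U s i| <= C * G i) -> (forall s, cont_on c (U s)) ->
  cont_on c (fun i => J (U^~ i) t).
Proof.
move=> G0 Gm mU t0 hU cU.
apply: (@kernel_continuous R (ker 0 t) (fun s x => U s (c, x)) (`|C| * m)) => //.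
- exact: intg_ker.
- by move=> x; exact: jmeas_time.
- move=> s x; rewrite normrM (ger0_norm (ker_ge0 _ _ _)) mulrC /ker.
  have [/andP[s0 st]|_] := boolP ((0 < s) && (s <= t)); last by rewrite !mulr0.
  rewrite !mulr1; have st' : 0 <= s <= t by rewrite (ltW s0).
  apply: le_trans (hU s _ st') _.
  apply: le_trans (_ : `|C| * G (c, x) <= _); first by rewrite ler_wpM2r // ler_norm.
  by rewrite ler_wpM2l.
Qed.

Lemma prim_on_limit (G : state) (Sn : nat -> state) S (e : nat -> R) :
  loc (fun x => G (false, x)) -> (forall n, prim_on (Sn n)) -> smeas S ->
  (forall n i, `|Sn n i - S i| <= e n * G i) -> e n @[n --> \oo] --> 0 -> prim_on S.
Proof.
move=> lG pS mS hS he; apply: (@prim_lim _ _ _ _ _ _ e pS _ lG (mS false)) => //.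
move=> x; apply/cvgrPdist_le => d d0.
have : e n * G (true, x) @[n --> \oo] --> 0.
  by rewrite -[X in _ --> X](mul0r (G (true, x))); apply: cvgMl.
move/cvgrPdist_le/(_ _ d0); apply: filterS => n; rewrite sub0r normrN distrC => h.
by apply: le_trans (hS n (true, x)) _; apply: le_trans (ler_norm _) h.
Qed.

Lemma prim_on_J (G : state) (U : R -> state) t C : (forall i, 0 <= G i) ->
  loc (fun x => G (false, x)) -> jmeas U -> 0 <= t ->
  (forall s i, 0 <= s <= t -> `|U s i| <= C * G i) -> (forall s, prim_on (U s)) ->
  prim_on (fun i => J (U^~ i) t).
Proof.
move=> G0 lG mU t0 hU pU.
have dom_le s i : `|ker 0 t s * U s i| <= C * G i * ker 0 t s.
  rewrite normrM (ger0_norm (ker_ge0 _ _ _)) mulrC /ker.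
  have [/andP[s0 st]|_] := boolP ((0 < s) && (s <= t)); last by rewrite !mulr0.
  by rewrite !mulr1 hU // (ltW s0).
have ik i : intg (fun s => ker 0 t s * U s i).
  apply: (intg_dom _ (dom_le^~ i)); last by apply: intgZ; exact: intg_ker.
  by apply: measurable_funM; [exact: measurable_ker|exact: jmeas_time].
refine (@kernel_prim R (ker 0 t) (fun s x => U s (true, x)) (fun s x => U s (false, x))
  (fun r => C * t * G (false, r)) (measurable_ker 0 t) (mU false) pU (fun x => ik (true, x))
  (locZ _ lG) _).
apply: aeW => r; split => //.
apply: le_trans (le_Ri (intg_norm (ik _)) _ (dom_le^~ (false, r))) _.
  by apply: intgZ; exact: intg_ker.
by rewrite RiZ ?intg_ker // Ri_ker // subr0 mulrAC.
Qed.

Lemma prim_shift (f g : R -> R) (a : R) : prim f g -> prim (fun x => f (a + x)) (fun x => g (a + x)).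
Proof.
move=> [[mg lg] hf]; have sh y x r : ker y x r = ker (a + y) (a + x) (a + r).
  by rewrite /ker ltrD2l lerD2l.
have mgc : measurable_fun setT (fun x => g (a + x)).
  by apply: (measurableT_comp mg); exact: measurable_funD.
have E y x : (fun r => ker y x r * g (a + r)) =
    (fun r => (fun q => ker (a + y) (a + x) q * g q) (r + a)).
  by apply/funext => r; rewrite sh (addrC a r).
split; first split=> // y x.
  by rewrite E; exact: (intg_shift a (lg (a + y) (a + x))).
move=> y x yx; rewrite hf ?lerD2l // E.
by rewrite (Ri_shift a (intg_meas (lg (a + y) (a + x)))).
Qed.

Variables (alpha w w1 : R -> R) (D : set R) (G : state) (g0 B : R).
Hypotheses (ialpha : intg alpha) (mw : measurable_fun setT w) (mw1 : measurable_fun setT w1).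
Hypotheses (wlip : locally_lipschitz w) (w1lip : locally_lipschitz w1) (w0 : w 0 = 0).
Hypotheses (mD : measurable D) (G_ge0 : forall i, 0 <= G i).
Hypothesis G_bnd : forall x, G (true, x) <= g0.
Hypothesis G_conv : forall i, dom D i -> intg (fun z => `|alpha z| * G (i.1, z + i.2)) /\
  \int[mu]_z (`|alpha z| * G (i.1, z + i.2)) <= B * G i.

Lemma kern_bound M C : exists2 X, 0 <= X & forall S, (forall x, `|S (true, x)| <= M) ->
  (forall i, `|S i| <= C * G i) -> forall c x z,
  `|kern w w1 S c x z| <= X * (G (c, z + x) + G (c, x)).
Proof.
have [X X0 hX] := kern_estimates wlip w1lip G_ge0 G_bnd M (lexx 0).
exists (X * `|C|); first by rewrite mulr_ge0.
move=> S hS hC c x z; have M0 : 0 <= M := le_trans (normr_ge0 _) (hS 0).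
have := hX S (fun=> 0) hS _ _ `|C| (normr_ge0 C) _ c x z; rewrite kern0 // subr0; apply.
- by move=> ?; rewrite normr0.
- by move=> ?; rewrite normr0 mul0r.
- by move=> i; rewrite subr0; exact: bound_norm.
Qed.

Lemma cont_on_field c m S M C : smeas S -> (forall x, `|S (true, x)| <= M) ->
  (forall i, `|S i| <= C * G i) -> (forall x, G (c, x) <= m) -> (forall x, dom D (c, x)) ->
  (forall z, continuous (fun x => kern w w1 S c x z)) -> cont_on c (field_op alpha w w1 D S).
Proof.
move=> mS hS hC Gm Dall ck; have [X X0 hX] := kern_bound M C.
rewrite /cont_on /field_op /=.
have -> : (fun x : R => (dom D (c, x))%:R * \int[mu]_z (alpha z * kern w w1 S c x z)) =
    (fun x : R => \int[mu]_z (alpha z * kern w w1 S c x z)).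
  by apply/funext => x; rewrite Dall mul1r.
apply: (@kernel_continuous R alpha (fun z x => kern w w1 S c x z) (X * (m + m))) => //.
- by move=> x; exact: kern_meas.
- move=> z x; rewrite normrM mulrC ler_wpM2r //; apply: le_trans (hX S hS hC c x z) _.
  by rewrite ler_wpM2l // lerD.
Qed.

(** The chain rule shows that the kernel of v is the x-derivative of that of u, and [kernel_prim]
    integrates this over z. Freezing v off [D] changes the derivative on a null set only. *)
Lemma prim_on_field S M C : smeas S -> (forall x, `|S (true, x)| <= M) ->
  (forall i, `|S i| <= C * G i) -> C1fun w -> w1 = derive1 w ->
  (\forall x \ae mu, D x) -> loc (fun x => G (false, x)) ->
  prim_on S -> prim_on (field_op alpha w w1 D S).
Proof.
move=> mS hS hC Cw w1E Dae lG pS; have [X X0 hX] := kern_bound M C.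
have conv c x : dom D (c, x) -> intg (fun z => alpha z * kern w w1 S c x z) /\
    \int[mu]_z `|alpha z * kern w w1 S c x z| <= X * (B + \int[mu]_z `|alpha z|) * G (c, x).
  move=> dx.
  have := weighted_conv_le ialpha G_conv X0 dx (kern_meas mw mw1 c x mS) (fun z => hX S hS hC c x z).
  exact.
have := @kernel_prim R alpha (fun z x => kern w w1 S true x z) (fun z x => kern w w1 S false x z)
  (fun r => X * (B + \int[mu]_z `|alpha z|) * G (false, r)) (intg_meas ialpha).
move=> /(_ _ _ _ _ _)/wrap[].
- have mk := kern_jmeas mw mw1 false (jmeas_cst mS).
  apply: (measurableT_comp mk (g := fun p : R * R => ((0 : R, p.2), p.1))).
  by apply: measurable_fun_pair => //; exact: measurable_fun_pair.
- move=> z; rewrite /kern w1E.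
  exact: (chain_prim Cw (primB (prim_shift z pS) pS)).
- by move=> x; have [] := conv true x isT.
- exact: locZ.
- by apply: ae_imp Dae => r Dr; apply: conv; rewrite /dom /= mem_set.
move=> hp; rewrite /prim_on /field_op /=.
have -> : (fun x : R => (dom D (true, x))%:R * \int[mu]_z (alpha z * kern w w1 S true x z)) =
    (fun x : R => \int[mu]_z (alpha z * kern w w1 S true x z)).
  by apply/funext => x; rewrite mul1r.
apply: (prim_ae hp).
  exact: (jmeas_slice 0 (jmeas_field ialpha mw mw1 mD (jmeas_cst mS)) false).
by apply: ae_imp Dae => x Dx; rewrite /dom /= mem_set // mul1r.
Qed.

End Closure.

(** * Norms of the four spaces and representatives of the data *)

Section Preliminaries.
Context {R : realType}.
Local Notation mu := (@lebesgue_measure R).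
Local Notation state := (bool * R -> R).
Implicit Types (f g w : R -> R) (p : \bar R).

Lemma C1_continuous w : C1fun w -> continuous w.
Proof. by move=> [dw _]; exact: derivable_continuous. Qed.

Lemma C1_locally_lipschitz w : C1fun w -> locally_lipschitz w.
Proof.
move=> [dw cw] M; have [L L0 hL] := continuous_bounded_segment (- M) M cw.
exists L => // x y; rewrite (ler_norml x) (ler_norml y) => /andP[x1 x2] /andP[y1 y2].
have [c /andP[c1 c2] ->] := MVT_dist y x dw.
rewrite normrM ler_wpM2r // hL //; apply/andP; split.
  by apply: le_trans c1; rewrite le_min y1 x1.
by apply: le_trans c2 _; rewrite ge_max y2 x2.
Qed.

Lemma C2_C1 w : C2fun w -> C1fun w /\ C1fun (derive1 w).
Proof.
move=> [dw [d2 c2]].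
exact: (conj (conj dw (derivable_continuous d2)) (conj d2 c2)).
Qed.

Lemma supn_le f (c : R) : (forall x, `|f x| <= c) -> (supn f <= c%:E)%E.
Proof. by move=> h; apply: ge_ereal_sup => _ [x _ <-]; rewrite lee_fin. Qed.

Lemma supn_ge0 f : (0 <= supn f)%E.
Proof.
apply: le_trans (_ : (`|f 0|%:E <= _)%E); first by rewrite lee_fin.
by apply: ereal_sup_ubound; exists 0.
Qed.

Lemma supn0 : supn (fun=> 0 : R) = 0%E.
Proof.
apply/eqP; rewrite eq_le supn_ge0 andbT; apply: supn_le => x.
by rewrite normr0.
Qed.

Lemma supn_bounded f : (supn f < +oo)%E -> exists m, forall x, `|f x| <= m.
Proof.
move=> fy; exists (fine (supn f)) => x; rewrite -lee_fin fineK; last first.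
  by rewrite ge0_fin_numE // supn_ge0.
by apply: ereal_sup_ubound; exists x.
Qed.

Lemma nC1b_le f g : (forall x : R, is_derive x (1 : R) f (g x)) ->
  (nC1b f <= supn f + supn g)%E.
Proof. by move=> h; apply: ereal_inf_lbound; exists g. Qed.

Lemma nC1b0 : nC1b (fun=> 0 : R) = 0%E.
Proof.
apply/eqP; rewrite eq_le; apply/andP; split.
  apply: le_trans (nC1b_le (g := fun=> 0) _) _.
  by rewrite supn0 adde0.
by apply: le_ereal_inf_tmp => _ [g _ <-]; rewrite adde_ge0 ?supn_ge0.
Qed.

Lemma nW1p_le p f g : weak_deriv f g -> (nW1p p f <= Lpn p f + Lpn p g)%E.
Proof. by move=> h; apply: ereal_inf_lbound; exists g. Qed.

(** [nW1p] is an infimum over weak derivatives, and 0 is one for a function that vanishes almost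
    everywhere. *)
Lemma nW1p_ae0 p f : (1 <= p)%E -> measurable_fun setT f -> (\forall x \ae mu, f x = 0) ->
  nW1p p f = 0%E.
Proof.
move=> p1 mf f0; apply/eqP; rewrite eq_le; apply/andP; split; last first.
  by apply: le_ereal_inf_tmp => _ [g _ <-]; rewrite adde_ge0 ?Lpn_ge0.
apply: le_trans (nW1p_le p (g := fun=> 0) _) _; last by rewrite Lpn_ae0 // Lpn0 // adde0.
move=> h [dh _]; under [X in _ = (- X)%E]eq_integral do rewrite mul0r.
rewrite integral0 oppe0 (ae_eq_integral (cst 0%E)) ?integral0 //.
  apply/measurable_EFinP; apply: measurable_funM => //; apply: continuous_measurable_fun.
  by apply: derivable_continuous; exact: (dh 1%N).
by refine (ae_imp _ f0) => x -> _; rewrite mul0r.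
Qed.

(** Pointwise estimates need data bounded at every point. The change on a null set is invisible to
    the norm in which the initial conditions are stated. *)
Lemma bounded_representative p f : (1 <= p)%E -> inLpI p f ->
  exists F m, [/\ inLp p F, \forall x \ae mu, F x - f x = 0 & forall x, `|F x| <= m].
Proof.
move=> p1 [[mf fp] [_ fy]]; pose m := fine (Lpn +oo%E f).
have m0 : 0 <= m by rewrite fine_ge0 // Lpn_ge0.
pose F x := if `|f x| <= m then f x else 0.
have mF : measurable_fun setT F.
  apply: measurable_fun_ifT => //; apply: measurable_fun_ler => //.
  exact: measurableT_comp.
exists F, m; split.
- split=> //.
  have [mnf nfp] := Lpn_norm (conj mf fp).
  apply: le_lt_trans (Lpn_mono (c := 1) p1 mF mnf _ _ nfp) _ => //.
    by move=> x; rewrite mul1r /F; case: ifP => // _; rewrite normr0.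
  by rewrite ltry.
- by refine (ae_imp _ (Lpn_y_ae fy)) => x h; rewrite /F h subrr.
- by move=> x; rewrite /F; case: ifP => // _; rewrite normr0.
Qed.

Definition pair_state f g : state := fun i => if i.1 then f i.2 else g i.2.

Lemma smeas_pair f g : measurable_fun setT f -> measurable_fun setT g -> smeas (pair_state f g).
Proof. by move=> mf mg []. Qed.

End Preliminaries.

(** * Spaces without a space derivative *)

Section Cases.
Context {R : realType}.
Local Notation mu := (@lebesgue_measure R).
Local Notation state := (bool * R -> R).
Variables (alpha w : R -> R) (a b : R).
Hypotheses (ialpha : intg alpha) (w0 : w 0 = 0).
Hypothesis growth : forall x, `|w x| <= a * `|x| + b.
Let A := \int[mu]_z `|alpha z|.

(** Reduces each space to three choices: a weight above the data, an invariant [Ex], and a bound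
    [c * N] of the norm by the weight. *)
Lemma weighted_global_sol (w1 : R -> R) (D : set R) (G : state) (g0 B N : R) (phi psi : state)
  (Ex : state -> Prop) (inX : (R -> R) -> Prop) (nX : (R -> R) -> \bar R) (f g : R -> R) :
  C1fun w -> measurable_fun setT w1 -> locally_lipschitz w1 ->
  measurable D -> (forall i, 0 <= G i) -> (forall x, G (true, x) <= g0) -> 0 <= B ->
  (forall i, dom D i -> intg (fun z => `|alpha z| * G (i.1, z + i.2)) /\
     \int[mu]_z (`|alpha z| * G (i.1, z + i.2)) <= B * G i) ->
  smeas phi -> smeas psi -> (forall i, `|phi i| <= G i) -> (forall i, `|psi i| <= G i) ->
  Ex (fun=> 0) -> Ex phi -> Ex psi ->
  (forall S S', Ex S -> Ex S' -> Ex (fun i => S i + S' i)) ->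
  (forall c S, Ex S -> Ex (fun i => c * S i)) ->
  (forall (Sn : nat -> state) S (e : nat -> R), (forall n, Ex (Sn n)) -> smeas S ->
     (forall n i, `|Sn n i - S i| <= e n * G i) -> e n @[n --> \oo] --> 0 -> Ex S) ->
  (forall S M C, smeas S -> (forall x, `|S (true, x)| <= M) -> (forall i, `|S i| <= C * G i) ->
     Ex S -> Ex (field_op alpha w w1 D S)) ->
  (forall U t C, jmeas U -> 0 <= t -> (forall s i, 0 <= s <= t -> `|U s i| <= C * G i) ->
     (forall s, Ex (U s)) -> Ex (fun i => J (U^~ i) t)) ->
  0 <= N ->
  (forall S c, Ex S -> smeas S -> 0 <= c -> (forall i, `|S i| <= c * G i) ->
     inX (fun x => S (true, x)) /\ (nX (fun x => S (true, x)) <= (c * N)%:E)%E) ->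
  nX (fun=> 0) = 0%E ->
  nX (fun x => phi (true, x) - f x) = 0%E -> nX (fun x => psi (true, x) - g x) = 0%E ->
  global_sol inX nX alpha w f g.
Proof.
move=> Cw mw1 w1lip mD G_ge0 G_bnd B0 G_conv mphi mpsi phi_le psi_le Ex0 Exphi Expsi ExD ExZ
  Exlim Exfield ExJ N0 hX n0 hf hg T T0.
have mw : measurable_fun setT w by apply: continuous_measurable_fun; exact: C1_continuous.
(* [a] and [b] come without a sign, whereas the a priori estimate wants nonnegative constants. *)
have growth' x : `|w x| <= `|a| * `|x| + `|b|.
  by apply: le_trans (growth x) _; rewrite lerD ?ler_norm // ler_wpM2r // ler_norm.
have [U [U1 [U2 [C [C0 data]]]]] := system_solution ialpha mw mw1 (C1_locally_lipschitz Cw)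
  w1lip w0 (normr_ge0 a) (normr_ge0 b) growth' mD G_ge0 G_bnd B0 G_conv (ltW T0) mphi mpsi
  phi_le psi_le Ex0 Exphi Expsi ExD ExZ Exlim Exfield ExJ.
exists (fun t x => U t (true, x)).
refine (solves_of_data (intg_meas ialpha) mw C0 N0 data ExD ExZ _ _ n0 hf hg) => S c ES mS.
  by move=> hS; have [] := hX S _ ES mS (normr_ge0 c) (bound_norm G_ge0 hS).
by move=> c0 hS; have [] := hX S c ES mS c0 hS.
Qed.

Lemma cst_weight c : intg (fun z => `|alpha z| * c) /\
  \int[mu]_z (`|alpha z| * c) <= A * c.
Proof.
have iA := intg_norm ialpha; rewrite (_ : (fun z => _) = fun z => c * `|alpha z|).
  by rewrite RiZ // mulrC; split=> //; exact: intgZ.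
by apply/funext => z; rewrite mulrC.
Qed.

Lemma lipschitz0 : locally_lipschitz (fun=> 0 : R).
Proof. by move=> M; exists 0 => // x y _ _; rewrite subrr normr0 mul0r. Qed.

Lemma global_sol_Cb phi psi : C1fun w -> inCb phi -> inCb psi ->
  global_sol (@inCb R) (@nCb R) alpha w phi psi.
Proof.
move=> Cw [cphi /supn_bounded[m1 h1]] [cpsi /supn_bounded[m2 h2]].
pose M := `|m1| + `|m2|; have M0 : 0 <= M by rewrite addr_ge0.
have hphi x : `|phi x| <= M by rewrite (le_trans (h1 x)) // (le_trans (ler_norm _)) // lerDl.
have hpsi x : `|psi x| <= M by rewrite (le_trans (h2 x)) // (le_trans (ler_norm _)) // lerDr.
clearbody M.
(* The weight 0 switches the component v off: it forces v to vanish identically. *)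
pose G := pair_state (fun=> M) (fun=> 0 : R); have G0 i : 0 <= G i by case: i => [[] x].
have Gc i : intg (fun z => `|alpha z| * G (i.1, z + i.2)) /\
    \int[mu]_z (`|alpha z| * G (i.1, z + i.2)) <= A * G i by case: i => [[] x]; exact: cst_weight.
have GM x : G (true, x) <= M by [].
have cw := C1_continuous Cw; have mw := continuous_measurable_fun cw.
have mw1 : measurable_fun setT (fun _ : R => 0 : R) by exact: measurable_cst.
apply: (@weighted_global_sol (fun=> 0) set0 G M A M (pair_state phi (fun=> 0))
  (pair_state psi (fun=> 0)) (cont_on true)) => //.
- exact: lipschitz0.
- exact: A_ge0.
- by apply: smeas_pair => //; exact: continuous_measurable_fun.
- by apply: smeas_pair => //; exact: continuous_measurable_fun.
- by case=> [[] x]; rewrite /G /pair_state //= normr0.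
- by case=> [[] x]; rewrite /G /pair_state //= normr0.
- by move=> x; exact: cvg_cst.
- by move=> S S' cS cS' x; apply: cvgD; [exact: cS|exact: cS'].
- by move=> c S cS x; apply: cvgMr; exact: cS.
- by move=> Sn S e cS _ hS he; exact: (@cont_on_limit R true G M Sn S e G0 GM cS hS he).
- move=> S L C mS hS hC cS.
  refine (cont_on_field ialpha mw mw1 (C1_locally_lipschitz Cw) lipschitz0 w0 G0
    GM mS hS hC GM (fun=> isT) _).
  move=> z; rewrite /kern => x; apply: continuous_comp; last exact: cw.
    apply: cvgB; last exact: cS.
    by apply: continuous_comp (cS _); apply: cvgD; [exact: cvg_cst|exact: cvg_id].
- by move=> U t C mU t0 hU cU; exact: (@cont_on_J R true G M U t C G0 GM mU t0 hU cU).
- move=> S c cS mS c0 hS; have le : (supn (fun x => S (true, x)) <= (c * M)%:E)%E.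
    by apply: supn_le => x; exact: (hS (true, x)).
  by split=> //; split=> //; apply: le_lt_trans le _; rewrite ltry.
- exact: supn0.
- by rewrite /nCb -[RHS]supn0; congr supn; apply/funext => x; rewrite subrr.
- by rewrite /nCb -[RHS]supn0; congr supn; apply/funext => x; rewrite subrr.
Qed.

(** Membership in the space asks only for measurability and a bound by the weight, so the invariant
    [Ex] is trivial. *)
Lemma global_sol_LpI p phi psi : C1fun w -> (1 <= p)%E -> inLpI p phi -> inLpI p psi ->
  global_sol (inLpI p) (nLpI p) alpha w phi psi.
Proof.
move=> Cw p1 hphi hpsi; have [mphi mpsi] : measurable_fun setT phi /\ measurable_fun setT psi.
  by split; [case: hphi => [[]]|case: hpsi => [[]]].
have [F1 [m1 [F1p F1E F1m]]] := bounded_representative p1 hphi.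
have [F2 [m2 [F2p F2E F2m]]] := bounded_representative p1 hpsi.
have [H [B [c0 [gH H0 Hp Hc [B0 HB]]]]] : exists H B c, [/\ forall x, `|F1 x| + `|F2 x| <= H x,
    forall x, 0 <= H x, inLp p H, forall x, H x <= c & 0 <= B /\
    forall x, intg (fun z => `|alpha z| * H (z + x)) /\
       \int[mu]_z (`|alpha z| * H (z + x)) <= B * H x].
  apply: (@Lp_bounded_weight R alpha p _ (m1 + m2)) => //.
  - by apply: LpnD => //; exact: Lpn_norm.
  - by move=> x; rewrite lerD.
have Hy : (Lpn +oo%E H < +oo)%E.
  apply: le_lt_trans (@Lpn_y_le R H c0 _) _; last by rewrite ltry.
  by apply: aeW => x; rewrite ger0_norm.
pose G := pair_state H (fun=> 0 : R); have G0 i : 0 <= G i by case: i => [[] x] //; exact: H0.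
have F1H x : `|F1 x| <= H x by apply: le_trans (gH x); rewrite lerDl.
have F2H x : `|F2 x| <= H x by apply: le_trans (gH x); rewrite lerDr.
have Gc i : intg (fun z => `|alpha z| * G (i.1, z + i.2)) /\
    \int[mu]_z (`|alpha z| * G (i.1, z + i.2)) <= (A + B) * G i.
  have A0 := A_ge0 alpha; case: i => [[] x]; rewrite /G /pair_state /=.
    by have [h1 h2] := HB x; split=> //; apply: le_trans h2 _; rewrite ler_wpM2r // lerDr.
  by have [h1] := cst_weight 0; rewrite !mulr0.
have nLpI0 (f F : R -> R) : measurable_fun setT f -> inLp p F -> (\forall x \ae mu, F x - f x = 0) ->
    nLpI p (fun x => F x - f x) = 0%E.
  move=> mf [mF _] h; have mFf : measurable_fun setT (fun x => F x - f x).
    exact: measurable_funB.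
  by rewrite /nLpI !Lpn_ae0 ?adde0 // leey.
apply: (@weighted_global_sol (fun=> 0) set0 G c0 (A + B)
  (fine (Lpn p H) + fine (Lpn +oo%E H)) (pair_state F1 (fun=> 0))
  (pair_state F2 (fun=> 0)) (fun=> True)) => //.
- exact: lipschitz0.
- by rewrite addr_ge0 // A_ge0.
- by apply: smeas_pair => //; exact: F1p.1.
- by apply: smeas_pair => //; exact: F2p.1.
- by case=> [[] x]; rewrite /G /pair_state //= normr0.
- by case=> [[] x]; rewrite /G /pair_state //= normr0.
- by rewrite addr_ge0 // fine_ge0 // Lpn_ge0.
- move=> S c _ mS c_ge0 hS; have y1 : (1 <= +oo :> \bar R)%E by rewrite leey.
  have h1 := Lpn_mono p1 (mS true) Hp.1 c_ge0 (fun x => hS (true, x)) Hp.2.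
  have h2 := Lpn_mono y1 (mS true) Hp.1 c_ge0 (fun x => hS (true, x)) Hy.
  split; last by rewrite mulrDr EFinD leeD.
  by split; (split; first exact: mS); [apply: le_lt_trans h1 _|apply: le_lt_trans h2 _]; rewrite ltry.
- by rewrite /nLpI !Lpn0 ?adde0 // leey.
- exact: nLpI0.
- exact: nLpI0.
Qed.

End Cases.

(** * Spaces with a space derivative *)

Section Sobolev.
Context {R : realType}.
Local Notation mu := (@lebesgue_measure R).
Local Notation state := (bool * R -> R).
Variables (alpha w : R -> R) (a b : R).
Hypotheses (ialpha : intg alpha) (w0 : w 0 = 0).
Hypothesis growth : forall x, `|w x| <= a * `|x| + b.
Let A := \int[mu]_z `|alpha z|.

Lemma cont_onD c (S S' : state) : cont_on c S -> cont_on c S' -> cont_on c (fun i => S i + S' i).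
Proof. by move=> cS cS' x; apply: cvgD; [exact: cS|exact: cS']. Qed.

Lemma cont_onZ c d (S : state) : cont_on c S -> cont_on c (fun i => d * S i).
Proof. by move=> cS x; apply: cvgMr; exact: cS. Qed.

Lemma kern_continuous (w1 : R -> R) c (S : state) z : continuous w -> continuous w1 ->
  cont_on true S -> cont_on false S -> continuous (fun x => kern w w1 S c x z).
Proof.
move=> cw cw1 c1 c2.
have sub d : cont_on d S -> continuous (fun x => S (d, z + x) - S (d, x)).
  move=> cS x; apply: cvgB; last exact: cS.
  by apply: continuous_comp (cS _); apply: cvgD; [exact: cvg_cst|exact: cvg_id].
have comp (v : R -> R) : continuous v -> continuous (fun x => v (S (true, z + x) - S (true, x))).
  by move=> cv x; apply: continuous_comp; [exact: (sub true c1)|exact: cv].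
case: c; rewrite /kern => x; first exact: (comp w cw).
by apply: cvgM; [exact: (comp w1 cw1)|exact: (sub false c2)].
Qed.

Lemma global_sol_C1b phi psi : C2fun w -> inC1b phi -> inC1b psi ->
  global_sol (@inC1b R) (@nC1b R) alpha w phi psi.
Proof.
move=> /C2_C1[Cw Cw1].
move=> [dphi [[cphi /supn_bounded[m1 h1]] [cphi' /supn_bounded[m2 h2]]]].
move=> [dpsi [[cpsi /supn_bounded[m3 h3]] [cpsi' /supn_bounded[m4 h4]]]].
have [M0 e1 e2 e3 e4] := le_sum4 (normr_ge0 m1) (normr_ge0 m2) (normr_ge0 m3) (normr_ge0 m4).
have bd (f : R -> R) m n : (forall x, `|f x| <= m) -> `|m| <= n -> forall x, `|f x| <= n.
  by move=> h mn x; apply: le_trans (h x) (le_trans (ler_norm m) mn).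
have {h1}h1 := bd _ _ _ h1 e1; have {h2}h2 := bd _ _ _ h2 e2.
have {h3}h3 := bd _ _ _ h3 e3; have {h4}h4 := bd _ _ _ h4 e4.
move: (_ + _) M0 h1 h2 h3 h4 => M M0 h1 h2 h3 h4 {bd e1 e2 e3 e4}.
have M00 i : 0 <= (fun _ : bool * R => M) i by [].
have GM c (x : R) : (fun _ : bool * R => M) (c, x) <= M by [].
have cw := C1_continuous Cw; have mw := continuous_measurable_fun cw.
have cw1 := C1_continuous Cw1; have mw1 := continuous_measurable_fun cw1.
have lM : loc (fun _ : R => M) := loc_cst M.
have domT c (x : R) : dom setT (c, x) by rewrite /dom in_setT orbT.
have Gc (i : bool * R) : dom setT i -> intg (fun z => `|alpha z| * M) /\
    \int[mu]_z (`|alpha z| * M) <= A * M by move=> _; exact: cst_weight.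
(* Continuity of v is what upgrades the primitive relation to a classical derivative at every
   point. *)
pose Ex (S : state) := [/\ cont_on true S, cont_on false S & prim_on S].
have P1 := C1_prim (conj dphi cphi'); have P2 := C1_prim (conj dpsi cpsi').
have mphi := smeas_pair (continuous_measurable_fun cphi) (continuous_measurable_fun cphi').
have mpsi := smeas_pair (continuous_measurable_fun cpsi) (continuous_measurable_fun cpsi').
have wl := C1_locally_lipschitz Cw; have w1l := C1_locally_lipschitz Cw1.
have phiM i : `|pair_state phi (derive1 phi) i| <= M by case: i => [[] x]; [exact: h1|exact: h2].
have psiM i : `|pair_state psi (derive1 psi) i| <= M by case: i => [[] x]; [exact: h3|exact: h4].
refine (@weighted_global_sol R alpha w a b ialpha w0 growth (derive1 w) setT (fun=> M) M A (M + M)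
  (pair_state phi (derive1 phi)) (pair_state psi (derive1 psi)) Ex _ _ _ _ Cw mw1 w1l measurableT
  M00 (GM true) (A_ge0 alpha) Gc mphi mpsi phiM psiM _ (And3 cphi cphi' P1) (And3 cpsi cpsi' P2)
  _ _ _ _ _ (addr_ge0 M0 M0) _ nC1b0 _ _).
- by split; [move=> x; exact: cvg_cst|move=> x; exact: cvg_cst|exact: prim_cst].
- move=> S S' [c1 c2 p] [c1' c2' p']; split; [exact: cont_onD|exact: cont_onD|exact: (primD p p')].
- by move=> c S [c1 c2 p]; split; [exact: cont_onZ|exact: cont_onZ|exact: (primZ c p)].
- move=> Sn S e ESn mS hS he; split.
  + by apply: (@cont_on_limit R true (fun=> M) M Sn S e M00 (GM true) _ hS he) => n; case: (ESn n).
  + by apply: (@cont_on_limit R false (fun=> M) M Sn S e M00 (GM false) _ hS he) => n; case: (ESn n).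
  + by apply: (@prim_on_limit R (fun=> M) Sn S e lM _ mS hS he) => n; case: (ESn n).
- move=> S L C mS hS hC [c1 c2 p].
  split.
  + refine (@cont_on_field R alpha w (derive1 w) setT (fun=> M) M ialpha mw mw1 wl w1l w0 M00
      (GM true) true M S L C mS hS hC (GM true) (domT true)
      (fun z => @kern_continuous (derive1 w) true S z cw cw1 c1 c2)).
  + refine (@cont_on_field R alpha w (derive1 w) setT (fun=> M) M ialpha mw mw1 wl w1l w0 M00
      (GM true) false M S L C mS hS hC (GM false) (domT false)
      (fun z => @kern_continuous (derive1 w) false S z cw cw1 c1 c2)).
  + refine (@prim_on_field R alpha w (derive1 w) setT (fun=> M) M A ialpha mw mw1 wl w1l w0
      measurableT M00 (GM true) Gc S L C mS hS hC Cw erefl _ lM p).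
    exact: aeW.
- move=> U t C mU t0 hU EU; split.
  + by apply: (@cont_on_J R true (fun=> M) M U t C M00 (GM true) mU t0 hU) => s; case: (EU s).
  + by apply: (@cont_on_J R false (fun=> M) M U t C M00 (GM false) mU t0 hU) => s; case: (EU s).
  + by apply: (@prim_on_J R (fun=> M) U t C M00 lM mU t0 hU) => s; case: (EU s).
- move=> S c [c1 c2 p] mS c0 hS.
  have dS x : is_derive x (1 : R) (fun x => S (true, x)) (S (false, x)).
    by apply: (prim_is_derive p); exact: c2.
  have le d : (supn (fun x => S (d, x)) <= (c * M)%:E)%E.
    by apply: supn_le => x; exact: (hS (d, x)).
  have fin d : (supn (fun x => S (d, x)) < +oo)%E by apply: le_lt_trans (le d) _; rewrite ltry.
  split; last by apply: le_trans (nC1b_le dS) _; rewrite mulrDr EFinD leeD.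
  split; first by move=> x; have [] := dS x.
  split; first by split.
  rewrite (_ : derive1 _ = fun x => S (false, x)); first by split.
  by apply/funext => x; rewrite derive1E; have [] := dS x.
- by rewrite -[RHS](@nC1b0 R); congr nC1b; apply/funext => x; rewrite subrr.
- by rewrite -[RHS](@nC1b0 R); congr nC1b; apply/funext => x; rewrite subrr.
Qed.

Lemma global_sol_W1p p phi psi : C2fun w -> (1 <= p)%E -> inW1p p phi -> inW1p p psi ->
  global_sol (inW1p p) (nW1p p) alpha w phi psi.
Proof.
move=> /C2_C1[Cw Cw1] p1 [phip [g1 [g1p wd1]]] [psip [g2 [g2p wd2]]].
have [F1 [m1 [P1 E1 M1]]] := sobolev_representative p1 phip g1p wd1.
have [F2 [m2 [P2 E2 M2]]] := sobolev_representative p1 psip g2p wd2.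
have rep f F g : inLp p f -> prim F g -> (\forall x \ae mu, f x = F x) ->
    inLp p F /\ \forall x \ae mu, F x - f x = 0.
  move=> [mf fy] PF fF; split; last by refine (ae_imp _ fF) => x ->; rewrite subrr.
  have mF : measurable_fun setT F.
    by apply: continuous_measurable_fun; exact: prim_continuous PF.
  have [mnf nfy] := Lpn_norm (conj mf fy); split=> //.
  refine (le_lt_trans (Lpn_mono_ae (c := 1) p1 mF mnf ler01 _ nfy) _); last by rewrite ltry.
  by refine (ae_imp _ fF) => x ->; rewrite mul1r.
have [F1p D1] := rep _ _ _ phip P1 E1; have [F2p D2] := rep _ _ _ psip P2 E2.
have [H [B [c0 [gH H0 Hp Hc [B0 HB]]]]] : exists H B c, [/\ forall x, `|F1 x| + `|F2 x| <= H x,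
    forall x, 0 <= H x, inLp p H, forall x, H x <= c & 0 <= B /\
    forall x, intg (fun z => `|alpha z| * H (z + x)) /\
       \int[mu]_z (`|alpha z| * H (z + x)) <= B * H x].
  apply: (@Lp_bounded_weight R alpha p _ (m1 + m2)) => //.
  - by apply: LpnD => //; exact: Lpn_norm.
  - by move=> x; rewrite lerD.
have [D [K [B' [mD Dae [gK K0 Kp B'0 KB]]]]] : exists D K B, [/\ measurable D,
    \forall x \ae mu, D x & [/\ forall x, D x -> `|g1 x| + `|g2 x| <= K x,
    forall x, 0 <= K x, inLp p K, 0 <= B & forall x, D x ->
    intg (fun z => `|alpha z| * K (z + x)) /\ \int[mu]_z (`|alpha z| * K (z + x)) <= B * K x]].
  apply: (@Lp_weight R alpha p) => //.
  by apply: LpnD => //; exact: Lpn_norm.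
have [lK _] := Lp_uniformly_loc p1 Kp.
(* The weight [K] of v dominates the weak derivatives on [D] only, so they are set to 0 elsewhere.
   They remain derivatives of [F1] and [F2], the change being on a null set. *)
pose cut (g : R -> R) x := \1_D x * g x.
have mcut g : measurable_fun setT g -> measurable_fun setT (cut g).
  by move=> mg; apply: measurable_funM => //; exact: measurable_indic.
have cutE g x : D x -> cut g x = g x by move=> Dx; rewrite /cut indicE mem_set // mul1r.
have cut_prim F g : prim F g -> prim F (cut g).
  move=> PF; apply: (prim_ae PF); first by apply: mcut; exact: PF.1.1.
  by refine (ae_imp _ Dae) => x Dx; rewrite cutE.
have cut_le g x : (D x -> `|g x| <= K x) -> `|cut g x| <= K x.
  rewrite /cut indicE; have [/set_mem Dx|_] := boolP (x \in D) => h; first by rewrite mul1r h.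
  by rewrite mul0r normr0.
pose G := pair_state H K; have G0 i : 0 <= G i by case: i => [[] x]; [exact: H0|exact: K0].
have GH x : G (true, x) <= c0 by exact: Hc.
have lG : loc (fun x => G (false, x)) by [].
have Gc i : dom D i -> intg (fun z => `|alpha z| * G (i.1, z + i.2)) /\
    \int[mu]_z (`|alpha z| * G (i.1, z + i.2)) <= (B + B') * G i.
  case: i => [[] x] /=.
    by move=> _; have [h1 h2] := HB x; split=> //; apply: le_trans h2 _; rewrite ler_wpM2r // lerDl.
  move=> /set_mem Dx; have [h1 h2] := KB x Dx; split=> //; apply: le_trans h2 _.
  by rewrite ler_wpM2r // lerDr.
have cw := C1_continuous Cw; have mw := continuous_measurable_fun cw.
have cw1 := C1_continuous Cw1; have mw1 := continuous_measurable_fun cw1.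
have wl := C1_locally_lipschitz Cw; have w1l := C1_locally_lipschitz Cw1.
have F1H x : `|F1 x| <= H x by apply: le_trans (gH x); rewrite lerDl.
have F2H x : `|F2 x| <= H x by apply: le_trans (gH x); rewrite lerDr.
have g1K x : `|cut g1 x| <= K x by apply: cut_le => Dx; apply: le_trans (gK x Dx); rewrite lerDl.
have g2K x : `|cut g2 x| <= K x by apply: cut_le => Dx; apply: le_trans (gK x Dx); rewrite lerDr.
have zero F f : inLp p F -> inLp p f -> (\forall x \ae mu, F x - f x = 0) ->
    nW1p p (fun x => F x - f x) = 0%E.
  by move=> [mF _] [mf _] h; apply: nW1p_ae0 => //; exact: measurable_funB.
apply: (@weighted_global_sol R alpha w a b ialpha w0 growth (derive1 w) D G c0 (B + B')
  (fine (Lpn p H) + fine (Lpn p K))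
  (pair_state F1 (cut g1)) (pair_state F2 (cut g2)) prim_on) => //.
- by rewrite addr_ge0.
- by apply: smeas_pair; [exact: F1p.1|apply: mcut; exact: g1p.1].
- by apply: smeas_pair; [exact: F2p.1|apply: mcut; exact: g2p.1].
- by case=> [[] x]; [exact: F1H|exact: g1K].
- by case=> [[] x]; [exact: F2H|exact: g2K].
- exact: prim_cst.
- exact: (cut_prim F1 g1).
- exact: (cut_prim F2 g2).
- by move=> S S'; exact: primD.
- by move=> c S; exact: primZ.
- by move=> Sn S e pS mS hS he; exact: (@prim_on_limit R G Sn S e lG pS mS hS he).
- move=> S L C mS hS hC pS.
  exact: (prim_on_field ialpha mw mw1 wl w1l w0 mD G0 GH Gc mS hS hC Cw erefl Dae lG pS).
- by move=> U t C mU t0 hU pU; exact: (@prim_on_J R G U t C G0 lG mU t0 hU pU).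
- by rewrite addr_ge0 // fine_ge0 // Lpn_ge0.
- move=> S c pS mS c_ge0 hS.
  have h1 := Lpn_mono p1 (mS true) Hp.1 c_ge0 (fun x => hS (true, x)) Hp.2.
  have h2 := Lpn_mono p1 (mS false) Kp.1 c_ge0 (fun x => hS (false, x)) Kp.2.
  have wd := prim_weak_deriv pS.
  split; last by apply: le_trans (nW1p_le p wd) _; rewrite mulrDr EFinD leeD.
  split; first by split; [exact: mS|apply: le_lt_trans h1 _; rewrite ltry].
  exists (fun x => S (false, x)); split=> //.
  by split; [exact: mS|apply: le_lt_trans h2 _; rewrite ltry].
- by apply: nW1p_ae0 => //; apply: aeW.
- exact: zero.
- exact: zero.
Qed.

End Sobolev.

Theorem theorem4p2 (R : realType) (alpha w : R -> R) (a b : R) :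
  measurable_fun [set: R] alpha ->
  (@lebesgue_measure R).-integrable [set: R] (EFin \o alpha) ->
  w 0 = 0 ->
  (forall eta : R, `|w eta| <= a * `|eta| + b) ->
  [/\ (C1fun w -> forall phi psi, inCb phi -> inCb psi ->
         global_sol (@inCb R) (@nCb R) alpha w phi psi),
      (C1fun w -> forall p : \bar R, (1 <= p)%E -> forall phi psi,
         inLpI p phi -> inLpI p psi ->
         global_sol (inLpI p) (nLpI p) alpha w phi psi),
      (C2fun w -> forall phi psi, inC1b phi -> inC1b psi ->
         global_sol (@inC1b R) (@nC1b R) alpha w phi psi) &
      (C2fun w -> forall p : \bar R, (1 <= p)%E -> forall phi psi,
         inW1p p phi -> inW1p p psi ->
         global_sol (inW1p p) (nW1p p) alpha w phi psi)].
Proof.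
move=> _ ialpha w0 growth; split.
- by move=> Cw phi psi; exact: global_sol_Cb ialpha w0 growth _ _ Cw.
- by move=> Cw p p1 phi psi; exact: global_sol_LpI ialpha w0 growth _ _ _ Cw p1.
- by move=> Cw phi psi; exact: global_sol_C1b ialpha w0 growth _ _ Cw.
- by move=> Cw p p1 phi psi; exact: global_sol_W1p ialpha w0 growth _ _ _ Cw p1.
Qed.
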